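(* Let $\Pi$ be any stationary job assignment policy for the system $\mathcal{M}_N$ with separate queues. If $Z^{(N)}(0)\le R^{(N,\Pi)}(0)$, then the processes $Z^{(N)}$ and $\mathbf{X}^{(N,\Pi)}$ can be constructed on the same probability space such that $Z^{(N)}(t)\le R^{(N,\Pi)}(t)$ for all $t\ge 0$; that is, $Z^{(N)}(t)\le_{st} R^{(N,\Pi)}(t)$, where $\le_{st}$ denotes stochastic dominance.
   Context: Parameters: $M\in\{1,2,\dots\}$; service rates $\mu_1>\mu_2>\dots>\mu_M>0$; proportions $\gamma_1,\dots,\gamma_M\in(0,1]$ with $\sum_j\gamma_j=1$ and $\sum_j\gamma_j\mu_j=1$; $\lambda>0$; $N$ is a positive integer with $N\gamma_j\in\{1,2,\dots\}$ for all $j\in[M]=\{1,\dots,M\}$. Write $(x)_+=\max(x,0)$ and $\mathbb{Z}_+=\{0,1,2,\dots\}$. System $\mathcal{M}_N$: $N$ servers, $N\gamma_j$ of them of type $j$ with service rate $\mu_j$, each with its own infinite-buffer FCFS queue. Jobs arrive as a Poisson process of rate $N\lambda$, have i.i.d. exponential sizes of mean $1$ (independent of arrivals), and each is assigned on arrival to one server. A stationary policy $\Pi$ assigns each arriving job (possibly at random) depending only on the current state: with $X_{i,j}$ the number of type $j$ servers having at least $i$ jobs (including the one in service), $X_{0,j}=N\gamma_j$, the process $\mathbf{X}^{(N,\Pi)}=(X^{(N,\Pi)}_{i,j}(t),i\ge1,j\in[M];t\ge0)$ is a continuous-time Markov chain that, from state $\mathbf{X}$, jumps to $\mathbf{X}+\mathbf{e}_{i,j}$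 at rate $N\lambda\,a^{\Pi}_{i,j}(\mathbf{X})$ and to $\mathbf{X}-\mathbf{e}_{i,j}$ at rate $\mu_j(X_{i,j}-X_{i+1,j})$, where $a^\Pi_{i,j}(\mathbf{X})\ge0$ is the probability that an arriving job is sent to a type $j$ server with exactly $i-1$ jobs, $\sum_{i,j}a^\Pi_{i,j}(\mathbf{X})=1$, and $a^\Pi_{i,j}(\mathbf{X})=0$ if $X_{i-1,j}=X_{i,j}$. $R^{(N,\Pi)}(t)=\sum_{i\ge1,j\in[M]}X^{(N,\Pi)}_{i,j}(t)$ is the total number of jobs, assumed finite at time $0$. Resource pooled system $\mathcal{M}_N'$ under the Join-the-Fastest-Free-Server (JFFS) policy: same servers and same arrival and job-size assumptions, but with one central queue; a waiting job is always given to the fastest idle server. The total number of jobs $Z^{(N)}(t)\in\mathbb{Z}_+$ is the Markov chain with transition rates $k\to k+1$ at rate $N\lambda$ and $k\to k-1$ at rate $\sum_{j\in[M]}\mu_j\min\big((k-\sum_{i=1}^{j-1}N\gamma_i)_+,N\gamma_j\big)$. *)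

(* Defs.v *)
From HB Require Import structures.
From mathcomp Require Import all_boot all_order all_algebra.
From mathcomp Require Import all_classical all_reals all_analysis.

Set Implicit Arguments.
Unset Strict Implicit.
Unset Printing Implicit Defensive.

Import Order.TTheory GRing.Theory Num.Theory numFieldNormedType.Exports.

Local Open Scope classical_set_scope.
Local Open Scope ring_scope.

Section MarkovChain.
Context {R : realType} {S : choiceType}.

(* Honest transition functions with transition rates [q].  Only the
   off-diagonal entries of [q] matter; the rate of leaving [x] is the sum of
   [q x y] over [y != x] (no rate is lost to infinity). *)
Record transition_function (q : S -> S -> R) (p : R -> S -> S -> R) : Prop := {
  tf_ge0 : forall t x y, 0 <= t -> 0 <= p t x y;
  tf_sum1 : forall t x, 0 <= t ->
    (\esum_(y in [set: S]) (p t x y)%:E = 1)%E;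
  tf_init : forall x y, p 0 x y = (x == y)%:R;
  tf_semigroup : forall s t x z, 0 <= s -> 0 <= t ->
    ((p (s + t) x z)%:E = \esum_(y in [set: S]) (p s x y * p t y z)%:E)%E;
  tf_rate : forall x y, x != y -> p h x y / h @[h --> 0^'+] --> q x y;
  tf_exit : forall x,
    ((1 - p h x x) / h)%:E @[h --> 0^'+] -->
      \esum_(y in [set y | y != x]) (q x y)%:E }.

(* Right-continuous with left limits, for the discrete topology on [S]. *)
Definition cadlag_path (f : R -> S) : Prop :=
  (forall t, 0 <= t -> \forall s \near t^'+, f s = f t) /\
  (forall t, 0 < t -> exists x, \forall s \near t^'-, f s = x).

(* [X] restricted to times [t >= 0] is a time-homogeneous continuous-time
   Markov chain with transition rates [q].  The Markov property is written in
   product form, so that conditioning on null events is never needed. *)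
Definition ctmc (d : measure_display) (Om : measurableType d)
    (P : probability Om R) (q : S -> S -> R) (X : R -> Om -> S) : Prop :=
  [/\ forall t x, 0 <= t -> measurable [set w | X t w = x],
      forall w, cadlag_path (X ^~ w) &
      exists2 p, transition_function q p &
        forall (n : nat) (t : nat -> R) (x : nat -> S),
          0 <= t 0%N -> (forall k, t k <= t k.+1) ->
          (P [set w | forall k, (k <= n.+1)%N -> X (t k) w = x k] =
           P [set w | forall k, (k <= n)%N -> X (t k) w = x k]
             * (p (t n.+1 - t n) (x n) (x n.+1))%:E)%E].

End MarkovChain.

Definition st_le (R : realType) (d1 d2 : measure_display)
    (Om1 : measurableType d1) (Om2 : measurableType d2)
    (P1 : probability Om1 R) (P2 : probability Om2 R)
    (Y1 : Om1 -> nat) (Y2 : Om2 -> nat) : Prop :=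
  forall k : nat,
    (P1 [set w | (k < Y1 w)%N] <= P2 [set w | (k < Y2 w)%N])%E.

(* [x i j] is the number of type [j] servers with at least [i] jobs, where
   there are [n j] servers of type [j]; row [0] is included as a convention.
   The last field says that the total number of jobs is finite. *)
Record state (M : nat) (n : 'I_M -> nat) := State {
  occ :> nat -> 'I_M -> nat;
  occ0 : forall j, occ 0%N j = n j;
  occ_noninc : forall i j, (occ i.+1 j <= occ i j)%N;
  occ_fin : exists K : nat, forall i j, (K <= i)%N -> occ i j = 0%N }.

HB.instance Definition _ (M : nat) (n : 'I_M -> nat) := gen_eqMixin (state n).
HB.instance Definition _ (M : nat) (n : 'I_M -> nat) :=
  gen_choiceMixin (state n).

Section SeparateQueues.
Context {R : realType} {M : nat} {n : 'I_M -> nat}.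

(* Indices [(i, j)] of the coordinates, where [i >= 1]. *)
Definition coords : set (nat * 'I_M) := [set c | (0 < c.1)%N].

(* A finitely supported sum, by [occ_fin]. *)
Definition total_jobs (x : state n) : nat :=
  \sum_(c \in coords) x c.1 c.2.

(* [y = x + e_c] *)
Definition incr_at (c : nat * 'I_M) (x y : state n) : Prop :=
  forall i j, y i j = (x i j + ((i, j) == c))%N.

(* [a x i j] is the probability that a job arriving in state [x] is sent to a
   type [j] server with exactly [i - 1] jobs; the values at [i = 0] are
   irrelevant. *)
Record stationary_policy (a : state n -> nat -> 'I_M -> R) : Prop := {
  policy_ge0 : forall x i j, (0 < i)%N -> 0 <= a x i j;
  policy_sum1 : forall x, (\esum_(c in coords) (a x c.1 c.2)%:E = 1)%E;
  policy_supp : forall (x : state n) i j, (0 < i)%N -> x i.-1 j = x i j -> a x i j = 0 }.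

(* For given [x] and [y] each sum has at most one term. *)
Definition queue_rates (N : nat) (lambda : R) (mu : 'I_M -> R)
    (a : state n -> nat -> 'I_M -> R) (x y : state n) : R :=
  \sum_(c \in coords `&` [set c | incr_at c x y])
      N%:R * lambda * a x c.1 c.2
  + \sum_(c \in coords `&` [set c | incr_at c y x])
      mu c.2 * ((x c.1 c.2)%:R - (x c.1.+1 c.2)%:R).

End SeparateQueues.

Definition jffs_departure (R : realType) (M N : nat) (mu gamma : 'I_M -> R)
    (k : nat) : R :=
  \sum_(j < M) mu j *
    Num.min (Num.max (k%:R - \sum_(i < M | (i < j)%N) N%:R * gamma i) 0)
            (N%:R * gamma j).

Definition jffs_rates (R : realType) (M N : nat) (lambda : R)
    (mu gamma : 'I_M -> R) (k l : nat) : R :=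
  if l == k.+1 then N%:R * lambda
  else if k == l.+1 then jffs_departure N mu gamma k
  else 0.

(* Main.v *)
(* All rates are bounded by a constant La, so both chains can be uniformized: each
   makes a (possibly trivial) step of a discrete-time chain at the points of a Poisson
   process of rate La, and its transition function is a Poisson mixture of powers of a
   stochastic kernel.

   Coupling. Arrivals are simultaneous. While the pooled system holds strictly fewer
   jobs than the separate queues, departures need not be synchronized. When both hold
   k jobs, the pooled system has the larger departure rate, because it keeps its k jobs
   on the fastest servers; hence each departure from the queues can be matched with one
   from the pooled system, and the order of the totals is preserved. Both marginals of
   the coupled kernel are lumpings, hence Markov with the required rates.

   Construction of the chain. The law of a Markov chain on finer and finer dyadic grids
   is realized on [0, 1[ with Lebesgue measure by nested half-open intervals. A coordinate
   counting the steps of the uniformized chain is nondecreasing along the grids, and the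
   state moves only when it increases; this gives the cadlag extension to real times,
   without exceptional null sets since only intervals of positive length are nonempty.

   Dominance for arbitrary versions. A transition function with bounded rates dominates
   each partial sum of the Poisson mixture (by comparison of right derivatives); as both
   have total mass 1 they coincide, so the rates and the initial law determine the law at
   time t. *)

From HB Require Import structures.
Require Import Defs.
From mathcomp Require Import all_boot all_order all_algebra.
From mathcomp Require Import finmap all_classical all_reals all_analysis.
From mathcomp Require Import ring lra zify.
Set Implicit Arguments.
Unset Strict Implicit.
Unset Printing Implicit Defensive.
Import Order.TTheory GRing.Theory Num.Theory numFieldNormedType.Exports.
Local Open Scope classical_set_scope.
Local Open Scope ring_scope.

(** A chain must have cadlag paths at every sample point, and the order of the totals is claimed at
    every sample point as well, so statements that hold only almost surely are not enough.

    The obstacle in passing from dyadic to real times is that a path read on finer and finer grids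
    could oscillate. The step counter rules this out: along dyadic times decreasing to [t] it is a
    nonincreasing natural number, hence eventually constant, and the state is then constant with it.
    The coupled chain carries the counter, and both marginals forget it.

    Grid [l] has [4 ^ l] steps of length [1 / 2 ^ l]: refining it also doubles the horizon, so that
    a single projective limit covers all times.

    For an arbitrary version nothing is assumed about differentiability of the transition function
    away from time 0. Truncating the Chapman-Kolmogorov sum to finitely many intermediate states
    gives minorants that can be differentiated, and one-sided bounds suffice because the masses are
    equal. *)

(** * Sums of nonnegative extended reals over arbitrary index sets *)

Section ESumExtra.
Local Open Scope ereal_scope.
Context {R : realType}.
Implicit Types (T I J : choiceType).

Lemma ge0_esumZl T (A : set T) (c : \bar R) (f : T -> \bar R) :
  0 <= c -> (forall x, 0 <= f x) ->
  \esum_(i in A) (c * f i) = c * \esum_(i in A) f i.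
Proof.
move=> c0 f0; apply/eqP; rewrite eq_le; apply/andP; split.
  apply: ge_ereal_sup => _ [X [finX XA] <-].
  rewrite -ge0_mule_fsumr//; apply: lee_wpmul2l => //.
  by apply: ereal_sup_ubound; exists X.
case: c c0 => [r r0| _ |//].
  rewrite /esum -ereal_supZl//; last first.
    by apply/set0P; exists (\sum_(x \in set0) f x); exists set0 => //; exact: fsets_set0.
  apply: ge_ereal_sup => _ [_ [X [finX XA] <-] <-].
  by rewrite ge0_mule_fsumr//; apply: ereal_sup_ubound; exists X.
(* Here [c] is infinite: either the sum vanishes, or some term is positive and both sides are
   infinite. *)
have [->|] := eqVneq (\esum_(i in A) f i) 0.
  by rewrite mule0; apply: esum_ge0 => x _; rewrite mule_ge0.
rewrite neq_lt ltNge esum_ge0//= => /ereal_sup_gt[_ [X [finX XA] <-]] X0.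
have [x Xx fx] : exists2 x, X x & 0 < f x.
  apply: contrapT => /forall2NP Hx; move: X0; rewrite fsbig1 ?ltxx// => x Xx.
  by apply/eqP; rewrite eq_le f0 andbT leNgt; apply/negP; case: (Hx x).
rewrite gt0_mulye; last exact: lt_le_trans (ereal_sup_ubound (ex_intro2 _ _ X (conj finX XA) erefl)).
apply: esum_ge; exists [set x]; first by split => // _ ->; exact: XA.
by rewrite fsbig_set1 gt0_mulye.
Qed.

Lemma ge0_esumZr T (A : set T) (c : \bar R) (f : T -> \bar R) :
  0 <= c -> (forall x, 0 <= f x) ->
  \esum_(i in A) (f i * c) = (\esum_(i in A) f i) * c.
Proof.
move=> c0 f0; rewrite muleC -ge0_esumZl//; apply: eq_esum => i _.
by rewrite muleC.
Qed.

Lemma exchange_esum I J (A : set I) (B : set J) (f : I -> J -> \bar R) :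
  (forall i j, 0 <= f i j) ->
  \esum_(i in A) \esum_(j in B) f i j = \esum_(j in B) \esum_(i in A) f i j.
Proof.
move=> f0; rewrite !esum_esum//.
rewrite (reindex_esum (B `*`` (fun=> A)) _ (fun x => (x.2, x.1)))//; split=> //=.
- by move=> [i j] [/=].
- by move=> [i1 i2] [j1 j2] /= _ _ [] -> ->.
- by move=> [i1 i2] [Pi1 Qi2] /=; exists (i2, i1).
Qed.

Lemma esum_single T (A : set T) (x : T) (f : T -> \bar R) : A x ->
  0 <= f x -> (forall y, y != x -> f y = 0) -> \esum_(y in A) f y = f x.
Proof.
move=> Ax fx0 f0.
have f0' y : 0 <= f y by have [->|/f0->] := eqVneq y x.
rewrite (esumID [set x])// [X in _ + X]esum1 ?adde0; last first.
  by move=> y [_ /eqP]; exact: f0.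
by rewrite (_ : A `&` _ = [set x]) ?esum_set1//; apply/seteqP; split => [y [_ ->]|y ->].
Qed.

End ESumExtra.

(** Extracts a possible transition from a nonzero probability; supports are tracked in this way
    throughout. *)
Lemma esum_neq0 (R : realType) (T : choiceType) (A : set T) (f : T -> \bar R) :
  (\esum_(i in A) f i != 0 -> exists i, f i != 0)%E.
Proof.
move=> /eqP f0; apply: contrapT => /forallNP h; apply: f0; apply: esum1 => i _.
by apply/eqP; apply/negPn/negP; exact: h.
Qed.

(** A strict inequality at [z] could not be made up for elsewhere, as the remaining masses are
    ordered the same way. This upgrades one-sided bounds on laws to equalities. *)
Lemma esum_eq_of_le (R : realType) (T : choiceType) (f g : T -> \bar R) (z : T) :
  (forall y, 0 <= f y)%E -> (forall y, f y <= g y)%E ->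
  (\esum_(y in [set: T]) f y = 1)%E -> (\esum_(y in [set: T]) g y = 1)%E ->
  f z = g z.
Proof.
move=> f0 fg f1 g1; apply/eqP; rewrite eq_le fg/=.
have g0 y : (0 <= g y)%E by exact: le_trans (fg y).
have le : (\esum_(y in ~` [set z]) f y <= \esum_(y in ~` [set z]) g y)%E.
  by apply: le_esum => y _; exact: fg.
have le0 : (0 <= \esum_(y in ~` [set z]) f y)%E by exact: esum_ge0.
have le1 (h : T -> \bar R) : (forall y, 0 <= h y)%E ->
    (\esum_(y in [set: T]) h y = 1)%E -> (h z <= 1)%E.
  move=> h0 <-; apply: esum_ge; exists [set z]; first by split.
  by rewrite fsbig_set1.
have := le1 f f0 f1; have := le1 g g0 g1; have := f0 z; have := g0 z.
move: f1 g1 le le0; rewrite (esumID [set z] setT f (fun y _ => f0 y)).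
rewrite (esumID [set z] setT g (fun y _ => g0 y)) !setTI !esum_set1//.
case: (f z) => [u| |]; case: (g z) => [v| |]; rewrite ?leye_eq ?leeNy_eq//.
case: (\esum_(y in _) f y)%E => [a| |]; case: (\esum_(y in _) g y)%E => [b| |] //.
by rewrite -!EFinD !lee_fin => -[e1] -[e2]; lra.
Qed.

(** The target comes first, so that [delta y] is the indicator function of [y]. *)
Definition delta {R : realType} {S : eqType} (y x : S) : \bar R := (x == y)%:R%:E.

(** * Kernels acting on nonnegative functions, and their powers *)

Section Kernel.
Local Open Scope ereal_scope.
Context {R : realType}.
Implicit Types (S : choiceType).

Definition act S S' (K : S -> S' -> \bar R) (F : S' -> \bar R) (x : S) : \bar R :=
  \esum_(y in [set: S']) (K x y * F y).

Lemma delta_ge0 S (y x : S) : 0 <= delta y x :> \bar R.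
Proof. by rewrite /delta lee_fin. Qed.
Hint Resolve delta_ge0 : core.

Lemma esum_delta S (x : S) (F : S -> \bar R) : (forall y, 0 <= F y) ->
  \esum_(y in [set: S]) (delta y x * F y) = F x.
Proof.
move=> F0; rewrite (@esum_single _ _ _ x)//= /delta ?eqxx ?mul1e// => y /negPf.
by rewrite eq_sym => ->; rewrite mul0e.
Qed.

Section Act.
Context {S S' : choiceType} (K : S -> S' -> \bar R) (K0 : forall x y, 0 <= K x y).
Implicit Types (F : S' -> \bar R).

Lemma act_ge0 F : (forall x, 0 <= F x) -> forall x, 0 <= act K F x.
Proof. by move=> F0 x; apply: esum_ge0 => y _; rewrite mule_ge0. Qed.

Lemma act_delta y x : act K (delta y) x = K x y.
Proof.
rewrite /act (@esum_single _ _ _ y) /delta ?eqxx ?mule1// => z /negPf ->.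
by rewrite mule0.
Qed.

Lemma act_esum (I : choiceType) (A : set I) (f : S' -> I -> \bar R) x :
  (forall x i, 0 <= f x i) ->
  act K (fun y => \esum_(i in A) f y i) x = \esum_(i in A) act K (f ^~ i) x.
Proof.
move=> f0; rewrite /act -exchange_esum; last by move=> *; rewrite mule_ge0.
by apply: eq_esum => y _; rewrite ge0_esumZl.
Qed.

Lemma actZ c F x : 0 <= c -> (forall x, 0 <= F x) ->
  act K (fun y => c * F y) x = c * act K F x.
Proof.
move=> c0 F0; rewrite /act -ge0_esumZl//; last by move=> y; rewrite mule_ge0.
by apply: eq_esum => y _; rewrite muleCA.
Qed.

Lemma eq_act F G x : (forall y, F y = G y) -> act K F x = act K G x.
Proof. by move=> FG; apply: eq_esum => y _; rewrite FG. Qed.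

End Act.

Section Pow.
Context {S : choiceType} (K : S -> S -> \bar R) (K0 : forall x y, 0 <= K x y).
Implicit Types (F : S -> \bar R).

Lemma iter_act_ge0 n F : (forall x, 0 <= F x) -> forall x, 0 <= iter n (act K) F x.
Proof. by move=> F0; elim: n => [//|n ih] x; exact: act_ge0. Qed.

Lemma iter_act_esum n (I : choiceType) (A : set I) (f : S -> I -> \bar R) x :
  (forall x i, 0 <= f x i) ->
  iter n (act K) (fun y => \esum_(i in A) f y i) x =
  \esum_(i in A) iter n (act K) (f ^~ i) x.
Proof.
move=> f0; elim: n x => [//|n ih] x; rewrite iterS (eq_act _ _ ih) act_esum//.
by move=> y i; apply: iter_act_ge0.
Qed.

Lemma iter_actZ n c F x : 0 <= c -> (forall x, 0 <= F x) ->
  iter n (act K) (fun y => c * F y) x = c * iter n (act K) F x.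
Proof.
move=> c0 F0; elim: n x => [//|n ih] x; rewrite iterS (eq_act _ _ ih) actZ//.
exact: iter_act_ge0.
Qed.

Lemma iter_actE n F x : (forall x, 0 <= F x) ->
  iter n (act K) F x = \esum_(y in [set: S]) (iter n (act K) (delta y) x * F y).
Proof.
move=> F0; have -> : F = (fun x => \esum_(y in [set: S]) (F y * delta y x)).
  by apply/funext => z; under eq_esum do rewrite muleC; rewrite esum_delta.
rewrite iter_act_esum; last by move=> *; rewrite mule_ge0.
apply: eq_esum => y _; rewrite iter_actZ// muleC; congr (_ * _).
by under eq_esum do rewrite muleC; rewrite esum_delta.
Qed.

(** The second hypothesis is lumpability along [f]: [act K] preserves functions that factor through
    [f], hence so do its powers. *)
Lemma iter_act_comp (S' : choiceType) (f : S -> S') (K' : S' -> S' -> \bar R) :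
  (forall x y, 0 <= K' x y) ->
  (forall F : S' -> \bar R, (forall y, 0 <= F y) -> forall x, act K (F \o f) x = act K' F (f x)) ->
  forall n (F : S' -> \bar R), (forall y, 0 <= F y) ->
  forall x, iter n (act K) (F \o f) x = iter n (act K') F (f x).
Proof.
move=> K'0 Kf; elim=> [//|n ih] F F0 x.
rewrite iterS (@eq_act _ _ _ _ (iter n (act K') F \o f) x); last exact: ih.
rewrite Kf//; elim: n {ih} => [//|n ih] y; exact: act_ge0.
Qed.

Hypothesis K1 : forall x, \esum_(y in [set: S]) K x y = 1.

Lemma act_cst c x : 0 <= c -> act K (fun=> c) x = c.
Proof. by move=> c0; rewrite /act ge0_esumZr// K1 mul1e. Qed.

Lemma iter_act_cst n c x : 0 <= c -> iter n (act K) (fun=> c) x = c.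
Proof.
by move=> c0; elim: n x => [//|n ih] x; rewrite iterS (eq_act _ _ ih) act_cst.
Qed.

Lemma iter_act_le1 n F x : (forall x, 0 <= F x <= 1) -> iter n (act K) F x <= 1.
Proof.
move=> F01; elim: n x => [x|n ih x]; first by case/andP: (F01 x).
rewrite -(K1 x); apply: le_esum => y _; rewrite -[leRHS]mule1.
by apply: lee_wpmul2l => //; exact: ih.
Qed.

End Pow.
End Kernel.
#[global] Hint Resolve delta_ge0 : core.

(** * Poisson weights *)

Section Poisson.
Context {R : realType}.
Implicit Types a b : R.

Definition poisson_weight a n : R := expR (- a) * (a ^+ n / n`!%:R).

Lemma poisson_weight_ge0 a n : 0 <= a -> 0 <= poisson_weight a n.
Proof. by move=> a0; rewrite mulr_ge0 ?expR_ge0// divr_ge0// exprn_ge0. Qed.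

Lemma esum_exp_coeff a : 0 <= a ->
  (\esum_(n in [set: nat]) (a ^+ n / n`!%:R)%:E = (expR a)%:E)%E.
Proof.
move=> a0; rewrite -nneseries_esumT; last by move=> n; rewrite lee_fin divr_ge0// exprn_ge0.
rewrite expRE -EFin_lim; last first.
  rewrite /pseries/=; under eq_fun do rewrite mulrC.
  exact: is_cvg_series_exp_coeff.
apply/congr_lim/funext => n/=; rewrite /pseries/= /series/= -sumEFin//.
by apply: eq_bigr => i _; rewrite mulrC.
Qed.

Lemma poisson_weight_sum1 a : 0 <= a ->
  (\esum_(n in [set: nat]) (poisson_weight a n)%:E = 1)%E.
Proof.
move=> a0; under eq_esum do rewrite EFinM.
rewrite ge0_esumZl ?esum_exp_coeff ?lee_fin ?expR_ge0//.
  by rewrite -EFinM expRN mulVf ?gt_eqF ?expR_gt0.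
by move=> n; rewrite lee_fin divr_ge0// exprn_ge0.
Qed.

Lemma poisson_weight0 n : poisson_weight 0 n = (n == 0%N)%:R :> R.
Proof.
by rewrite /poisson_weight oppr0 expR0 mul1r; case: n => [|n];
  rewrite ?expr0 ?fact0 ?divr1// exprS !mul0r.
Qed.

(** The binomial theorem; it is the source of the semigroup law for Poisson mixtures. *)
Lemma poisson_weightD a b n :
  poisson_weight (a + b) n =
  \sum_(i < n.+1) poisson_weight a i * poisson_weight b (n - i)%N.
Proof.
rewrite /poisson_weight opprD expRD addrC exprDn mulr_suml mulr_sumr.
apply: eq_bigr => i _.
have lein : (i <= n)%N by rewrite -ltnS.
rewrite mulrnAl -mulr_natr.
have f0 k : (k`!%:R != 0 :> R) by rewrite pnatr_eq0 -lt0n fact_gt0.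
have -> : 'C(n, i)%:R = n`!%:R / (i`!%:R * (n - i)`!%:R) :> R.
  by rewrite -(bin_fact lein) !natrM mulfK ?mulf_neq0 ?f0.
by field; rewrite !f0.
Qed.

(* The total mass outside [0, 1] is at most [a ^ 2], by [1 - a <= expR (- a)]. *)
Lemma poisson_weight_tail a : 0 <= a ->
  1 - poisson_weight a 0 - poisson_weight a 1 <= a ^+ 2.
Proof.
move=> a0; rewrite /poisson_weight !fact0 (_ : 1`! = 1%N)// expr0 expr1 !divr1.
have := expR_ge1Dx (- a); nra.
Qed.

End Poisson.

(** * The uniformized semigroup and its rates *)

Section Unif.
Local Open Scope ereal_scope.
Context {R : realType} {S : choiceType} (K : S -> S -> \bar R).
Hypothesis K0 : forall x y, 0 <= K x y.
Hypothesis K1 : forall x, \esum_(y in [set: S]) K x y = 1.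
Implicit Types (F : S -> \bar R) (a b : R).

(* The transition operator, at time [a], of the continuous-time chain that makes
   a [K]-step at each point of a Poisson process of unit rate. *)
Definition unif a F x : \bar R :=
  \esum_(n in [set: nat]) ((poisson_weight a n)%:E * iter n (act K) F x).

Lemma unif_ge0 a F : (0 <= a)%R -> (forall x, 0 <= F x) -> forall x, 0 <= unif a F x.
Proof.
move=> a0 F0 x; apply: esum_ge0 => n _.
by rewrite mule_ge0 ?iter_act_ge0// lee_fin poisson_weight_ge0.
Qed.

Lemma unifE a F x : (0 <= a)%R -> (forall x, 0 <= F x) ->
  unif a F x = \esum_(y in [set: S]) (unif a (delta y) x * F y).
Proof.
move=> a0 F0; have w0 n : 0 <= (poisson_weight a n)%:E.
  by rewrite lee_fin poisson_weight_ge0.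
transitivity (\esum_(n in [set: nat]) \esum_(y in [set: S])
    (((poisson_weight a n)%:E * iter n (act K) (delta y) x) * F y)).
  apply: eq_esum => n _; rewrite (iter_actE K0)// -ge0_esumZl//; last first.
    by move=> y; rewrite mule_ge0 ?iter_act_ge0.
  by apply: eq_esum => y _; rewrite muleA.
rewrite exchange_esum; last by move=> *; rewrite !mule_ge0 ?iter_act_ge0.
apply: eq_esum => y _; rewrite ge0_esumZr// => n.
by rewrite mule_ge0 ?iter_act_ge0.
Qed.

Lemma unif_cst a c x : (0 <= a)%R -> 0 <= c -> unif a (fun=> c) x = c.
Proof.
move=> a0 c0; rewrite /unif; under eq_esum do rewrite (iter_act_cst K0 K1)//.
rewrite ge0_esumZr// ?poisson_weight_sum1 ?mul1e// => n.
by rewrite lee_fin poisson_weight_ge0.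
Qed.

Lemma unif_sum1 a x : (0 <= a)%R -> \esum_(y in [set: S]) unif a (delta y) x = 1.
Proof.
move=> a0; rewrite -(@unif_cst a 1 x)// unifE//.
by apply: eq_esum => y _; rewrite mule1.
Qed.

Lemma unif_le1 a F x : (0 <= a)%R -> (forall x, 0 <= F x <= 1) -> unif a F x <= 1.
Proof.
move=> a0 F01; rewrite -(poisson_weight_sum1 a0); apply: le_esum => n _.
rewrite -[leRHS]mule1; apply: lee_wpmul2l; last exact: iter_act_le1.
by rewrite lee_fin poisson_weight_ge0.
Qed.

Lemma unif0 F x : (forall x, 0 <= F x) -> unif 0 F x = F x.
Proof.
move=> F0; rewrite /unif (@esum_single _ _ _ 0%N)//= ?poisson_weight0 ?mul1e//.
by move=> n /negPf; rewrite poisson_weight0 => ->; rewrite mul0e.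
Qed.

(** With [n] steps in the first period and [m] in the second, the double sum is reindexed by the
    total [k = n + m]; for fixed [k] the weights add up by [poisson_weightD]. *)
Lemma unifD a b F x : (0 <= a)%R -> (0 <= b)%R -> (forall x, 0 <= F x) ->
  unif a (unif b F) x = unif (a + b) F x.
Proof.
move=> a0 b0 F0.
have wa n : 0 <= (poisson_weight a n)%:E by rewrite lee_fin poisson_weight_ge0.
have wb n : 0 <= (poisson_weight b n)%:E by rewrite lee_fin poisson_weight_ge0.
have I0 n y : 0 <= iter n (act K) F y by exact: iter_act_ge0.
transitivity (\esum_(n in [set: nat]) \esum_(m in [set: nat])
    ((poisson_weight a n)%:E * (poisson_weight b m)%:E * iter (n + m) (act K) F x)).
  apply: eq_esum => n _; rewrite (iter_act_esum K0); last first.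
    by move=> y m; rewrite mule_ge0.
  rewrite -ge0_esumZl//; last first.
    by move=> m; apply: (iter_act_ge0 K0) => y; rewrite mule_ge0.
  by apply: eq_esum => m _; rewrite (iter_actZ K0)// iterD muleA.
transitivity (\esum_(n in [set: nat]) \esum_(k in [set k | (n <= k)%N])
    ((poisson_weight a n)%:E * (poisson_weight b (k - n))%:E * iter k (act K) F x)).
  apply: eq_esum => n _.
  rewrite [RHS](reindex_esum [set: nat] [set k | (n <= k)%N] (addn n))//; last first.
    split=> [m _ /=|m m' _ _ /addnI//|k /= nk]; first exact: leq_addr.
    by exists (k - n)%N => //; rewrite subnKC.
  by apply: eq_esum => m _; rewrite addKn.
under eq_esum do rewrite esum_mkcond.
rewrite exchange_esum; last by move=> i j; case: ifP; rewrite // !mule_ge0.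
apply: eq_esum => k _; rewrite poisson_weightD -sumEFin.
rewrite ge0_sume_distrl; last first.
  by move=> i _; rewrite EFinM mule_ge0.
rewrite [RHS](fsbig_ord _ _ (fun i => (poisson_weight a i * poisson_weight b (k - i))%:E * iter k (act K) F x))/=.
rewrite -esum_fset//; last by move=> i _; rewrite EFinM !mule_ge0.
rewrite [RHS]esum_mkcond; apply: eq_esum => i _.
have -> : (k \in [set k0 | (i <= k0)%N]) = (i \in `I_k.+1).
  by apply/idP/idP; rewrite !inE /=.
by rewrite EFinM.
Qed.

(** The right side is the transition operator of [K'] unfolded, since [unif] is tied to [K] inside
    this section. *)
Lemma unif_comp (S' : choiceType) (f : S -> S') (K' : S' -> S' -> \bar R) :
  (forall x y, 0 <= K' x y) ->
  (forall F : S' -> \bar R, (forall y, 0 <= F y) ->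
    forall x, act K (F \o f) x = act K' F (f x)) ->
  forall a (F : S' -> \bar R), (forall y, 0 <= F y) ->
  forall x, unif a (F \o f) x =
    \esum_(n in [set: nat]) ((poisson_weight a n)%:E * iter n (act K') F (f x)).
Proof.
move=> K'0 Kf a F F0 x; apply: eq_esum => n _; congr (_ * _).
exact: iter_act_comp.
Qed.

Lemma unif_delta_fin a y x : (0 <= a)%R -> unif a (delta y) x \is a fin_num.
Proof.
move=> a0; rewrite ge0_fin_numE ?unif_ge0//; apply: le_lt_trans (ltry 1).
by apply: unif_le1 => // z; rewrite delta_ge0/= /delta lee_fin lern1 leq_b1.
Qed.

Lemma kernel_fin x y : K x y \is a fin_num.
Proof.
rewrite ge0_fin_numE//; apply: le_lt_trans (ltry 1).
rewrite -(K1 x); apply: esum_ge; exists [set y]; first by split.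
by rewrite fsbig_set1.
Qed.

Lemma esum_nat_recl (f : nat -> \bar R) : (forall n, 0 <= f n) ->
  \esum_(n in [set: nat]) f n = f 0%N + \esum_(n in [set: nat]) f n.+1.
Proof.
move=> f0; rewrite (esumID [set 0%N])// setTI esum_set1//; congr (_ + _).
rewrite setTI (reindex_esum [set: nat] _ succn)//; split.
- by move=> n _ /=.
- by move=> n m _ _ [].
- by case=> [/= /(_ erefl)//|n _]; exists n.
Qed.

Local Open Scope ring_scope.

(** Three errors of at most [a ^+ 2] each: in the weight of no step, in the weight of one step, and
    the whole mass of two or more steps. *)
Lemma unif_first_order a x y : 0 <= a <= 1 ->
  `|fine (unif a (delta y) x) - ((x == y)%:R + a * (fine (K x y) - (x == y)%:R))|
    <= 3 * a ^+ 2.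
Proof.
move=> /andP[a0 a1].
pose k := fine (K x y); have kE : K x y = k%:E by rewrite fineK ?kernel_fin.
have k0 : 0 <= k by rewrite -lee_fin -kE.
have k1 : k <= 1.
  rewrite -lee_fin -kE -(K1 x); apply: esum_ge; exists [set y]; first by split.
  by rewrite fsbig_set1.
have w0 n : (0 <= (poisson_weight a n)%:E)%E by rewrite lee_fin poisson_weight_ge0.
have I0 n z : (0 <= iter n (act K) (delta y) z)%E by exact: iter_act_ge0.
pose c n := iter n.+2 (act K) (delta y) x.
pose r := \esum_(n in [set: nat]) ((poisson_weight a n.+2)%:E * c n)%E.
have r0 : (0 <= r)%E by apply: esum_ge0 => n _; apply: mule_ge0; [exact: w0|exact: I0].
have r1 : (r <= (1 - poisson_weight a 0 - poisson_weight a 1)%:E)%E.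
  apply: (@le_trans _ _ (\esum_(n in [set: nat]) (poisson_weight a n.+2)%:E)%E).
    apply: le_esum => n _; rewrite -[leRHS]mule1; apply: lee_wpmul2l => //.
    apply: iter_act_le1 => // z.
    by rewrite delta_ge0/= /delta lee_fin lern1 leq_b1.
  have := poisson_weight_sum1 a0; rewrite esum_nat_recl// esum_nat_recl//.
  case: (\esum_(n in _) _)%E => // r'; rewrite -!EFinD => -[].
  by rewrite lee_fin; lra.
have E : unif a (delta y) x =
    ((poisson_weight a 0 * (x == y)%:R + poisson_weight a 1 * k)%:E + r)%E.
  rewrite /unif esum_nat_recl; last by move=> n; rewrite mule_ge0.
  rewrite esum_nat_recl; last by move=> n; rewrite mule_ge0.
  by rewrite addeA/= act_delta// kE EFinD !EFinM.
move: r0 r1 E; case: r => // r; rewrite !lee_fin => r0 r1 ->.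
have := poisson_weight_tail a0; rewrite -/k.
move: r1; rewrite -!EFinD/= /poisson_weight !fact0 (_ : 1`! = 1%N)// expr0 expr1 !divr1.
have e1 := expR_ge1Dx (- a).
(* From [1 + a <= expR a], because [(1 + a) * (1 - a + a ^+ 2) = 1 + a ^+ 3]. *)
have e2 : expR (- a) <= 1 - a + a ^+ 2.
  have ea : 1 + a <= expR a by exact: expR_ge1Dx.
  have ee : expR a * expR (- a) = 1 by rewrite expRN divff// gt_eqF ?expR_gt0.
  have : (1 + a) * expR (- a) <= 1.
    by apply: (le_trans (ler_wpM2r (expR_ge0 _) ea)); rewrite ee.
  have := expR_ge0 (- a); nra.
move: (expR (- a)) e1 e2 => e e1 e2 r1 tail.
by case: (x == y) => /=; rewrite ler_norml; apply/andP; split; nra.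
Qed.

Definition unif_trans La t x y : R := fine (unif (La * t) (delta y) x).

Lemma unif_trans_derive La x y : 0 < La ->
  (unif_trans La h x y - (x == y)%:R) / h @[h --> 0^'+]
    --> La * (fine (K x y) - (x == y)%:R).
Proof.
move=> La0; apply/cvgrPdist_le => e e0; near=> h.
have h0 : 0 < h by near: h; exact: nbhs_right_gt.
have hLa : La * h <= 1.
  rewrite mulrC -ler_pdivlMr// div1r; near: h; apply: nbhs_right_le.
  by rewrite invr_gt0.
have he : 3 * La ^+ 2 * h <= e.
  rewrite mulrC -ler_pdivlMr ?mulr_gt0 ?exprn_gt0//; near: h; apply: nbhs_right_le.
  by rewrite divr_gt0// mulr_gt0 ?exprn_gt0.
have a01 : 0 <= La * h <= 1 by apply/andP; split=> //; exact: mulr_ge0 (ltW La0) (ltW h0).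
have := @unif_first_order (La * h) x y a01.
rewrite -/(unif_trans La h x y) distrC => B.
have -> : La * (fine (K x y) - (x == y)%:R) - (unif_trans La h x y - (x == y)%:R) / h
  = ((x == y)%:R + La * h * (fine (K x y) - (x == y)%:R) - unif_trans La h x y) / h.
  by field; rewrite gt_eqF.
rewrite normrM [X in _ * X]gtr0_norm ?invr_gt0// ler_pdivrMr//.
by apply: (le_trans B); rewrite exprMn; nra.
Unshelve. all: by end_near. Qed.

Lemma exit_rate La (q : S -> S -> R) x : 0 < La ->
  (forall x y, x != y -> (q x y)%:E = (La%:E * K x y)%E) ->
  \esum_(y in [set y | y != x]) (q x y)%:E = (La * (1 - fine (K x x)))%:E.
Proof.
move=> La0 qK; transitivity (\esum_(y in [set y | y != x]) (La%:E * K x y)%E).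
  by apply: eq_esum => y /= yx; rewrite qK// eq_sym.
rewrite ge0_esumZl ?lee_fin ?(ltW La0)// EFinM; congr (_ * _)%E.
have := K1 x; rewrite (esumID [set x])// !setTI esum_set1//.
rewrite (_ : ~` [set x] = [set y | y != x]); last first.
  by apply/seteqP; split => y /eqP.
have := kernel_fin x x; case: (K x x) => // r _.
case: (\esum_(y in _) _)%E => // s; rewrite -EFinD => -[<-].
by rewrite /= addrAC subrr add0r.
Qed.

(** Agreement off the diagonal suffices: self-loops of [K] are invisible in continuous time, and the
    row sums of [K] determine the exit rates. *)
Lemma unif_trans_transition_function La (q : S -> S -> R) : 0 < La ->
  (forall x y, x != y -> (q x y)%:E = (La%:E * K x y)%E) ->
  transition_function q (unif_trans La).
Proof.
move=> La0 qK.
have transE t x y : 0 <= t -> (unif_trans La t x y)%:E = unif (La * t) (delta y) x.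
  by move=> t0; rewrite fineK// unif_delta_fin// mulr_ge0// ltW.
split.
- by move=> t x y t0; rewrite fine_ge0// unif_ge0// mulr_ge0// ltW.
- move=> t x t0; under eq_esum do rewrite transE//.
  by rewrite unif_sum1// mulr_ge0// ltW.
- by move=> x y; rewrite /unif_trans mulr0 unif0.
- move=> s t x z s0 t0.
  rewrite transE ?addr_ge0// mulrDr -unifD ?mulr_ge0 ?(ltW La0)//.
  rewrite unifE ?mulr_ge0 ?(ltW La0)//; last first.
    by apply: unif_ge0; rewrite // mulr_ge0// ltW.
  by apply: eq_esum => y _; rewrite EFinM !transE.
- move=> x y xy; have := @unif_trans_derive La x y La0.
  rewrite (negPf xy) !subr0.
  have -> : La * fine (K x y) = q x y.
    by apply: EFin_inj; rewrite qK// EFinM fineK ?kernel_fin.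
  by under eq_fun do rewrite subr0.
- move=> x.
  rewrite (exit_rate _ La0)//.
  apply: cvg_EFin; first by near=> h.
  have L := @unif_trans_derive La x x La0; rewrite eqxx in L.
  rewrite (_ : La * _ = - (La * (fine (K x x) - 1))); last by ring.
  move/cvgN: L; apply: cvg_trans; apply: near_eq_cvg; apply: nearW => h /=.
  by rewrite -mulNr opprB.
Unshelve. all: by end_near. Qed.

End Unif.

(** * Comparison by one-sided derivatives *)

Section RightDerivative.
Context {R : realType}.
Implicit Types (f g : R -> R).

Lemma near_at_rightP (x : R) (P : R -> Prop) : (\forall h \near x^'+, P h) ->
  exists2 d, 0 < d & forall h, x < h < x + d -> P h.
Proof.
rewrite near_withinE => /nbhs_ballP[d /= d0 Pd]; exists d => // h /andP[xh hd].
by apply: Pd => //=; rewrite /ball/= ltr_distlC; apply/andP; split; lra.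
Qed.

(** Real induction with a tolerated slope [- e]: the times up to which the bound holds contain their
    supremum [c] by the left hypothesis, and extend beyond any [c < T] by the right one. Lower
    estimates are all that is asked of [g]. *)
Lemma right_derivative_ge0 g T : 0 <= T ->
  (forall t e, 0 <= t -> 0 < e -> \forall h \near 0^'+, g t - e * h <= g (t + h)) ->
  (forall t e, 0 < t -> 0 < e -> \forall s \near t^'-, g s - e <= g t) ->
  g 0 <= g T.
Proof.
move=> T0 gr gl; apply/ler_addgt0Pr => e0 e00.
(* The added 1 covers [T = 0]. *)
pose e := e0 / (T + 1).
have e_gt0 : 0 < e by rewrite divr_gt0// ltr_wpDl.
suff : g 0 - e * T <= g T.
  rewrite lerBlDr => /le_trans; apply; rewrite lerD2l /e mulrAC.
  by rewrite ler_pdivrMr ?ltr_wpDl// ler_pM2l//; lra.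
pose A := [set t | 0 <= t <= T /\ forall s, 0 <= s <= t -> g 0 - e * s <= g s].
have A0 : A 0.
  split; first by rewrite lexx.
  by move=> s; rewrite -eq_le => /eqP <-; rewrite mulr0 subr0.
have supA : has_sup A by split; [exists 0|exists T => t [/andP[]]].
pose c := sup A.
have cT : c <= T by apply: ge_sup; [exists 0|move=> t [/andP[]]].
have c0 : 0 <= c by apply: ub_le_sup A0; case: supA.
have below s : 0 <= s < c -> g 0 - e * s <= g s.
  move=> /andP[s0 sc]; have [t [_ At] st] := sup_adherent (eqbRL (subr_gt0 _ _) sc) supA.
  by apply: At; rewrite s0 ltW//; move: st; rewrite subKr.
have Ac : A c.
  split=> [|s /andP[s0]]; first by rewrite c0.
  rewrite le_eqVlt => /predU1P[{s s0}->|sc]; last by rewrite below// s0.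
  move: c0; rewrite le_eqVlt => /predU1P[<-|c_gt0].
    by rewrite mulr0 subr0.
  apply/ler_addgt0Pr => d d0; near (c^'-) => s.
  have s0 : 0 < s by near: s; exact: nbhs_left_gt.
  have sc : s < c by near: s; exact: nbhs_left_lt.
  have : g s - d <= g c by near: s; exact: gl.
  have := below s; rewrite (ltW s0) sc => /(_ isT).
  have : e * s <= e * c by rewrite ler_pM2l// ltW.
  lra.
move: cT; rewrite le_eqVlt => /predU1P[cT|cT].
  by case: Ac => _; apply; rewrite -cT c0 lexx.
exfalso.
have [d d0 Pd] := near_at_rightP (gr c e c0 e_gt0).
(* Half of [d] keeps [s - c] strictly below [d] for all [s <= c + h]. *)
pose h := Num.min (d / 2) (T - c).
have h0 : 0 < h by rewrite lt_min divr_gt0//= subr_gt0.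
have : c + h <= c; last by lra.
apply: ub_le_sup; first by case: supA.
split=> [|s /andP[s0 sch]].
  by rewrite addr_ge0 ?(ltW h0)//= -lerBrDl ge_min lexx orbT.
have [sc|cs] := leP s c; first by case: Ac => _; apply; rewrite s0.
have := Pd (s - c); rewrite add0r subr_gt0 cs/= addrCA subrr addr0.
have hd : h <= d / 2 by rewrite ge_min lexx.
case: Ac => _ /(_ c); rewrite c0 lexx => /(_ isT) gc.
have -> : s - c < d by lra.
by move=> /(_ isT); lra.
Unshelve. all: by end_near. Qed.

Lemma is_derive_right f (t df : R) : is_derive t 1 f df ->
  (f (t + h) - f t) / h @[h --> 0^'+] --> df.
Proof.
move=> [fd <-]; rewrite /derive.
have := @cvg_dnbhs_at_right _ _ (fun h : R => h^-1 *: ((f \o shift t) (h *: 1) - f t)) 0 _ fd.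
apply: cvg_trans; apply: near_eq_cvg; apply: nearW => h /=.
by rewrite /= scaler1 [h + t]addrC [RHS]mulrC.
Qed.

End RightDerivative.

(** * Regularity of arbitrary transition functions *)

Section TransitionFunction.
Context {R : realType} {S : choiceType} (q : S -> S -> R) (p : R -> S -> S -> R).
Hypothesis pP : transition_function q p.

Lemma tf_le1 t x y : 0 <= t -> p t x y <= 1.
Proof.
move=> t0; rewrite -lee_fin -(tf_sum1 pP x t0); apply: esum_ge.
by exists [set y] => //; rewrite fsbig_set1.
Qed.

Lemma tf_sum_neq t x : 0 <= t ->
  (\esum_(y in ~` [set x]) (p t x y)%:E = (1 - p t x x)%:E)%E.
Proof.
move=> t0; have := tf_sum1 pP x t0; have p0 y := tf_ge0 pP x y t0.
rewrite (esumID [set x]) => [|y _]; last by rewrite lee_fin.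
rewrite !setTI esum_set1 ?lee_fin//; case: (\esum_(y in _) _)%E => // s.
by rewrite -EFinD => -[<-]; rewrite addrAC subrr add0r.
Qed.

Lemma tf_ge_sum (F : {fset S}) s t x z : 0 <= s -> 0 <= t ->
  \sum_(y <- F) p s x y * p t y z <= p (s + t) x z.
Proof.
move=> s0 t0; rewrite -lee_fin (tf_semigroup pP)//; apply: esum_ge.
exists [set` F]; first by split.
by rewrite fsbig_finite//= set_fsetK sumEFin.
Qed.

(** Split according to the state at time [s]: it differs from [x] with probability [1 - p s x x],
    which bounds the change in both directions, uniformly in [t]. *)
Lemma tf_continuous s t x z : 0 <= s -> 0 <= t ->
  `|p (s + t) x z - p t x z| <= 1 - p s x x.
Proof.
move=> s0 t0; rewrite ler_norml; apply/andP; split.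
  have := tf_ge_sum [fset x]%fset x z s0 t0; rewrite big_seq_fset1.
  have := tf_le1 x x s0; have := tf_le1 x z t0; have := tf_ge0 pP x z t0; nra.
rewrite lerBlDr -lee_fin (tf_semigroup pP)// (esumID [set x])//; last first.
  by move=> y _; rewrite lee_fin mulr_ge0 ?(tf_ge0 pP).
rewrite !setTI esum_set1 ?lee_fin ?mulr_ge0 ?(tf_ge0 pP)// addeC EFinD.
apply: leeD.
  rewrite -tf_sum_neq//; apply: le_esum => y _; rewrite lee_fin.
  by rewrite ler_piMr ?tf_le1// (tf_ge0 pP).
by rewrite lee_fin ler_piMl ?tf_le1// (tf_ge0 pP).
Qed.

Lemma tf_derive La (k : S -> S -> R) :
  (forall x y, x != y -> q x y = La * k x y) ->
  (forall x, \esum_(y in [set y | y != x]) (q x y)%:E = (La * (1 - k x x))%:E) ->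
  forall x y, (p h x y - (x == y)%:R) / h @[h --> 0^'+] --> La * (k x y - (x == y)%:R).
Proof.
move=> qk qx x y; have [<-|xy] := eqVneq x y.
  have := tf_exit pP (x := x); rewrite qx => /fine_cvgP[_] /cvgN.
  rewrite (_ : La * (k x x - _) = - (La * (1 - k x x))); last by rewrite /=; ring.
  apply: cvg_trans; apply: near_eq_cvg; apply: nearW => h /=.
  by rewrite -mulNr opprB.
rewrite subr0 -qk//; have := tf_rate pP xy.
by apply: cvg_trans; apply: near_eq_cvg; apply: nearW => h /=; rewrite subr0.
Qed.

Lemma tf_diag_cvg La (k : S -> S -> R) x :
  (forall x y, (p h x y - (x == y)%:R) / h @[h --> 0^'+] --> La * (k x y - (x == y)%:R)) ->
  1 - p h x x @[h --> 0^'+] --> 0.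
Proof.
move=> /(_ x x); rewrite eqxx => L.
have id0 : h @[h --> (0 : R)^'+] --> (0 : R) by apply: cvg_at_right_filter; exact: cvg_id.
have /cvgN : (p h x x - true%:R) / h * h @[h --> (0 : R)^'+] -->
    La * (k x x - true%:R) * 0 by exact: cvgM.
rewrite mulr0 oppr0; apply: cvg_trans; apply: near_eq_cvg.
near=> h => /=; rewrite fctE divfK ?opprB//.
Unshelve. all: by end_near. Qed.

End TransitionFunction.

(** * Bounded rates determine the transition function *)

Section Uniqueness.
Context {R : realType} {S : choiceType} (K : S -> S -> \bar R).
Hypothesis K0 : (forall x y, 0 <= K x y)%E.
Hypothesis K1 : (forall x, \esum_(y in [set: S]) K x y = 1)%E.
Variables (La : R) (q : S -> S -> R) (p : R -> S -> S -> R).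
Hypothesis La0 : 0 < La.
Hypothesis qK : forall x y, x != y -> (q x y)%:E = (La%:E * K x y)%E.
Hypothesis pP : transition_function q p.

Let k x y := fine (K x y).

Lemma tf_derive_kernel x y :
  (p h x y - (x == y)%:R) / h @[h --> 0^'+] --> La * (k x y - (x == y)%:R).
Proof.
have K_fin := kernel_fin K0 K1.
apply: (tf_derive pP) => {x y}[x y xy|x].
  by apply: EFin_inj; rewrite qK// EFinM fineK.
by rewrite (exit_rate K0 K1 _ La0 qK).
Qed.

Lemma tf_leftcontinuous t x z e : 0 < t -> 0 < e ->
  \forall s \near t^'-, `|p t x z - p s x z| <= e.
Proof.
move=> t0 e0; have := @tf_diag_cvg _ _ p La k x tf_derive_kernel.
move/cvgrPdist_le => /(_ e e0)/near_at_rightP[d d0 Pd].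
near=> s.
have st : s < t by near: s; exact: nbhs_left_lt.
have s0 : 0 < s by near: s; exact: nbhs_left_gt.
have sd : t - d < s by near: s; apply: nbhs_left_gt; lra.
have := Pd (t - s); rewrite add0r subr_gt0 st/= ltrBlDl -ltrBlDr sd => /(_ isT).
rewrite sub0r normrN => B; have ts0 : 0 <= t - s by rewrite subr_ge0 ltW.
have := tf_continuous pP x z ts0 (ltW s0); rewrite subrK => /le_trans; apply.
exact: le_trans (ler_norm _) B.
Unshelve. all: by end_near. Qed.

Let kn n z y := fine (iter n (act K) (delta z) y).

Let knE n z y : ((kn n z y)%:E = iter n (act K) (delta z) y)%E.
Proof.
have I0 : (0 <= iter n (act K) (delta z) y)%E by exact: iter_act_ge0.
rewrite fineK// ge0_fin_numE//; apply: le_lt_trans (ltry 1).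
by apply: iter_act_le1 => // w; rewrite delta_ge0/= /delta lee_fin lern1 leq_b1.
Qed.

Let k0 x y : 0 <= k x y. Proof. by rewrite fine_ge0. Qed.

(** The degree drops by one while the coefficients [c n] stay: this is the recursion between
    successive truncations of the exponential series. *)
Lemma expR_poly_right_derivative (c : nat -> R) m t :
  ((\sum_(n < m) (La * (t + h)) ^+ n.+1 / n.+1`!%:R * c n) -
   (\sum_(n < m) (La * t) ^+ n.+1 / n.+1`!%:R * c n)) / h @[h --> 0^'+] -->
  La * \sum_(n < m) (La * t) ^+ n / n`!%:R * c n.
Proof.
elim: m => [|m ih].
  have -> : La * \sum_(n < 0) (La * t) ^+ n / n`!%:R * c n = 0 by rewrite big_ord0 mulr0.
  by apply: cvg_near_cst; apply: nearW => h; rewrite !big_ord0 subrr mul0r.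
pose f (s : R) := (La * s) ^+ m.+1 / m.+1`!%:R * c m.
have fd : is_derive t 1 f (La * ((La * t) ^+ m / m`!%:R * c m)).
  have -> : f = horner ((La ^+ m.+1 / m.+1`!%:R * c m) *: 'X^(m.+1)).
    by apply/funext => s; rewrite /f hornerZ hornerXn exprMn; ring.
  apply: is_derive_eq; rewrite derivZ derivXn hornerZ hornerMn hornerXn/=.
  rewrite factS natrM exprMn exprS.
  have : (m`!%:R : R) != 0 by rewrite pnatr_eq0 -lt0n fact_gt0.
  have : (m.+1%:R : R) != 0 by rewrite pnatr_eq0.
  rewrite -[t ^+ m *+ _]mulr_natr; move: (m.+1%:R : R) (m`!%:R : R) => u v u0 v0.
  by field; rewrite u0 v0.
have -> : La * \sum_(n < m.+1) (La * t) ^+ n / n`!%:R * c n =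
    La * \sum_(n < m) (La * t) ^+ n / n`!%:R * c n + La * ((La * t) ^+ m / m`!%:R * c m).
  by rewrite big_ord_recr/= mulrDr.
rewrite [X in X @ _](_ : _ = (fun h =>
    (\sum_(n < m) (La * (t + h)) ^+ n.+1 / n.+1`!%:R * c n -
     \sum_(n < m) (La * t) ^+ n.+1 / n.+1`!%:R * c n) / h + (f (t + h) - f t) / h)).
  by apply: cvgD => //; exact: is_derive_right.
by apply/funext => h; rewrite !big_ord_recr/= -mulrDl /f; congr (_ / h); ring.
Qed.

(** The factor [expR (La * t)] absorbs the loss term of the backward equation. The derivative of one
    truncation is then [La] times the kernel applied to the previous one, so the induction
    hypothesis compares derivatives. *)
Lemma tf_ge_exp_poly m t x z : 0 <= t ->
  \sum_(n < m) (La * t) ^+ n / n`!%:R * kn n z x <= expR (La * t) * p t x z.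
Proof.
elim: m t x => [|m ih] t x t0.
  by rewrite big_ord0 mulr_ge0 ?expR_ge0// (tf_ge0 pP).
(* The first step is restricted to a finite set [F], so that no infinite sum is differentiated; the
   supremum over [F] is taken afterwards. *)
suff step (F : {fset S}) : (x == z)%:R + \sum_(n < m) (La * t) ^+ n.+1 / n.+1`!%:R *
    \sum_(y <- F) k x y * kn n z y <= expR (La * t) * p t x z.
  rewrite big_ord_recl expr0 fact0 divr1 mul1r (_ : kn (@ord0 m) z x = (x == z)%:R)// -lerBrDl.
  pose c n := (La * t) ^+ n.+1 / n.+1`!%:R.
  have c0 n : 0 <= c n by rewrite divr_ge0// exprn_ge0// mulr_ge0// ltW.
  under eq_bigr do rewrite lift0 -/(c _).
  rewrite -lee_fin -sumEFin.
  apply: (@le_trans _ _ (\esum_(y in [set: S])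
    (K x y * \sum_(n < m) ((c n)%:E * iter n (act K) (delta z) y)))%E).
    have I0 n y : (0 <= iter n (act K) (delta z) y)%E by exact: iter_act_ge0.
    under [leRHS]eq_esum => y _.
      rewrite ge0_sume_distrr; last by move=> n _; rewrite mule_ge0 ?lee_fin.
      over.
    rewrite esum_sum; last by move=> y n _ _; rewrite !mule_ge0 ?lee_fin.
    apply: lee_sum => n _; rewrite EFinM knE iterS -(actZ K0) ?lee_fin//.
  apply: ge_ereal_sup => _ [X [finX _] <-]; rewrite fsbig_finite//=.
  have := step (fset_set X); rewrite -lerBrDl -lee_fin; apply: le_trans.
  rewrite [leLHS](_ : _ = (\sum_(y <- fset_set X) k x y * \sum_(n < m) c n * kn n z y)%:E).
    rewrite lee_fin; under eq_bigr do rewrite mulr_sumr.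
    rewrite exchange_big/=; apply: ler_sum => n _; rewrite mulr_sumr.
    by apply: ler_sum => y _; rewrite mulrCA.
  rewrite -sumEFin; apply: eq_bigr => y _; rewrite EFinM fineK ?(kernel_fin K0 K1)//.
  by rewrite -sumEFin; congr (_ * _)%E; apply: eq_bigr => n _; rewrite [in RHS]EFinM knE.
pose kF n := \sum_(y <- F) k x y * kn n z y.
pose poly s := \sum_(n < m) (La * s) ^+ n.+1 / n.+1`!%:R * kF n.
pose g s := expR (La * s) * p s x z - ((x == z)%:R + poly s).
have id0 : h @[h --> (0 : R)^'+] --> (0 : R) by apply: cvg_at_right_filter; exact: cvg_id.
suff : g 0 <= g t.
  rewrite {1}/g mulr0 expR0 mul1r (tf_init pP) /poly big1 ?addr0 ?subrr ?subr_ge0//.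
  by move=> i _; rewrite exprS mulr0 !mul0r.
apply: right_derivative_ge0 => // {t t0} t e t0 e0.
  (* The state [x] is added because [p h x x] tends to 1 and supplies the value [p t x z] at
     [h = 0]. *)
  pose F' := (x |` F)%fset.
  pose A h := \sum_(y <- F') p h x y * p t y z.
  pose B := \sum_(y <- F') k x y * p t y z.
  (* A minorant of [g (t + h)], obtained by keeping only the states of [F'] at time [h]. Its right
     derivative at [h = 0] follows from the rates alone. *)
  pose L h := expR (La * (t + h)) * A h - ((x == z)%:R + poly (t + h)).
  have Ax h : A h - p t x z = \sum_(y <- F') (p h x y - (x == y)%:R) * p t y z.
    rewrite /A [in RHS](eq_bigr (fun y => p h x y * p t y z - (x == y)%:R * p t y z)); last first.
      by move=> y _; rewrite mulrBl.
    rewrite sumrB; congr (_ - _); rewrite (big_fsetD1 x)/=; last by rewrite !inE eqxx.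
    rewrite eqxx mul1r big1_fset ?addr0// => y.
    by rewrite !inE eq_sym => /andP[/negPf -> _] _; rewrite mul0r.
  have dA : (A h - p t x z) / h @[h --> 0^'+] --> La * (B - p t x z).
    have -> : La * (B - p t x z) = \sum_(y <- F') La * (k x y - (x == y)%:R) * p t y z.
      under eq_bigr do rewrite -mulrA mulrBl.
      rewrite -mulr_sumr sumrB; congr (_ * (_ - _)); rewrite (big_fsetD1 x)/=; last by rewrite !inE eqxx.
      rewrite eqxx mul1r big1_fset ?addr0// => y.
      by rewrite !inE eq_sym => /andP[/negPf -> _] _; rewrite mul0r.
    under eq_fun do rewrite Ax mulr_suml.
    apply: cvg_big => [|y _]; first exact: add_continuous.
    under eq_fun do rewrite mulrAC.
    by apply: cvgM; [exact: tf_derive_kernel|exact: cvg_cst].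
  have dE : (expR (La * (t + h)) - expR (La * t)) / h @[h --> 0^'+] --> La * expR (La * t).
    apply: (@is_derive_right _ (fun s => expR (La * s))).
    apply: is_derive_eq; rewrite /GRing.scale/=; ring.
  have cE : expR (La * (t + h)) @[h --> (0 : R)^'+] --> expR (La * t).
    apply: continuous_cvg; first exact: continuous_expR.
    apply: cvgM; first exact: cvg_cst.
    rewrite -[X in _ --> X]addr0; apply: cvgD => //; exact: cvg_cst.
  have dp := @expR_poly_right_derivative kF m t.
  have dL : (L h - g t) / h @[h --> 0^'+] -->
      La * expR (La * t) * p t x z + expR (La * t) * (La * (B - p t x z)) -
      La * \sum_(n < m) (La * t) ^+ n / n`!%:R * kF n.
    rewrite [X in X @ _](_ : _ = (fun h =>
      (expR (La * (t + h)) - expR (La * t)) / h * p t x z +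
      expR (La * (t + h)) * ((A h - p t x z) / h) - (poly (t + h) - poly t) / h)).
      by apply: cvgB => //; apply: cvgD; apply: cvgM => //; exact: cvg_cst.
    by apply/funext => h; rewrite /L /g; ring.
  have D0 : 0 <= La * expR (La * t) * p t x z + expR (La * t) * (La * (B - p t x z)) -
      La * \sum_(n < m) (La * t) ^+ n / n`!%:R * kF n.
    (* The derivative of the exponential cancels the loss term [- p t x z]. *)
    rewrite subr_ge0 [leRHS](_ : _ = La * (expR (La * t) * B)); last by ring.
    rewrite ler_pM2l//.
    apply: (@le_trans _ _ (\sum_(y <- F) k x y * (expR (La * t) * p t y z))).
      apply: (@le_trans _ _ (\sum_(y <- F) k x y * \sum_(n < m) (La * t) ^+ n / n`!%:R * kn n z y)).
        under [leRHS]eq_bigr do rewrite mulr_sumr.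
        rewrite exchange_big/=; apply: ler_sum => n _; rewrite mulr_sumr.
        by apply: ler_sum => y _; rewrite mulrCA.
      by apply: ler_sum => y _; rewrite ler_wpM2l ?ih.
    rewrite /B mulr_sumr; under eq_bigr do rewrite mulrCA.
    have [xF|xF] := boolP (x \in F).
      by rewrite /F' (_ : (x |` F)%fset = F)//; apply/fsetP => y; rewrite !inE; case: eqP => // ->.
    rewrite /F' big_fsetU1//= lerDr.
    by rewrite !mulr_ge0 ?expR_ge0// (tf_ge0 pP).
  move/cvgrPdist_le : dL => /(_ e e0) dL.
  near=> h.
  have h0 : 0 < h by near: h; exact: nbhs_right_gt.
  apply: (@le_trans _ _ (L h)); last first.
    rewrite /L /g lerB// ler_wpM2l ?expR_ge0// addrC.
    by apply: (tf_ge_sum pP) => //; exact: ltW.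
  have : - e <= (L h - g t) / h.
    have : `|La * expR (La * t) * p t x z + expR (La * t) * (La * (B - p t x z)) -
      La * \sum_(n < m) (La * t) ^+ n / n`!%:R * kF n - (L h - g t) / h| <= e by near: h; exact: dL.
    rewrite ler_norml => /andP[_]; lra.
  by rewrite ler_pdivlMr//; lra.
have : g s @[s --> t^'-] --> g t.
  have cs : s @[s --> t^'-] --> t by apply: cvg_at_left_filter; exact: cvg_id.
  have cLs : La * s @[s --> t^'-] --> La * t by apply: cvgM => //; exact: cvg_cst.
  apply: cvgB; [apply: cvgM|apply: cvgD].
  - by apply: continuous_cvg => //; exact: continuous_expR.
  - by apply/cvgrPdist_le => d d0; exact: tf_leftcontinuous.
  - exact: cvg_cst.
  - apply: cvg_big => [|n _]; first exact: add_continuous.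
    apply: cvgM; [apply: cvgM|]; [|exact: cvg_cst..].
    exact: (@cvg_comp _ _ _ _ (fun u : R => u ^+ n.+1) _ _ _ cLs (@exprn_continuous _ n.+1 _)).
move/cvgrPdist_le => /(_ e e0); apply: filterS => s.
by rewrite ler_norml => /andP[+ _]; lra.
Unshelve. all: by end_near. Qed.

Lemma tf_unique t x z : 0 <= t -> p t x z = unif_trans K La t x z.
Proof.
move=> t0; have uP := unif_trans_transition_function K0 K1 La0 qK.
have le y : unif_trans K La t x y <= p t x y.
  have Lt0 : 0 <= La * t by rewrite mulr_ge0// ltW.
  rewrite -lee_fin fineK ?unif_delta_fin// /unif -nneseries_esumT; last first.
    by move=> n; rewrite mule_ge0 ?iter_act_ge0// lee_fin poisson_weight_ge0.
  apply: lime_le.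
    apply: is_cvg_nneseries => n _ _.
    by rewrite mule_ge0 ?iter_act_ge0// lee_fin poisson_weight_ge0.
  apply: nearW => m; rewrite big_mkord.
  rewrite (eq_bigr (fun n : 'I_m => (poisson_weight (La * t) n * kn n y x)%:E)); last first.
    by move=> n _; rewrite [in RHS]EFinM knE.
  rewrite sumEFin lee_fin; have := tf_ge_exp_poly m x y t0.
  rewrite -ler_pdivrMl ?expR_gt0// -expRN mulr_sumr; apply: le_trans.
  by apply: ler_sum => n _; rewrite /poisson_weight -[leLHS]mulrA.
apply/esym/EFin_inj.
apply: (@esum_eq_of_le _ _ (fun y => (unif_trans K La t x y)%:E) (fun y => (p t x y)%:E)) => [y|y||].
- by rewrite lee_fin (tf_ge0 uP).
- by rewrite lee_fin.
- exact: (tf_sum1 uP x t0).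
- exact: (tf_sum1 pP x t0).
Qed.

End Uniqueness.

(** * Lebesgue measure on the unit interval as a probability *)

Section UnitInterval.
Context {R : realType}.

Definition unit_lebesgue :=
  mrestr (@lebesgue_measure R) (measurable_itv `[0%R, 1%R[).

HB.instance Definition _ := Measure.on unit_lebesgue.

Lemma unit_lebesgue_setT : (unit_lebesgue setT = 1)%E.
Proof.
rewrite /unit_lebesgue /mrestr setTI lebesgue_measure_itv/= lte_fin ltr01.
by rewrite oppr0 adde0.
Qed.

HB.instance Definition _ := Measure_isProbability.Build _ _ _
  unit_lebesgue unit_lebesgue_setT.

End UnitInterval.

(** * Random variables with countably many values *)

Section CountableSums.
Local Open Scope ereal_scope.
Context {R : realType} {T : countType}.

Lemma esum_pickle (A : set T) (f : T -> \bar R) : (forall s, 0 <= f s) ->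
  \esum_(s in A) f s =
  \sum_(i <oo) (if pickle_inv i is Some s then if s \in A then f s else 0 else 0).
Proof.
move=> f0; pose g i := if @pickle_inv T i is Some s then if s \in A then f s else 0 else 0.
rewrite [RHS](_ : _ = \sum_(i <oo) g i)//.
have g0 i : 0 <= g i by rewrite /g; case: pickle_inv => // s; case: ifP.
rewrite nneseries_esumT//; transitivity (\esum_(i in choice.pickle @` A) g i).
  rewrite (reindex_esum A (choice.pickle @` A) choice.pickle); last first.
    by apply: inj_bij => x y _ _; exact: (pcan_inj (@choice.pickleK T)).
  by apply: eq_esum => s As; rewrite /g pickleK_inv mem_set.
rewrite esum_mkcond; apply: eq_esum => i _; case: ifPn => //.
rewrite notin_setE /g => Ai.
have := @pickle_invK T i; case: pickle_inv => //= s si; case: ifPn => //.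
by rewrite inE => As; case: Ai; exists s.
Qed.

Context (d : measure_display) (Om : measurableType d) (P : probability Om R).
Variable Y : Om -> T.
Hypothesis mY : forall s, measurable [set w | Y w = s].

Let slice (A : set T) i : set Om :=
  if pickle_inv i is Some s then if s \in A then [set w | Y w = s] else set0 else set0.

Let sliceE A : [set w | A (Y w)] = \bigcup_i slice A i.
Proof.
apply/seteqP; split=> [w /= Aw|w [i _]].
  by exists (choice.pickle (Y w)) => //; rewrite /slice pickleK_inv mem_set.
rewrite /slice; case: pickle_inv => // s; case: ifPn => //.
by rewrite inE => As /= ->.
Qed.

Let slice_measurable A i : measurable (slice A i).
Proof. by rewrite /slice; case: pickle_inv => // s; case: ifP. Qed.

Lemma countable_valued_measurable (A : set T) : measurable [set w | A (Y w)].
Proof. by rewrite sliceE; apply: bigcup_measurable => i _. Qed.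

Lemma countable_valued_prob (A : set T) :
  P [set w | A (Y w)] = \esum_(s in A) P [set w | Y w = s].
Proof.
rewrite sliceE measure_semi_bigcup//; last first.
- by rewrite -sliceE; exact: countable_valued_measurable.
- apply/trivIsetP => i j _ _ ij; apply/seteqP; split => // w [].
  have := @pickle_invK T i; have := @pickle_invK T j; rewrite /slice.
  case: (pickle_inv j) => // s /= sj; case: (pickle_inv i) => // s' /= si.
  do 2![case: ifP => // _] => /= e1 e2.
  by move: ij; rewrite -si -sj -e1 -e2 eqxx.
rewrite esum_pickle//; apply: eq_eseriesr => i _; rewrite /slice.
by case: pickle_inv => [s|]; [case: ifP => // _|]; rewrite measure0.
Qed.

End CountableSums.

(** * Cutting an interval into pieces of prescribed lengths *)

Section Partition.
Context {R : realType} {T : countType} (A : set T) (u : T -> R) (b : R).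
Hypothesis u0 : forall s, 0 <= u s.
Hypothesis ub : (\esum_(s in A) (u s)%:E = b%:E)%E.

Definition code_weight (i : nat) : R :=
  if pickle_inv i is Some s then (if s \in A then u s else 0) else 0.

(** Pieces are laid out from left to right in the order of the codes: [s] receives [[left_mass s,
    left_mass s + u s[]. *)
Definition left_mass (s : T) : R := \sum_(i < choice.pickle s) code_weight i.

Lemma code_weight_ge0 i : 0 <= code_weight i.
Proof. by rewrite /code_weight; case: pickle_inv => // s; case: ifP. Qed.

Lemma code_weight_pickle s : A s -> code_weight (choice.pickle s) = u s.
Proof. by move=> As; rewrite /code_weight pickleK_inv mem_set. Qed.

Lemma left_mass_ge0 s : 0 <= left_mass s.
Proof. by apply: sumr_ge0 => i _; exact: code_weight_ge0. Qed.

Lemma code_weight_sum : (\sum_(i <oo) (code_weight i)%:E = b%:E)%E.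
Proof.
rewrite -ub esum_pickle//; apply: eq_eseriesr => i _; rewrite /code_weight.
by case: pickle_inv => // s; case: ifP.
Qed.

Lemma partial_mass_le n : \sum_(i < n) code_weight i <= b.
Proof.
rewrite -lee_fin -code_weight_sum -sumEFin -(big_mkord xpredT (fun i => (code_weight i)%:E)).
by apply: nneseries_lim_ge => i _; rewrite lee_fin code_weight_ge0.
Qed.

Lemma left_massD s : A s ->
  left_mass s + u s = \sum_(i < (choice.pickle s).+1) code_weight i.
Proof. by move=> As; rewrite big_ord_recr/= code_weight_pickle. Qed.

Lemma left_mass_le s : A s -> left_mass s + u s <= b.
Proof.
move=> As; rewrite left_massD//; exact: partial_mass_le.
Qed.

(** Take the least number of codes whose total weight exceeds [x]. The last of these weights is
    nonzero, so its code is that of an element of [A]. *)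
Lemma partition_exists x : 0 <= x < b ->
  exists2 s, A s & left_mass s <= x < left_mass s + u s.
Proof.
move=> /andP[x0 xb].
have [n xn] : exists n, x < \sum_(i < n) code_weight i.
  apply: contrapT => /forallNP xn; move: xb; rewrite ltNge => /negP; apply.
  rewrite -lee_fin -code_weight_sum; apply: lime_le.
    by apply: is_cvg_nneseries => i _ _; rewrite lee_fin code_weight_ge0.
  apply: nearW => n; rewrite big_mkord sumEFin lee_fin leNgt; apply/negP; exact: xn.
have exn : exists n, x < \sum_(i < n) code_weight i by exists n.
case: (ex_minnP exn) => -[|i]; first by rewrite big_ord0 ltNge x0.
rewrite big_ord_recr/= => xi mini.
have xi' : \sum_(j < i) code_weight j <= x.
  by rewrite leNgt; apply/negP => /mini; rewrite ltnn.
have : code_weight i != 0.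
  by apply/eqP => wi; move: xi; rewrite wi addr0 ltNge xi'.
have wE : code_weight i = code_weight i by [].
move: {1}wE; rewrite {1}/code_weight; have := @pickle_invK T i.
case: pickle_inv => [s /= si|_ <-]; last by rewrite eqxx.
case: ifPn => [|_ <-]; last by rewrite eqxx.
rewrite inE => As us _; exists s => //.
by rewrite /left_mass si us xi' xi.
Qed.

Lemma partition_unique x s1 s2 : A s1 -> A s2 ->
  left_mass s1 <= x < left_mass s1 + u s1 ->
  left_mass s2 <= x < left_mass s2 + u s2 -> s1 = s2.
Proof.
wlog : s1 s2 / (choice.pickle s1 <= choice.pickle s2)%N.
  move=> H A1 A2 x1 x2; case: (leqP (choice.pickle s1) (choice.pickle s2)) => [s12|/ltnW s21].
    exact: H.
  by apply/esym; exact: H.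
rewrite leq_eqVlt => /predU1P[/(pcan_inj (@choice.pickleK T))//|s12] A1 A2 /andP[_ x1] /andP[x2 _].
suff : left_mass s1 + u s1 <= left_mass s2 by move=> ?; exfalso; lra.
rewrite left_massD// /left_mass.
rewrite -(subnKC s12) -(big_mkord xpredT) -(big_mkord xpredT code_weight).
rewrite [leRHS](big_cat_nat (n := (choice.pickle s1).+1))//= ?leq_addr// lerDl.
by apply: sumr_ge0 => i _; exact: code_weight_ge0.
Qed.

End Partition.

(** * Realization of a consistent family of discrete laws *)

Section ProjectiveLimit.
Context {R : realType} {T : countType} (r : nat -> T -> T) (pi : nat -> T -> R).
Variable root : T.
Hypothesis pi0 : forall m s, 0 <= pi m s.
Hypothesis pi_root : forall s, pi 0 s = (s == root)%:R.
Hypothesis pi_proj : forall m s,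
  (\esum_(s' in [set s' | r m s' = s]) (pi m.+1 s')%:E = (pi m s)%:E)%E.

(** The cell of [s] at level [m + 1] is a piece of the cell of its parent [r m s]. At level 0 all
    cells start at 0, but only that of [root] is nonempty. *)
Fixpoint cell_left m s : R :=
  if m is m'.+1 then
    cell_left m' (r m' s) + left_mass [set s' | r m' s' = r m' s] (pi m) s
  else 0.

Definition cell m s : set R := `[cell_left m s, cell_left m s + pi m s[.

Lemma cell_sub m s : cell m.+1 s `<=` cell m (r m s).
Proof.
move=> x; rewrite /cell/= !in_itv/= => /andP[x1 x2].
have ll := @left_mass_ge0 _ _ [set s' | r m s' = r m s] (pi m.+1) (pi0 m.+1) s.
have lu := left_mass_le (pi0 m.+1) (pi_proj m (r m s)) (erefl : [set s' | r m s' = r m s] s).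
by apply/andP; split; lra.
Qed.

Lemma cell_unit m s : cell m s `<=` `[0, 1[.
Proof.
elim: m s => [|m ih] s; last exact: subset_trans (@cell_sub m s) (ih _).
move=> x; rewrite /cell/= add0r !in_itv/= pi_root => /andP[-> /lt_le_trans->//].
by rewrite lern1 leq_b1.
Qed.

Lemma cell_exists m x : `[0, 1[%classic x -> exists s, cell m s x.
Proof.
move=> x01; elim: m => [|m [s]].
  by exists root; rewrite /cell/= pi_root eqxx add0r.
rewrite /cell/= in_itv/= => /andP[x1 x2].
have [|s' s's xs'] := partition_exists (pi0 m.+1) (pi_proj m s) (x := x - cell_left m s).
  by apply/andP; split; lra.
exists s'; rewrite /= in_itv/= s's; move: xs' => /andP[? ?].
by apply/andP; split; lra.
Qed.

Lemma cell_unique m x s1 s2 : cell m s1 x -> cell m s2 x -> s1 = s2.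
Proof.
elim: m s1 s2 => [|m ih] s1 s2.
  rewrite /cell/= !in_itv/= !add0r !pi_root => /andP[x0 x1] /andP[_ x2].
  have eq1 s : x < (s == root)%:R -> s = root.
    by case: eqP => // _; rewrite ltNge x0.
  by rewrite (eq1 _ x1) (eq1 _ x2).
move=> x1 x2; have r12 := ih _ _ (cell_sub x1) (cell_sub x2).
move: x1 x2; rewrite /cell/= !in_itv/= r12 => /andP[x1 x1'] /andP[x2 x2'].
apply: (partition_unique (pi0 m.+1) (x := x - cell_left m (r m s2)) (A := [set s' | r m s' = r m s2])) => //; apply/andP; split; lra.
Qed.

(* Every point of the real line is sent to [0, 1[, so that the random variables
   below have no exceptional null set. *)
Definition clamp (x : R) : R := if x \in `[0, 1[ then x else 0.

Lemma clamp_unit x : `[0, 1[%classic (clamp x).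
Proof. by rewrite /clamp/=; case: ifPn => //= _; rewrite in_itv/= lexx ltr01. Qed.

Definition limit_var m x : T := projT1 (cid (cell_exists m (clamp_unit x))).

Lemma limit_varP m x : cell m (limit_var m x) (clamp x).
Proof. by rewrite /limit_var; case: cid. Qed.

Lemma limit_var_proj m x : r m (limit_var m.+1 x) = limit_var m x.
Proof. exact: cell_unique (cell_sub (limit_varP m.+1 x)) (limit_varP m x). Qed.

Lemma limit_var_gt0 m x : 0 < pi m (limit_var m x).
Proof. by have := limit_varP m x; rewrite /cell/= in_itv/= => /andP[? ?]; lra. Qed.

Lemma limit_var_clamp m x s : (limit_var m x = s) <-> cell m s (clamp x).
Proof.
split=> [<-|]; first exact: limit_varP.
by move=> sx; exact: cell_unique (limit_varP m x) sx.
Qed.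

Lemma limit_var_measurable m s : measurable [set x | limit_var m x = s].
Proof.
(* Points outside [[0, 1[] behave like 0, so either all or none of them are added to the cell. *)
rewrite (_ : [set x | _] = cell m s `|` (~` `[0, 1[ `&` [set x | cell m s 0])).
  apply: measurableU; first exact: measurable_itv.
  apply: measurableI; first by apply: measurableC; exact: measurable_itv.
  by have [c0|c0] := pselect (cell m s 0);
    [rewrite (_ : [set _ | _] = setT)|rewrite (_ : [set _ | _] = set0)] => //;
    apply/seteqP; split.
apply/seteqP; split=> [x /limit_var_clamp|x]; rewrite /clamp.
  by case: ifPn => [_|x01]; [left|right; split=> //=; apply/negP].
move=> H; apply/limit_var_clamp; rewrite /clamp; case: H => [sx|[/negP/negPf x01] c0].
  by have := cell_unit sx; rewrite /= => ->.
by rewrite x01.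
Qed.

Lemma limit_var_prob m s :
  unit_lebesgue [set x | limit_var m x = s] = (pi m s)%:E.
Proof.
rewrite /unit_lebesgue /mrestr (_ : _ `&` _ = cell m s); last first.
  apply/seteqP; split=> [x [/limit_var_clamp]|x sx]; rewrite /clamp/=.
    by move=> + x01; rewrite x01.
  have x01 := cell_unit sx; split=> //; apply/limit_var_clamp.
  by rewrite /clamp; move: x01; rewrite /= => ->.
rewrite lebesgue_measure_itv/= lte_fin ltrDl; case: ltP => [_|].
  by rewrite -EFinD addrAC subrr add0r.
by move=> pi_le0; congr EFin; apply/eqP; rewrite eq_le pi0.
Qed.

End ProjectiveLimit.

(** * Expectations over paths of a discrete-time chain *)

Section PathExpectation.
Local Open Scope ereal_scope.
Context {R : realType}.
Implicit Types (S : choiceType).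

(* The expectation of [F (X_1, ..., X_L)] for the discrete-time chain with
   kernel [P] started at [x]. *)
Fixpoint path_exp S (P : S -> S -> \bar R) L x (F : seq S -> \bar R) : \bar R :=
  if L is L'.+1 then act P (fun y => path_exp P L' y (fun s => F (y :: s))) x
  else F [::].

Section Basics.
Context {S : choiceType} (P : S -> S -> \bar R).
Hypothesis P0 : forall x y, 0 <= P x y.
Implicit Types (F G : seq S -> \bar R).

Lemma path_exp_ge0 L x F : (forall s, 0 <= F s) -> 0 <= path_exp P L x F.
Proof.
elim: L x F => [|L ih] x F F0 /=; [exact: F0|apply: (act_ge0 P0) => y].
by apply: ih => s; exact: F0.
Qed.

Lemma eq_path_exp L x F G : (forall s, size s = L -> F s = G s) ->
  path_exp P L x F = path_exp P L x G.
Proof.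
elim: L x F G => [|L ih] x F G FG /=; first exact: FG.
by apply: eq_act => y; apply: ih => s sL; apply: FG; rewrite /= sL.
Qed.

Lemma path_exp_esum (I : choiceType) (A : set I) L x (f : seq S -> I -> \bar R) :
  (forall s i, 0 <= f s i) ->
  path_exp P L x (fun s => \esum_(i in A) f s i) =
  \esum_(i in A) path_exp P L x (f ^~ i).
Proof.
elim: L x f => [//|L ih] x f f0 /=.
rewrite (eq_act _ _ (fun y => ih y (fun s => f (y :: s)) (fun s i => f0 _ i))).
by rewrite (act_esum P0)// => y i; apply: path_exp_ge0.
Qed.

Lemma path_expZ c L x F : 0 <= c -> (forall s, 0 <= F s) ->
  path_exp P L x (fun s => c * F s) = c * path_exp P L x F.
Proof.
move=> c0; elim: L x F => [//|L ih] x F F0 /=.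
rewrite (eq_act _ _ (fun y => ih y (fun s => F (y :: s)) (fun s => F0 _))).
by rewrite (actZ P0)// => y; apply: path_exp_ge0.
Qed.

Lemma path_exp_cat L L' x F :
  path_exp P (L + L') x F = path_exp P L x (fun s =>
    path_exp P L' (last x s) (fun s' => F (s ++ s'))).
Proof.
elim: L x F => [//|L ih] x F /=.
by apply: eq_act => y; rewrite ih.
Qed.

Lemma path_exp_last L x (G : S -> \bar R) :
  path_exp P L x (fun s => G (last x s)) = iter L (act P) G x.
Proof.
elim: L x => [//|L ih] x; rewrite iterS /=.
by apply: eq_act => y; rewrite -ih.
Qed.

Lemma path_exp_support (rho : S -> S -> Prop) L x t :
  (forall a b, P a b != 0 -> rho a b) ->
  path_exp P L x (delta t) != 0 ->
  size t = L /\ forall i, (i < L)%N -> rho (nth x (x :: t) i) (nth x (x :: t) i.+1).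
Proof.
move=> Prho; elim: L x t => [|L ih] x t /=.
  by case: t => [|z t]; rewrite /delta/= ?eqxx.
move=> /esum_neq0[y yP].
case: t yP => [|z t] yP.
  (* Zero is written [0 * 0] so that [path_expZ] can pull out a factor 0. *)
  exfalso; move: yP; rewrite (@eq_path_exp _ _ _ (fun=> 0 * 0))// => [|s _]; last by rewrite mule0.
  by rewrite path_expZ// mul0e mule0 eqxx.
have [zy|zy] := eqVneq y z; last first.
  exfalso; move: yP; rewrite (@eq_path_exp _ _ _ (fun=> 0 * 0)) => [|s _].
    by rewrite path_expZ// mul0e mule0 eqxx.
  by rewrite mule0 /delta eqseq_cons (negPf zy).
subst z.
have /= yP' : P x y * path_exp P L y (delta t) != 0.
  rewrite (@eq_path_exp _ _ _ (fun s => delta (y :: t) (y :: s)))// => s _.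
  by rewrite /delta eqseq_cons eqxx.
have Pxy : P x y != 0 by apply/eqP => e; move: yP'; rewrite e mul0e eqxx.
have [|sL rL] := ih y t; first by apply/eqP => e; move: yP'; rewrite e mule0 eqxx.
split=> [|[|i] iL /=]; [by rewrite /= sL|exact: Prho|].
have := rL i iL; rewrite /= (set_nth_default y x)//=; last by rewrite /= sL ltnW.
by rewrite (set_nth_default y x)// sL.
Qed.

Hypothesis P1 : forall x, \esum_(y in [set: S]) P x y = 1.

Lemma path_exp_cst c L x : 0 <= c -> path_exp P L x (fun=> c) = c.
Proof.
move=> c0; elim: L x => [//|L ih] x /=.
by rewrite (eq_act _ _ (ih)) (act_cst P0).
Qed.

Lemma path_exp_take L L' x F : (forall s, 0 <= F s) ->
  path_exp P (L + L') x (fun s => F (take L s)) = path_exp P L x F.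
Proof.
move=> F0; rewrite path_exp_cat; apply: eq_path_exp => s sL.
by under eq_fun do rewrite take_size_cat//; rewrite path_exp_cst.
Qed.

Lemma path_exp_le1 L x F : (forall s, 0 <= F s <= 1) -> path_exp P L x F <= 1.
Proof.
elim: L x F => [|L ih] x F F01 /=; first by case/andP: (F01 [::]).
rewrite -(P1 x); apply: le_esum => y _; rewrite -[leRHS]mule1.
by apply: lee_wpmul2l => //; exact: ih.
Qed.

(** The last [c] steps integrate to 1, and the [b] steps before them give a power of the kernel,
    started at the state reached after [a] steps. *)
Lemma path_exp_markov a b c x F (G : S -> \bar R) :
  (forall s, 0 <= F s) -> (forall y, 0 <= G y) ->
  path_exp P (a + b + c) x (fun s => F (take a s) * G (last x (take (a + b) s))) =
  path_exp P a x (fun s => F s * iter b (act P) G (last x s)).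
Proof.
move=> F0 G0.
transitivity (path_exp P (a + b) x (fun s => F (take a s) * G (last x s))).
  rewrite -[RHS](@path_exp_take _ c); last by move=> s; rewrite mule_ge0.
  apply: eq_path_exp => s sL; congr (F _ * _).
  by rewrite take_takel// leq_addr.
rewrite path_exp_cat; apply: eq_path_exp => s sa.
rewrite -path_exp_last -path_expZ//; apply: eq_path_exp => s' s'b.
by rewrite take_size_cat// last_cat.
Qed.

End Basics.

(** Paths are listed without their starting point, so the second, fourth, ... entries are the states
    at even times. *)
Fixpoint evens {S : Type} (s : seq S) : seq S :=
  if s is _ :: y :: s' then y :: evens s' else [::].

Lemma path_exp_evens S (P Q : S -> S -> \bar R) L x F :
  (forall x y, 0 <= P x y) -> (forall x y, 0 <= Q x y) ->
  (forall G : S -> \bar R, (forall y, 0 <= G y) -> forall x, act P (act P G) x = act Q G x) ->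
  (forall s, 0 <= F s) ->
  path_exp P (2 * L) x (F \o evens) = path_exp Q L x F.
Proof.
move=> P0 Q0 PQ; elim: L x F => [|L ih] x F F0; first by rewrite muln0.
rewrite mulnS /= -PQ; last by move=> y; apply: path_exp_ge0.
apply: eq_act => z; apply: eq_act => y.
exact: (ih y (fun s => F (y :: s))).
Qed.

End PathExpectation.

(** * Restriction of a path to the next coarser grid *)

Section Restrict.
Context {S : eqType}.

(** Level [l + 1] has [4 * 4 ^ l] steps. Half of them reach the horizon [2 ^ l] of level [l], and
    every second one of these falls on its mesh. *)
Definition restrict_path l (s : seq S) : seq S :=
  if s is x :: t then x :: evens (take (2 * 4 ^ l) t) else [::].

Lemma nth_evens (x0 : S) i s : ((2 * i).+1 < size s)%N ->
  nth x0 (evens s) i = nth x0 s (2 * i).+1.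
Proof.
elim: i s => [|i ih] [|a [|b s]]//=; rewrite ?nth_nil ?mulnS ?add2n// => hs.
by rewrite ih; [congr nth; lia|lia].
Qed.

Lemma nth_restrict_path (x0 : S) l i s : size s = (4 ^ l.+1).+1 -> (i <= 4 ^ l)%N ->
  nth x0 (restrict_path l s) i = nth x0 s (2 * i).
Proof.
case: s i => [//|x t] [|i] // [st] il; rewrite expnS in st.
rewrite mulnS add2n.
change (nth x0 (evens (take (2 * 4 ^ l) t)) i = nth x0 t (2 * i).+1).
rewrite nth_evens; last by rewrite size_take_min; lia.
by rewrite nth_take//; lia.
Qed.

Lemma last_take (x0 x : S) j t : (j <= size t)%N -> last x (take j t) = nth x0 (x :: t) j.
Proof. by elim: t j x => [|y t ih] [|j] x //= jt; rewrite ih. Qed.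

End Restrict.

(** * The chain at dyadic times *)

Section Dyadic.
Local Open Scope ereal_scope.
Context {R : realType} {S : countType} (K : S -> S -> \bar R) (La : R).
Context (nu : S -> \bar R) (x0 : S).
Hypothesis K0 : forall x y, 0 <= K x y.
Hypothesis K1 : forall x, \esum_(y in [set: S]) K x y = 1.
Hypothesis La0 : (0 < La)%R.
Hypothesis nu0 : forall x, 0 <= nu x.
Hypothesis nu1 : \esum_(x in [set: S]) nu x = 1.

Definition mesh_rate (l : nat) : R := La / 2 ^+ l.

Lemma mesh_rate_ge0 l : (0 <= mesh_rate l)%R.
Proof. by rewrite divr_ge0// ?exprn_ge0// ltW. Qed.
Hint Resolve mesh_rate_ge0 : core.

Lemma mesh_rate_lift m k j :
  ((k * 2 ^ j)%:R * mesh_rate (m + j) = k%:R * mesh_rate m)%R.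
Proof.
rewrite /mesh_rate exprD natrM natrX -mulrA; congr (_ * _)%R.
by rewrite invfM mulrCA [X in (_ * X)%R]mulrCA divff ?expf_neq0// mulr1.
Qed.

Definition mesh_kernel l (x y : S) : \bar R := unif K (mesh_rate l) (delta y) x.

Lemma mesh_kernel_ge0 l x y : 0 <= mesh_kernel l x y.
Proof. apply: (unif_ge0 K0); [exact: mesh_rate_ge0|move=> z; exact: delta_ge0]. Qed.
Hint Resolve mesh_kernel_ge0 : core.

Lemma mesh_kernel_sum1 l x : \esum_(y in [set: S]) mesh_kernel l x y = 1.
Proof. exact: (unif_sum1 K0 K1 _ (mesh_rate_ge0 l)). Qed.

Lemma act_mesh_kernel l F x : (forall x, 0 <= F x) ->
  act (mesh_kernel l) F x = unif K (mesh_rate l) F x.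
Proof. by move=> F0; rewrite unifE. Qed.

Lemma iter_mesh_kernel l n F x : (forall x, 0 <= F x) ->
  iter n (act (mesh_kernel l)) F x = unif K (n%:R * mesh_rate l) F x.
Proof.
move=> F0; elim: n x => [|n ih] x; first by rewrite mul0r unif0.
rewrite iterS (eq_act _ _ ih).
have nm0 : (0 <= n%:R * mesh_rate l)%R by rewrite mulr_ge0.
rewrite act_mesh_kernel; last by move=> y; apply: (unif_ge0 K0).
rewrite (unifD K0 _ (mesh_rate_ge0 l) nm0 F0).
suff -> : (mesh_rate l + n%:R * mesh_rate l = n.+1%:R * mesh_rate l)%R by [].
by rewrite -natr1; ring.
Qed.

Lemma mesh_rate_halve l : (mesh_rate l.+1 + mesh_rate l.+1 = mesh_rate l)%R.
Proof. by rewrite /mesh_rate exprS invfM mulrA -mulrDl -splitr. Qed.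

Lemma mesh_kernel_halve l G x : (forall y, 0 <= G y) ->
  act (mesh_kernel l.+1) (act (mesh_kernel l.+1) G) x = act (mesh_kernel l) G x.
Proof.
move=> G0; rewrite (eq_act _ _ (fun y => act_mesh_kernel l.+1 y G0)).
rewrite act_mesh_kernel; last by move=> y; apply: (unif_ge0 K0).
by rewrite (unifD K0 _ (mesh_rate_ge0 _) (mesh_rate_ge0 _) G0) mesh_rate_halve act_mesh_kernel.
Qed.

Definition grid_exp l (F : seq S -> \bar R) : \bar R :=
  \esum_(x in [set: S]) (nu x * path_exp (mesh_kernel l) (4 ^ l) x (fun t => F (x :: t))).

Lemma grid_exp_ge0 l F : (forall s, 0 <= F s) -> 0 <= grid_exp l F.
Proof.
by move=> F0; apply: esum_ge0 => x _; rewrite mule_ge0// path_exp_ge0.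
Qed.

Lemma grid_exp_esum (I : choiceType) (A : set I) l (f : seq S -> I -> \bar R) :
  (forall s i, 0 <= f s i) ->
  grid_exp l (fun s => \esum_(i in A) f s i) = \esum_(i in A) grid_exp l (f ^~ i).
Proof.
move=> f0; rewrite /grid_exp -exchange_esum; last first.
  by move=> *; rewrite mule_ge0// path_exp_ge0.
apply: eq_esum => x _; rewrite path_exp_esum// ge0_esumZl// => i.
by rewrite path_exp_ge0.
Qed.

Lemma grid_exp_cst l : grid_exp l (fun=> 1) = 1.
Proof.
rewrite -[RHS]nu1; apply: eq_esum => x _.
by rewrite path_exp_cst ?mule1//; exact: mesh_kernel_sum1.
Qed.

(** Consistency of the grid laws: the extra half of the horizon integrates to 1, and two steps of
    the halved mesh make one step of the coarser mesh. *)
Lemma grid_exp_restrict l F : (forall s, 0 <= F s) ->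
  grid_exp l.+1 (F \o restrict_path l) = grid_exp l F.
Proof.
move=> F0; apply: eq_esum => x _; congr (_ * _) => /=.
rewrite (_ : (4 ^ l.+1 = 2 * 4 ^ l + 2 * 4 ^ l)%N); last by rewrite expnS; lia.
rewrite (@path_exp_take _ _ _ _ _ _ _ _ (fun t => F (x :: evens t)))//; last first.
  exact: mesh_kernel_sum1.
rewrite (@path_exp_evens _ _ _ (mesh_kernel l) _ _ (fun t => F (x :: t)))//.
by move=> G G0 y; exact: mesh_kernel_halve.
Qed.

Lemma grid_exp_delta_fin l s : grid_exp l (delta s) \is a fin_num.
Proof.
rewrite ge0_fin_numE; last by apply: grid_exp_ge0 => t; exact: delta_ge0.
apply: le_lt_trans (ltry 1).
rewrite -nu1; apply: le_esum => x _; rewrite -[leRHS]mule1; apply: lee_wpmul2l => //.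
apply: path_exp_le1 => //; first exact: mesh_kernel_sum1.
by move=> t; rewrite delta_ge0/= /delta lee_fin lern1 leq_b1.
Qed.

(* Level [0] is the common root of all the grids. *)
Definition grid_weight l (s : seq S) : R :=
  if l is l'.+1 then fine (grid_exp l' (delta s)) else (s == [::])%:R.

Definition grid_proj l (s : seq S) : seq S :=
  if l is l'.+1 then restrict_path l' s else [::].

Lemma grid_weight_ge0 l s : (0 <= grid_weight l s)%R.
Proof. case: l => [|l] /=; first by rewrite ler0n.
by apply: fine_ge0; apply: grid_exp_ge0 => t; exact: delta_ge0. Qed.

Lemma grid_weight_proj l s :
  \esum_(s' in [set s' | grid_proj l s' = s]) (grid_weight l.+1 s')%:E = (grid_weight l s)%:E.
Proof.
under eq_esum do rewrite /= fineK ?grid_exp_delta_fin//.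
rewrite -grid_exp_esum//.
transitivity (grid_exp l (fun s' => (grid_proj l s' == s)%:R%:E)).
  apply: eq_esum => x _; congr (_ * _); apply: eq_path_exp => t _.
  rewrite esum_mkcond (@esum_single _ _ _ (x :: t))//=.
  - rewrite /delta eqxx; case: ifPn => [|].
      by rewrite inE/= => ->; rewrite eqxx.
    by rewrite notin_setE/= => /eqP/negPf ->.
  - by case: ifP.
  - by move=> z /negPf; rewrite /delta eq_sym => ->; case: ifP.
case: l => [|l] /=; last first.
  by rewrite fineK ?grid_exp_delta_fin//; apply: (@grid_exp_restrict l (delta s)) => t; exact: delta_ge0.
rewrite eq_sym; case: eqP => [_|_]; first exact: grid_exp_cst.
apply: esum1 => x _; rewrite (@eq_path_exp _ _ _ _ _ _ (fun=> 0 * 0)) => [|? _]; last by rewrite mul0e.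
by rewrite path_expZ// mul0e mule0.
Qed.

Definition grid_var l (w : R) : seq S :=
  limit_var grid_weight_ge0 (fun s => erefl : grid_weight 0 s = (s == [::])%:R) grid_weight_proj l.+1 w.

Lemma grid_var_measurable l s : measurable [set w | grid_var l w = s].
Proof. exact: limit_var_measurable. Qed.

Lemma grid_var_law l (A : set (seq S)) :
  unit_lebesgue [set w | A (grid_var l w)] = grid_exp l (fun s => (s \in A)%:R%:E).
Proof.
apply: (etrans (countable_valued_prob unit_lebesgue (@grid_var_measurable l) A)).
transitivity (\esum_(s in A) grid_exp l (delta s)).
  apply: eq_esum => s _; apply: etrans (limit_var_prob _ _ _ _ _) _.
  by rewrite /= fineK ?grid_exp_delta_fin.
rewrite -grid_exp_esum//; apply: eq_esum => x _; congr (_ * _).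
apply: eq_path_exp => t _; rewrite esum_mkcond (@esum_single _ _ _ (x :: t))//=.
- by rewrite /delta eqxx; case: ifP.
- by case: ifP.
- by move=> z /negPf; rewrite /delta eq_sym => ->; case: ifP.
Qed.

(** Valid at every [w]: the realized path has positive weight, hence a possible start and only
    possible steps. *)
Lemma grid_var_support (rho : S -> S -> Prop) (G : set S) l w :
  (forall x, nu x != 0 -> G x) ->
  (forall a b, mesh_kernel l a b != 0 -> rho a b) ->
  [/\ size (grid_var l w) = (4 ^ l).+1, G (nth x0 (grid_var l w) 0) &
    forall i, (i < 4 ^ l)%N ->
      rho (nth x0 (grid_var l w) i) (nth x0 (grid_var l w) i.+1)].
Proof.
move=> nuG Krho; set s := grid_var l w.
have : grid_exp l (delta s) != 0.
  have := limit_var_gt0 grid_weight_ge0 (fun s => erefl : grid_weight 0 s = (s == [::])%:R)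
    grid_weight_proj l.+1 w.
  rewrite -/(grid_var l w) -/s /= => sgt0; apply/eqP => e0.
  by move: sgt0; rewrite e0 ltxx.
move=> /esum_neq0[x]; case: s => [|y t].
  rewrite (@eq_path_exp _ _ _ _ _ _ (fun=> 0 * 0)) => [|? _]; last by rewrite mul0e.
  by rewrite path_expZ// mul0e mule0 eqxx.
have [xy|xy] := eqVneq x y; last first.
  rewrite (@eq_path_exp _ _ _ _ _ _ (fun=> 0 * 0)) => [|? _].
    by rewrite path_expZ// mul0e mule0 eqxx.
  by rewrite mul0e /delta eqseq_cons (negPf xy).
subst y; rewrite mule_eq0 negb_or => /andP[nux].
rewrite (@eq_path_exp _ _ _ _ _ _ (delta t)) => [|s' _]; last first.
  by rewrite /delta eqseq_cons eqxx.
move=> /(path_exp_support (@mesh_kernel_ge0 l) Krho)[st rt].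
split=> [| |i il]; [by rewrite /= st|exact: nuG|].
have := rt i il; rewrite (set_nth_default x0)/= ?st 1?ltnW//.
by rewrite (set_nth_default x0 x)/= ?st.
Qed.


Section Lumping.
Context {S' : choiceType} (f : S -> S') (K' : S' -> S' -> \bar R).
Hypothesis K'0 : forall x y, 0 <= K' x y.
Hypothesis K'f : forall F : S' -> \bar R, (forall y, 0 <= F y) ->
  forall x, act K (F \o f) x = act K' F (f x).

(** The event up to index [n] depends on the first [i n] steps only, so the transition splits off.
    The event fixes only images under [f], but by lumpability the transition probability of the
    image depends only on [x n]. *)
Lemma grid_markov l n (i : nat -> nat) (x : nat -> S') :
  (forall k, (i k <= i k.+1)%N) -> (i n.+1 <= 4 ^ l)%N ->
  unit_lebesgue [set w | forall k, (k <= n.+1)%N -> f (nth x0 (grid_var l w) (i k)) = x k] =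
  unit_lebesgue [set w | forall k, (k <= n)%N -> f (nth x0 (grid_var l w) (i k)) = x k] *
    unif K' ((i n.+1 - i n)%:R * mesh_rate l) (delta (x n.+1)) (x n).
Proof.
move=> iS il.
have imono : {homo i : a b / (a <= b)%N} by exact: homo_leq leqnn leq_trans iS.
pose E n := [set s | forall k, (k <= n)%N -> f (nth x0 s (i k)) = x k].
pose p := unif K' ((i n.+1 - i n)%:R * mesh_rate l) (delta (x n.+1)) (x n).
have p0 : 0 <= p by apply: (unif_ge0 K'0) => //; rewrite mulr_ge0.
rewrite (grid_var_law l (E n.+1)) (grid_var_law l (E n)) -/p.
rewrite -ge0_esumZr//; last by move=> y; rewrite mule_ge0// path_exp_ge0.
apply: eq_esum => y _; rewrite -muleA; congr (_ * _).
(* Steps up to the present, from there to the next observation, and from there to the end of the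
   grid. *)
set a := i n; set b := (i n.+1 - i n)%N; set c := (4 ^ l - i n.+1)%N.
have abE : (a + b = i n.+1)%N by rewrite /a /b subnKC.
have abcE : (a + b + c = 4 ^ l)%N by rewrite abE /c subnKC.
pose F s : \bar R := ((y :: s) \in E n)%:R%:E.
pose G z : \bar R := delta (x n.+1) (f z).
have Etake k s : (k <= n)%N -> (a <= size s)%N ->
    nth x0 (y :: take a s) (i k) = nth x0 (y :: s) (i k).
  move=> kn asz; rewrite -[y :: take a s]/(take a.+1 (y :: s)) nth_take//.
  by rewrite ltnS; exact: imono.
have En_take s : size s = (4 ^ l)%N -> (y :: s \in E n) = (y :: take a s \in E n).
  move=> sz; have asz : (a <= size s)%N by rewrite sz -abcE -addnA leq_addr.
  by apply/idP/idP; rewrite !inE => H k kn; rewrite -?(H k kn) ?Etake.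
rewrite -abcE.
transitivity (path_exp (mesh_kernel l) (a + b + c) y
    (fun s => F (take a s) * G (last y (take (a + b) s)))).
  apply: eq_path_exp => s sz; rewrite abcE in sz.
  rewrite /F /G -En_take// (last_take x0); last by rewrite sz -abcE leq_addr.
  rewrite abE.
  rewrite -EFinM -natrM mulnb; congr ((nat_of_bool _)%:R%:E).
  apply/idP/idP; rewrite !inE/=.
    move=> H; apply/andP; split; last by apply/eqP; apply: H.
    by rewrite inE => k kn; apply: H; exact: leqW.
  move=> /andP[]; rewrite inE => H /eqP xn k; rewrite leq_eqVlt => /predU1P[->//|].
  by rewrite ltnS; exact: H.
have F0 s : 0 <= F s by rewrite lee_fin.
have G0 z : 0 <= G z by exact: delta_ge0.
rewrite (path_exp_markov (@mesh_kernel_ge0 l) (@mesh_kernel_sum1 l))//.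
transitivity (path_exp (mesh_kernel l) a y (fun s => p * F s)).
  apply: eq_path_exp => s sz; rewrite muleC /F.
  have [|_] := boolP (y :: s \in E n); last by rewrite !mule0.
  rewrite inE => /(_ n (leqnn n)) xn; rewrite !mule1.
  rewrite iter_mesh_kernel//.
  have nthE : last y s = nth x0 (y :: s) (i n) by rewrite -/a -sz nth_last.
  have := unif_comp K'0 K'f (b%:R * mesh_rate l) (delta_ge0 (x n.+1)) (last y s).
  by rewrite nthE xn.
rewrite path_expZ// muleC; congr (_ * _).
rewrite -(@path_exp_take _ _ _ _ _ a (b + c))// => [|]; last exact: mesh_kernel_sum1.
rewrite addnA; apply: eq_path_exp => s; rewrite abcE => sz.
by rewrite /F -En_take.
Qed.

End Lumping.

Lemma grid_law l i v : (i <= 4 ^ l)%N ->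
  unit_lebesgue [set w | nth x0 (grid_var l w) i = v] =
  \esum_(y in [set: S]) (nu y * unif K (i%:R * mesh_rate l) (delta v) y).
Proof.
move=> il; rewrite (grid_var_law l [set s | nth x0 s i = v]).
apply: eq_esum => y _; congr (_ * _).
rewrite -(@iter_mesh_kernel l i (delta v) y (delta_ge0 v)) -path_exp_last.
rewrite -(@path_exp_take _ _ _ (@mesh_kernel_ge0 l) (@mesh_kernel_sum1 l) i (4 ^ l - i) y (fun s => delta v (last y s)) (fun s => delta_ge0 _ _)).
rewrite subnKC//; apply: eq_path_exp => s sz.
rewrite (last_take x0) ?sz//.
by rewrite /delta; congr ((nat_of_bool _)%:R%:E); apply/idP/idP; rewrite inE => /eqP.
Qed.

Lemma grid_double l i w : (i <= 4 ^ l)%N ->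
  nth x0 (grid_var l w) i = nth x0 (grid_var l.+1 w) (2 * i).
Proof.
move=> il.
have [sz _ _] := @grid_var_support (fun _ _ => True) setT l.+1 w (fun _ _ => I) (fun _ _ _ => I).
rewrite -(nth_restrict_path x0 sz il); congr (nth _ _ _); apply/esym.
exact: (limit_var_proj _ _ _ l.+1 w).
Qed.

(* Keeps unification from unfolding grids of different levels to compare them. *)
#[local] Opaque grid_var.

Lemma grid_lift l j i w : (i <= 4 ^ l)%N ->
  nth x0 (grid_var l w) i = nth x0 (grid_var (l + j) w) (i * 2 ^ j).
Proof.
move=> il; elim: j => [|j ih]; first by rewrite addn0 muln1.
rewrite ih addnS grid_double; first by rewrite mulnCA -expnS.
rewrite expnD; apply: leq_mul => //.
by rewrite -[4%N]/(2 * 2)%N expnMn leq_pmulr ?expn_gt0.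
Qed.

(* The value at the dyadic time [k / 2 ^ m]; the grid of level [m + k] has mesh
   [1 / 2 ^ (m + k)] and is long enough to contain that time. *)
Definition dyadic_val m k w : S := nth x0 (grid_var (m + k) w) (k * 2 ^ k).

Lemma leq_exp4 k m : (k * 2 ^ k <= 4 ^ (m + k))%N.
Proof.
rewrite expnD -[(k * _)%N]mul1n; apply: leq_mul; first by rewrite expn_gt0.
rewrite -[4%N]/(2 * 2)%N expnMn leq_mul2r; apply/orP; right.
exact: ltnW (ltn_expl k _).
Qed.

(** Finitely many dyadic times can thus be read on one common grid, where their joint law is
    known. *)
Lemma dyadic_val_grid m k j w : (k <= j)%N ->
  dyadic_val m k w = nth x0 (grid_var (m + j) w) (k * 2 ^ j).
Proof.
move=> kj; rewrite /dyadic_val.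
apply: (etrans (@grid_lift (m + k) (j - k) (k * 2 ^ k) w (leq_exp4 k m))).
by rewrite -addnA subnKC// -mulnA -expnD subnKC.
Qed.

Lemma dyadic_measurable m k v : measurable [set w | dyadic_val m k w = v].
Proof.
exact: (countable_valued_measurable (Y := grid_var (m + k)) (@grid_var_measurable (m + k))
  [set s | nth x0 s (k * 2 ^ k) = v]).
Qed.

Lemma dyadic_law m k v :
  unit_lebesgue [set w | dyadic_val m k w = v] =
  \esum_(y in [set: S]) (nu y * unif K (k%:R * mesh_rate m) (delta v) y).
Proof.
rewrite -(mesh_rate_lift m k k).
exact: (@grid_law (m + k) (k * 2 ^ k) v (leq_exp4 k m)).
Qed.

#[local] Opaque dyadic_val.

Lemma dyadic_double m k w : dyadic_val m.+1 (2 * k) w = dyadic_val m k w.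
Proof.
rewrite (@dyadic_val_grid m k (2 * k).+1)//; last by lia.
rewrite (@dyadic_val_grid m.+1 (2 * k) (2 * k))//.
by rewrite addSnnS expnS mulnCA mulnA.
Qed.

(** One dyadic step consists of many steps of the finer grid on which it is read, whence the
    reflexivity and transitivity of [rho]. *)
Lemma dyadic_support (rho : S -> S -> Prop) (G : set S) m k w :
  (forall x, nu x != 0 -> G x) -> (forall a b, rho a b -> G a -> G b) ->
  (forall a, rho a a) -> (forall a b c, rho a b -> rho b c -> rho a c) ->
  (forall l a b, mesh_kernel l a b != 0 -> rho a b) ->
  rho (dyadic_val m k w) (dyadic_val m k.+1 w) /\ G (dyadic_val m k w).
Proof.
move=> nuG rG rr rt Ur.
rewrite (@dyadic_val_grid m k k.+1)// (@dyadic_val_grid m k.+1 k.+1)//.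
set l := (m + k.+1)%N.
have [_ G0 rS] := @grid_var_support rho G l w nuG (Ur l).
have rle i j : (i + j <= 4 ^ l)%N ->
    rho (nth x0 (grid_var l w) i) (nth x0 (grid_var l w) (i + j)).
  elim: j => [|j ih] ijl; first by rewrite addn0; exact: rr.
  apply: rt (ih _) _; first by apply: leq_trans ijl; rewrite leq_add2l.
  by rewrite addnS; apply: rS; rewrite -addnS.
have kl : (k.+1 * 2 ^ k.+1 <= 4 ^ l)%N by exact: leq_exp4.
split.
  by have := rle (k * 2 ^ k.+1)%N (2 ^ k.+1)%N; rewrite -mulSnr; apply.
apply: rG G0; have := rle 0%N (k * 2 ^ k.+1)%N; rewrite add0n; apply.
by apply: leq_trans kl; rewrite leq_mul2r leqnSn orbT.
Qed.

Lemma dyadic_markov (S' : choiceType) (f : S -> S') (K' : S' -> S' -> \bar R) m n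
    (i : nat -> nat) (x : nat -> S') :
  (forall x y, 0 <= K' x y) ->
  (forall F : S' -> \bar R, (forall y, 0 <= F y) ->
    forall x, act K (F \o f) x = act K' F (f x)) ->
  (forall k, (i k <= i k.+1)%N) ->
  unit_lebesgue [set w | forall k, (k <= n.+1)%N -> f (dyadic_val m (i k) w) = x k] =
  unit_lebesgue [set w | forall k, (k <= n)%N -> f (dyadic_val m (i k) w) = x k] *
    unif K' ((i n.+1 - i n)%:R * mesh_rate m) (delta (x n.+1)) (x n).
Proof.
move=> K'0 K'f iS.
have imono : {homo i : a b / (a <= b)%N} by exact: homo_leq leqnn leq_trans iS.
(* The largest index involved: the grid of level [m + j] contains all the times. *)
pose j := i n.+1.
have iS' k : (i k * 2 ^ j <= i k.+1 * 2 ^ j)%N by rewrite leq_mul2r iS orbT.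
have H := @grid_markov S' f K' K'0 K'f (m + j) n (fun k => i k * 2 ^ j)%N x iS' (leq_exp4 _ _).
rewrite -mulnBl mesh_rate_lift in H.
have setE n' : (n' <= n.+1)%N ->
    [set w | forall k, (k <= n')%N -> f (dyadic_val m (i k) w) = x k] =
    [set w | forall k, (k <= n')%N -> f (nth x0 (grid_var (m + j) w) (i k * 2 ^ j)) = x k].
  move=> n'n; apply/seteqP; split=> w /= Hw k kn; have := Hw k kn;
    by rewrite (@dyadic_val_grid m (i k) j)//; apply: imono; exact: leq_trans kn n'n.
apply: (etrans (congr1 unit_lebesgue (setE n.+1 (leqnn _)))); apply: (etrans H).
apply: (congr1 (fun A => unit_lebesgue A * unif K' ((i n.+1 - i n)%:R * mesh_rate m) (delta (x n.+1)) (x n))).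
exact/esym/setE.
Qed.

End Dyadic.

Lemma exp2_unbounded (R : realType) (y : R) :
  exists m0, forall m, (m0 <= m)%N -> y < 2 ^+ m.
Proof.
exists (Num.truncn `|y|).+1 => m mt; apply: (le_lt_trans (ler_norm y)).
have /andP[_ lt] := truncn_itv (normr_ge0 y).
by apply: (lt_le_trans lt); rewrite -natrX ler_nat (leq_trans mt)// ltnW// ltn_expl.
Qed.

(** * Cadlag extension from dyadic to real times *)

Section Regularization.
Context {R : realType} {S : choiceType} (x0 : S) (V : nat -> nat -> S) (C : S -> nat).

(** The counter alone detects change: once it is squeezed between equal values, the state is pinned
    down. *)
Definition counter_le (a b : S) : Prop := (C a <= C b)%N /\ (C a = C b -> a = b).

Lemma counter_le_trans a b c : counter_le a b -> counter_le b c -> counter_le a c.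
Proof.
move=> [ab eab] [bc ebc]; split=> [|ac]; first exact: leq_trans bc.
have Cab : C a = C b by apply/eqP; rewrite eqn_leq ab ac bc.
by rewrite eab// ebc// -Cab.
Qed.

Lemma counter_le_anti a b : counter_le a b -> (C b <= C a)%N -> a = b.
Proof. by move=> [ab eab] ba; apply: eab; apply/eqP; rewrite eqn_leq ab. Qed.

Hypothesis V_double : forall m k, V m.+1 (2 * k) = V m k.
Hypothesis V_step : forall m k, counter_le (V m k) (V m k.+1).

Let V_lift m j k : V m k = V (m + j) (k * 2 ^ j).
Proof.
elim: j => [|j ih]; first by rewrite addn0 muln1.
by rewrite ih addnS -[LHS]V_double expnS mulnCA.
Qed.

Let V_mono m k k' : (k <= k')%N -> counter_le (V m k) (V m k').
Proof.
move=> /subnKC <-; elim: (k' - k)%N => [|j ih]; first by rewrite addn0.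
by rewrite addnS; apply: counter_le_trans ih (V_step _ _).
Qed.

(** The hypothesis reads [k / 2 ^ m <= k' / 2 ^ m']. *)
Let V_cmp m k m' k' : (k * 2 ^ m' <= k' * 2 ^ m)%N -> counter_le (V m k) (V m' k').
Proof. by move=> kk'; rewrite (V_lift m m') (V_lift m' m) addnC; exact: V_mono. Qed.

(* [dyadic_after m t / 2 ^ m] is the least multiple of [1 / 2 ^ m] above [t]. *)
Definition dyadic_after m (t : R) : nat := (Num.truncn (t * 2 ^+ m)).+1.

Let X2 m : 0 < 2 ^+ m :> R. Proof. exact: exprn_gt0. Qed.

Lemma dyadic_after_itv m t : 0 <= t ->
  t * 2 ^+ m < (dyadic_after m t)%:R <= t * 2 ^+ m + 1.
Proof.
move=> t0; have := truncn_itv (mulr_ge0 t0 (ltW (X2 m))).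
by move=> /andP[l u]; rewrite /dyadic_after u/= -natr1 lerD2r.
Qed.

Lemma dyadic_after_mono m s t : s <= t -> (dyadic_after m s <= dyadic_after m t)%N.
Proof. by move=> st; rewrite ltnS le_truncn// ler_pM2r. Qed.

Let after_le m m' k t : 0 <= t -> t * 2 ^+ m < k%:R -> (m <= m')%N ->
  (dyadic_after m' t * 2 ^ m <= k * 2 ^ m')%N.
Proof.
move=> t0 tk mm'; rewrite -{2}(subnKC mm') expnD mulnCA mulnC leq_mul2l; apply/orP; right.
rewrite truncn_lt_nat; last by rewrite mulr_ge0// ltW.
rewrite -{1}(subnKC mm') exprD mulrA natrM natrX ltr_pM2r//.
Qed.

Let le_after m m' k t : 0 <= t -> k%:R <= t * 2 ^+ m ->
  (k * 2 ^ m' <= dyadic_after m' t * 2 ^ m)%N.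
Proof.
move=> t0 kt; have /andP[tu _] := dyadic_after_itv m' t0.
rewrite -(ler_nat R) !natrM !natrX.
have := X2 m; have := X2 m'; nra.
Qed.

(** The dyadic times after [t] decrease as [m] grows, so the counter reaches its least value and
    stays there, and the state with it. *)
Lemma V_after_stable t : 0 <= t -> exists m0, forall m, (m0 <= m)%N ->
  V m (dyadic_after m t) = V m0 (dyadic_after m0 t).
Proof.
move=> t0; pose D m := V m (dyadic_after m t).
have exc : exists c, `[< exists m, C (D m) = c >] by exists (C (D 0%N)); apply/asboolP; exists 0%N.
case: (ex_minnP exc) => c /asboolP[m0 m0c] cmin; exists m0 => m m0m.
apply: counter_le_anti.
  apply: V_cmp; apply: after_le => //.
  by have /andP[] := dyadic_after_itv m0 t0.
by rewrite -/(D m0) m0c; apply: cmin; apply/asboolP; exists m.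
Qed.

Definition right_limit t : S :=
  xget x0 [set v | exists m0, forall m, (m0 <= m)%N -> V m (dyadic_after m t) = v].

Lemma right_limitP t : 0 <= t -> exists m0, forall m, (m0 <= m)%N ->
  V m (dyadic_after m t) = right_limit t.
Proof.
move=> t0; rewrite /right_limit.
have [m0 H] := V_after_stable t0.
by case: xgetP => [v -> //|/(_ (V m0 (dyadic_after m0 t)))[]]; exists m0.
Qed.

Let right_limit_ge m k t : 0 <= t -> k%:R <= t * 2 ^+ m ->
  counter_le (V m k) (right_limit t).
Proof.
move=> t0 kt; have [m0 H] := right_limitP t0.
by rewrite -(H m0 (leqnn _)); apply: V_cmp; exact: le_after.
Qed.

Let right_limit_le m k t : 0 <= t -> t * 2 ^+ m < k%:R ->
  counter_le (right_limit t) (V m k).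
Proof.
move=> t0 kt; have [m0 H] := right_limitP t0.
by rewrite -(H (maxn m m0) (leq_maxr _ _)); apply: V_cmp; apply: after_le; rewrite ?leq_maxl.
Qed.

Let right_limit_mono s t : 0 <= s -> s <= t ->
  counter_le (right_limit s) (right_limit t).
Proof.
move=> s0 st; have [ms Hs] := right_limitP s0; have [mt Ht] := right_limitP (le_trans s0 st).
rewrite -(Hs (maxn ms mt) (leq_maxl _ _)) -(Ht (maxn ms mt) (leq_maxr _ _)).
by apply: V_cmp; rewrite leq_mul2r dyadic_after_mono ?orbT.
Qed.

(** On the right, the path up to a close enough dyadic time is squeezed between two equal states. On
    the left, the counters at dyadic times before [t] are bounded by the counter at [t]; after a
    time attaining their maximum, nothing changes until [t]. *)
Lemma cadlag_right_limit : cadlag_path right_limit.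
Proof.
split=> t t0.
  have [m H] := right_limitP t0; set k := dyadic_after m t.
  have /andP[tk _] := dyadic_after_itv m t0; rewrite -/k in tk.
  near=> s.
  have ts : t < s by near: s; exact: nbhs_right_gt.
  have sk : s * 2 ^+ m < k%:R.
    by rewrite -ltr_pdivlMr//; near: s; apply: nbhs_right_lt; rewrite ltr_pdivlMr.
  apply/esym; apply: counter_le_anti; first exact: right_limit_mono (ltW ts).
  rewrite -(H m (leqnn _)); have [+ _] := right_limit_le (le_trans t0 (ltW ts)) sk.
  exact.
pose A c := `[< exists m k, k%:R < t * 2 ^+ m /\ C (V m k) = c >].
have exA : exists c, A c.
  exists (C (V 0%N 0%N)); apply/asboolP; exists 0%N, 0%N; split=> //.
  by rewrite expr0 mulr1.
have Aub c : A c -> (c <= C (right_limit t))%N.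
  move=> /asboolP[m [k [kt <-]]].
  by have [] := right_limit_ge (ltW t0) (ltW kt).
case: (ex_maxnP exA Aub) => c /asboolP[m [k [kt kc]]] cmax.
exists (V m k); near=> s.
have st : s < t by near: s; exact: nbhs_left_lt.
have ks : k%:R <= s * 2 ^+ m.
  by rewrite -ler_pdivrMr//; near: s; apply: nbhs_left_ge; rewrite ltr_pdivrMr.
have s0 : 0 <= s.
  by rewrite -(pmulr_lge0 _ (X2 m)); apply: le_trans ks.
apply/esym; apply: counter_le_anti; first exact: right_limit_ge.
rewrite kc; apply: cmax.
have [m1 H1] := right_limitP s0.
(* The mesh is below [t - s], so the dyadic time just after [s] still precedes [t] and counts for
   the maximum. *)
have [m2 m2s] := exp2_unbounded (t - s)^-1.
pose m' := maxn m1 m2.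
have m'E : (t - s)^-1 < 2 ^+ m' by apply: m2s; exact: leq_maxr.
apply/asboolP; exists m', (dyadic_after m' s).
rewrite (H1 m' (leq_maxl _ _)); split=> //.
have /andP[_ h] := dyadic_after_itv m' s0.
apply: (le_lt_trans h); rewrite -ltrBrDl -mulrBl.
by move: m'E; rewrite invf_plt ?posrE ?subr_gt0// -div1r ltr_pdivrMr.
Unshelve. all: by end_near. Qed.

End Regularization.

(** * Limits of events and of transition probabilities *)

Section LimitProbability.
Local Open Scope ereal_scope.
Context (d : measure_display) (Om : measurableType d) (R : realType) (P : probability Om R).

(** [B] is both the lower and the upper limit of the sets [A m]; continuity of the measure from
    below and from above squeezes [P (A m)]. *)
Lemma limit_prob (A : (set Om)^nat) (B : set Om) :
  (forall m, measurable (A m)) ->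
  (forall w, exists m0, forall m, (m0 <= m)%N -> A m w <-> B w) ->
  measurable B /\ P (A m) @[m --> \oo] --> P B.
Proof.
move=> mA AB; pose L m := \bigcap_(j in [set j | (m <= j)%N]) A j.
pose U m := \bigcup_(j in [set j | (m <= j)%N]) A j.
have mL m : measurable (L m) by apply: bigcap_measurable => //; exists m => /=.
have mU m : measurable (U m) by exact: bigcup_measurable.
have LB : \bigcup_m L m = B.
  apply/seteqP; split=> [w [m _ Lw]|w Bw]; have [m0 H] := AB w.
    by rewrite -(H (maxn m m0) (leq_maxr _ _)); apply: Lw => /=; exact: leq_maxl.
  by exists m0 => // j /= m0j; apply/H.
have UB : \bigcap_m U m = B.
  apply/seteqP; split=> [w Uw|w Bw m _]; have [m0 H] := AB w.
    by have [j /= m0j Ajw] := Uw m0 I; apply/(H j m0j).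
  by exists (maxn m m0) => /=; [exact: leq_maxl|apply/H => //; exact: leq_maxr].
have mB : measurable B by rewrite -LB; exact: bigcup_measurable.
split=> //; apply: (@squeeze_cvge _ _ _ _ (P \o L) _ (P \o U)).
- apply: nearW => m /=; apply/andP; split; apply: le_measure; rewrite ?inE//.
  + by move=> w; apply => /=.
  + by move=> w Aw; exists m => /=.
- rewrite -LB; apply: nondecreasing_cvg_mu => //; first by rewrite LB.
  by move=> m m' mm'; apply/subsetPset => w Lw j /= m'j; apply: Lw => /=; exact: leq_trans m'j.
- rewrite -UB; apply: nonincreasing_cvg_mu => //; [|by rewrite UB|].
    by rewrite (le_lt_trans (probability_le1 _ _))// ltry.
  by move=> m m' mm'; apply/subsetPset => w [j /= m'j Aj]; exists j => //=; exact: leq_trans m'j.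
Qed.

End LimitProbability.

Lemma mesh_rate_cvg0 (R : realType) (La : R) : 0 < La ->
  mesh_rate La m @[m --> \oo] --> (0 : R).
Proof.
move=> La0; apply/cvgrPdist_le => e e0.
have [m0 H] := exp2_unbounded (La / e).
exists m0 => // m /= /H; rewrite sub0r normrN ger0_norm; last exact: mesh_rate_ge0.
by rewrite ltr_pdivrMr// => h; rewrite ler_pdivrMr ?exprn_gt0// mulrC ltW.
Qed.

Section UnifContinuity.
Context {R : realType} {S : choiceType} (K : S -> S -> \bar R).
Hypothesis K0 : (forall x y, 0 <= K x y)%E.
Hypothesis K1 : (forall x, \esum_(y in [set: S]) K x y = 1)%E.

(** With [s = a - b], the change is at most the probability of being away from [x] at time [s],
    which is at most [s + 3 * s ^+ 2 <= 4 * s]. *)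
Lemma unif_lipschitz a b y x : 0 <= a -> 0 <= b -> `|a - b| <= 1 ->
  `|fine (unif K a (delta y) x) - fine (unif K b (delta y) x)| <= 4 * `|a - b|.
Proof.
wlog ab : a b / b <= a => [H|] a0 b0.
  case: (leP b a) => [ba|/ltW ab]; first exact: H.
  by rewrite (distrC a b) (distrC (fine _) (fine _)); exact: H.
rewrite ger0_norm ?subr_ge0// => s1; set s := a - b.
have s0 : 0 <= s by rewrite subr_ge0.
have pP : transition_function (fun x y => fine (K x y)) (unif_trans K 1).
  apply: unif_trans_transition_function => // u v _.
  by rewrite mul1e fineK// kernel_fin.
have := tf_continuous pP x y s0 b0; rewrite /unif_trans !mul1r subrK.
move/le_trans; apply.
have /(unif_first_order K0 K1 x x) : 0 <= s <= 1 by rewrite s0.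
rewrite eqxx; have k0 : 0 <= fine (K x x) by rewrite fine_ge0.
have ss : s ^+ 2 <= s by rewrite expr2 ler_piMr.
have sk : 0 <= s * fine (K x x) by rewrite mulr_ge0.
by move=> /ler_normlP[/= + _]; lra.
Qed.

Lemma unif_cvg (a : nat -> R) (b : R) y x : (forall m, 0 <= a m) -> 0 <= b ->
  a m @[m --> \oo] --> b ->
  fine (unif K (a m) (delta y) x) @[m --> \oo] --> fine (unif K b (delta y) x).
Proof.
move=> a0 b0 ab; apply/cvgrPdist_le => e e0.
move/cvgrPdist_le : ab => ab.
have e4 : 0 < e / 4 by rewrite divr_gt0.
have := ab _ e4; have := ab 1 ltr01; apply: filterS2 => m m1 m4.
apply: (le_trans (unif_lipschitz _ _ _ _ _)) => //.
by rewrite mulrC -ler_pdivlMr.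
Qed.

End UnifContinuity.

(** * The continuous-time chain *)

Section Chain.
Local Open Scope ereal_scope.
Context {R : realType} {S : countType} (K : S -> S -> \bar R) (La : R).
Context (nu : S -> \bar R) (x0 : S) (C : S -> nat) (G : set S).
Hypothesis K0 : forall x y, 0 <= K x y.
Hypothesis K1 : forall x, \esum_(y in [set: S]) K x y = 1.
Hypothesis La0 : (0 < La)%R.
Hypothesis nu0 : forall x, 0 <= nu x.
Hypothesis nu1 : \esum_(x in [set: S]) nu x = 1.
Hypothesis KC : forall x y, K x y != 0 -> C y = (C x).+1.
Hypothesis KG : forall x y, K x y != 0 -> G x -> G y.
Hypothesis nuG : forall x, nu x != 0 -> G x.

Let V m k w := dyadic_val x0 K0 K1 La0 nu0 nu1 m k w.

Definition chain_val (t : R) (w : R) : S := right_limit x0 (fun m k => V m k w) t.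

Lemma iter_act_counter n x y : iter n (act K) (delta y) x != 0 ->
  [/\ C y = (C x + n)%N, n = 0%N -> x = y & G x -> G y].
Proof.
elim: n x => [|n ih] x /=.
  by rewrite /delta; case: (eqVneq x y) => [->|]; rewrite ?addn0// eqxx.
move=> /esum_neq0[z]; rewrite mule_eq0 negb_or => /andP[Kxz /ih[Cy _ Gzy]].
by split => [|//|Gx]; [rewrite Cy (KC Kxz) addSnnS|apply: Gzy; exact: KG Kxz Gx].
Qed.

(** A mesh transition is made of [n] kernel steps for some [n], and the counter grows by exactly
    [n]; if it is unchanged then [n = 0] and so is the state. *)
Lemma mesh_kernel_counter l x y : mesh_kernel K La l x y != 0 ->
  counter_le C x y /\ (G x -> G y).
Proof.
move=> /esum_neq0[n]; rewrite mule_eq0 negb_or => /andP[_ /iter_act_counter[Cy n0 xy]].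
split=> //; split=> [|Cxy]; first by rewrite Cy leq_addr.
by apply: n0; apply/eqP; rewrite -(eqn_add2l (C x)) -Cy Cxy addn0.
Qed.

Lemma chain_step m k w : (counter_le C (V m k w) (V m k.+1 w) /\
  (G (V m k w) -> G (V m k.+1 w))) /\ G (V m k w).
Proof.
apply: (dyadic_support x0 K0 K1 La0 nu0 nu1 (rho := fun a b => counter_le C a b /\ (G a -> G b))) => //.
- by move=> a b [_]; apply.
- move=> a b c [ab Gab] [bc Gbc]; split; first exact: counter_le_trans bc.
  by move=> /Gab.
- exact: mesh_kernel_counter.
Qed.

Let V_step w m k : counter_le C (V m k w) (V m k.+1 w).
Proof. by have [[]] := chain_step m k w. Qed.

Let V_double w m k : V m.+1 (2 * k) w = V m k w.
Proof. exact: dyadic_double. Qed.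

Lemma chain_cadlag w : cadlag_path (chain_val ^~ w).
Proof. exact: (cadlag_right_limit x0 (V_double w) (V_step w)). Qed.

Lemma chain_stable t w : (0 <= t)%R -> exists m0, forall m, (m0 <= m)%N ->
  V m (dyadic_after m t) w = chain_val t w.
Proof. exact: (right_limitP x0 (V_double w) (V_step w)). Qed.

Lemma chain_support t w : (0 <= t)%R -> G (chain_val t w).
Proof.
move=> t0; have [m H] := chain_stable w t0; rewrite -(H m (leqnn m)).
by have [] := chain_step m (dyadic_after m t) w.
Qed.

Lemma chain_limit_prob t v : (0 <= t)%R ->
  measurable [set w | chain_val t w = v] /\
  unit_lebesgue [set w | V m (dyadic_after m t) w = v] @[m --> \oo] -->
    unit_lebesgue [set w | chain_val t w = v].
Proof.
move=> t0.
apply: (@limit_prob _ _ _ unit_lebesgue (fun m => [set w | V m (dyadic_after m t) w = v])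
  [set w | chain_val t w = v]).
  by move=> m; exact: dyadic_measurable.
by move=> w; have [m0 H] := chain_stable w t0; exists m0 => m /H /= ->.
Qed.

Lemma chain_measurable t v : (0 <= t)%R -> measurable [set w | chain_val t w = v].
Proof. by move=> t0; have [] := chain_limit_prob v t0. Qed.

(** The value at time 0 is the limit of those at times [1 / 2 ^ m]. Starting at [y] and being there
    at that time has a probability tending to [nu y], which gives a lower bound; total mass 1 makes
    it an equality. *)
Lemma chain_init v : unit_lebesgue [set w | chain_val 0 w = v] = nu v.
Proof.
apply/esym; apply: (@esum_eq_of_le _ _ nu (fun v => unit_lebesgue [set w | chain_val 0 w = v])) => // [y|]; last first.
  rewrite -(countable_valued_prob unit_lebesgue (Y := chain_val 0) _ setT); last first.
    by move=> z; exact: chain_measurable.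
  exact: unit_lebesgue_setT.
have [_ cv] := chain_limit_prob y (lexx 0%R).
have after0 m : dyadic_after m (0 : R) = 1%N by rewrite /dyadic_after mul0r truncn0.
have : nu y * (fine (unif K (mesh_rate La m) (delta y) y))%:E @[m --> \oo] -->
    nu y * (fine (unif K 0 (delta y) y))%:E.
  apply: cvgeZl; first by rewrite ge0_fin_numE// (le_lt_trans _ (ltry 1))// -nu1; apply: esum_ge; exists [set y]; rewrite ?fsbig_set1//; split.
  apply: cvg_EFin; first by apply: nearW.
  apply: unif_cvg => //; first by move=> m; exact: mesh_rate_ge0.
  exact: mesh_rate_cvg0.
rewrite unif0// /delta eqxx mule1 => cn.
apply: (lee_cvg_to cn cv); apply: nearW => m; rewrite after0.
rewrite /V dyadic_law mul1r; apply: esum_ge; exists [set y]; first by split.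
by rewrite fsbig_set1 fineK// unif_delta_fin//; exact: mesh_rate_ge0.
Qed.

(** Both times are rounded up by at most one mesh, so their difference is off by at most one
    mesh. *)
Lemma dyadic_after_diff_cvg s t : (0 <= s)%R -> (s <= t)%R ->
  ((dyadic_after m t - dyadic_after m s)%N%:R * mesh_rate La m)%R @[m --> \oo] -->
    (La * (t - s))%R.
Proof.
move=> s0 st; apply/cvgrPdist_le => e e0.
move/cvgrPdist_le : (mesh_rate_cvg0 La0) => /(_ e e0); apply: filterS => m.
rewrite sub0r normrN ger0_norm; last exact: mesh_rate_ge0.
apply: le_trans; rewrite natrB; last exact: dyadic_after_mono.
have /andP[s1 s2] := dyadic_after_itv m s0.
have /andP[t1 t2] := dyadic_after_itv m (le_trans s0 st).
set a := (dyadic_after m t)%:R%R in t1 t2 *; set b := (dyadic_after m s)%:R%R in s1 s2 *.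
have e2 : (0 < 2 ^+ m :> R)%R by exact: exprn_gt0.
have -> : (La * (t - s) - (a - b) * mesh_rate La m =
    mesh_rate La m * ((t * 2 ^+ m - a) - (s * 2 ^+ m - b)))%R.
  by rewrite /mesh_rate; field; rewrite gt_eqF.
rewrite normrM ger0_norm; last exact: mesh_rate_ge0.
by rewrite ler_piMr ?mesh_rate_ge0// ler_norml; apply/andP; split; lra.
Qed.

(** The product formula holds at the dyadic times just after the [t k]. The events converge because
    paths stabilize, the transition probabilities because they are continuous in time. *)
Lemma chain_markov (S' : choiceType) (f : S -> S') (K' : S' -> S' -> \bar R) n
    (t : nat -> R) (x : nat -> S') :
  (forall x y, 0 <= K' x y) ->
  (forall x, \esum_(y in [set: S']) K' x y = 1) ->
  (forall F : S' -> \bar R, (forall y, 0 <= F y) ->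
    forall x, act K (F \o f) x = act K' F (f x)) ->
  (0 <= t 0%N)%R -> (forall k, t k <= t k.+1)%R ->
  unit_lebesgue [set w | forall k, (k <= n.+1)%N -> f (chain_val (t k) w) = x k] =
  unit_lebesgue [set w | forall k, (k <= n)%N -> f (chain_val (t k) w) = x k] *
    (unif_trans K' La (t n.+1 - t n) (x n) (x n.+1))%:E.
Proof.
move=> K'0 K'1 K'f t0 tS.
have tpos k : (0 <= t k)%R by elim: k => [//|k ih]; exact: le_trans (tS k).
pose E N := [set w | forall k, (k <= N)%N -> f (chain_val (t k) w) = x k].
pose A N m := [set w | forall k, (k <= N)%N -> f (V m (dyadic_after m (t k)) w) = x k].
have mA N m : measurable (A N m).
  have -> : A N m = \bigcap_(k in [set k | (k <= N)%N])
      [set w | (f @^-1` [set x k]) (V m (dyadic_after m (t k)) w)].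
    by apply/seteqP; split.
  apply: bigcap_measurable => [|k _]; first by exists 0%N.
  apply: (countable_valued_measurable (Y := V m (dyadic_after m (t k)))) => v.
  exact: dyadic_measurable.
have stable N w : exists m0, forall m, (m0 <= m)%N -> forall k, (k <= N)%N ->
    V m (dyadic_after m (t k)) w = chain_val (t k) w.
  elim: N => [|N [m1 H1]].
    by have [m0 H] := chain_stable w (tpos 0%N); exists m0 => m /H Hm k; rewrite leqn0 => /eqP ->.
  have [m0 H] := chain_stable w (tpos N.+1); exists (maxn m0 m1) => m.
  rewrite geq_max => /andP[/H m0m /H1 m1m] k.
  by rewrite leq_eqVlt => /predU1P[->//|]; exact: m1m.
have [mE cv] : (forall N, measurable (E N)) /\
    forall N, unit_lebesgue (A N m) @[m --> \oo] --> unit_lebesgue (E N).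
  apply/all_and2 => N.
  apply: (@limit_prob _ _ _ unit_lebesgue (A N) (E N) (mA N)) => w.
  have [m0 H] := stable N w; exists m0 => m mm.
  by split=> Hw k kN; move: (Hw k kN); rewrite (H m mm k kN).
pose a m := ((dyadic_after m (t n.+1) - dyadic_after m (t n))%N%:R * mesh_rate La m)%R.
have AE m : unit_lebesgue (A n.+1 m) = unit_lebesgue (A n m) *
    (fine (unif K' (a m) (delta (x n.+1)) (x n)))%:E.
  rewrite fineK; last by apply: unif_delta_fin => //; rewrite mulr_ge0// mesh_rate_ge0.
  apply: (dyadic_markov x0 K0 K1 La0 nu0 nu1 m n (i := fun k => dyadic_after m (t k))) => // k.
  exact: dyadic_after_mono.
have : unit_lebesgue (A n m) * (fine (unif K' (a m) (delta (x n.+1)) (x n)))%:E @[m --> \oo]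
    --> unit_lebesgue (E n) * (unif_trans K' La (t n.+1 - t n) (x n) (x n.+1))%:E.
  apply: cvgeM; [|exact: cv|].
    by apply: mule_def_fin => //; apply: fin_num_measure; exact: mE.
  apply: cvg_EFin; first by apply: nearW.
  apply: unif_cvg => //; first by move=> m; rewrite mulr_ge0// mesh_rate_ge0.
    by rewrite mulr_ge0 ?(ltW La0)// subr_ge0.
  exact: dyadic_after_diff_cvg.
under eq_fun do rewrite -AE.
exact: (cvg_unique _ (cv n.+1)).
Qed.

End Chain.

(** * Sums over particular index types *)

Section ESumTypes.
Local Open Scope ereal_scope.
Context {R : realType}.

Lemma esum_sum_type (A B : choiceType) (f : A + B -> \bar R) : (forall l, 0 <= f l) ->
  \esum_(l in [set: A + B]) f l =
  \esum_(a in [set: A]) f (inl a) + \esum_(b in [set: B]) f (inr b).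
Proof.
move=> f0; rewrite (esumID (range inl) setT f (fun l _ => f0 l)) !setTI.
rewrite (esum_image [set: A] inl) => [|a a' _ _ []//]; congr (_ + _).
have -> : ~` (range (@inl A B)) = range inr.
  apply/seteqP; split=> [[a|b]|_ [b _ <-] []//] /=; first by case; exists a.
  by exists b.
by rewrite (esum_image [set: B] inr) => [|b b' _ _ []].
Qed.

Lemma esum_bool (f : bool -> \bar R) : (forall l, 0 <= f l) ->
  \esum_(b in [set: bool]) f b = f true + f false.
Proof.
move=> f0; rewrite (esumID [set true] setT f (fun l _ => f0 l)) !setTI esum_set1//.
congr (_ + _); rewrite (_ : ~` [set true] = [set false]) ?esum_set1//.
by apply/seteqP; split=> -[] //= /(_ erefl).
Qed.

Lemma esum_unit (f : unit -> \bar R) : 0 <= f tt -> \esum_(u in [set: unit]) f u = f tt.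
Proof.
move=> f0; rewrite (_ : [set: unit] = [set tt]) ?esum_set1//.
by apply/seteqP; split=> -[].
Qed.

Lemma esum_finType (T : finType) (f : T -> \bar R) : (forall j, 0 <= f j) ->
  \esum_(j in [set: T]) f j = \sum_j f j.
Proof.
move=> f0; rewrite esum_fset//; last exact: finite_finset.
rewrite (fsbigE (index_enum T)) ?index_enum_uniq//=.
  by apply: eq_bigl => j; rewrite in_setT.
by move=> j _; rewrite mem_index_enum.
Qed.

Lemma esum_pair (A B : choiceType) (f : A * B -> \bar R) : (forall p, 0 <= f p) ->
  \esum_(p in [set: A * B]) f p = \esum_(a in [set: A]) \esum_(b in [set: B]) f (a, b).
Proof.
move=> f0; rewrite esum_esum//.
rewrite (_ : _ `*`` _ = [set: A * B]); last by apply/seteqP; split.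
by apply: eq_esum => -[].
Qed.

Lemma esum_nat_fin (f : nat -> \bar R) m : (forall i, 0 <= f i) ->
  (forall i, (m <= i)%N -> f i = 0) ->
  \esum_(i in [set: nat]) f i = \sum_(i < m) f i.
Proof.
elim: m f => [|m ih] f f0 fm.
  by rewrite big_ord0; apply: esum1 => i _; exact: fm.
rewrite esum_nat_recl// ih ?big_ord_recl// => i mi; exact: fm.
Qed.

(** Meant for the two sums in [queue_rates], whose index sets have at most one element. *)
Lemma esum_subsingleton (T : choiceType) (D : set T) (g : T -> R) :
  (forall c, (0 <= g c)%R) -> (forall c c', D c -> D c' -> c = c') ->
  \esum_(c in D) (g c)%:E = (\sum_(c \in D) g c)%R%:E.
Proof.
move=> g0 D1; have [[c Dc]|D0] := pselect (exists c, D c).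
  have -> : D = [set c].
    by apply/seteqP; split=> [c' Dc'|_ ->//]; exact: D1.
  by rewrite esum_set1 ?lee_fin// fsbig_set1.
have -> : D = set0 by apply/seteqP; split=> // c Dc; apply: D0; exists c.
by rewrite esum_set0 fsbig_set0.
Qed.

End ESumTypes.

(** * Kernels given by randomly chosen labelled moves *)

Section MoveKernel.
Local Open Scope ereal_scope.
Context {R : realType} {S L : choiceType} (r : S -> L -> \bar R) (tau : S -> L -> S).
Hypothesis r0 : forall x l, 0 <= r x l.
Hypothesis r1 : forall x, \esum_(l in [set: L]) r x l = 1.

Definition move_kernel (x y : S) : \bar R :=
  \esum_(l in [set: L]) (r x l * delta y (tau x l)).

Lemma move_kernel_ge0 x y : 0 <= move_kernel x y.
Proof. by apply: esum_ge0 => l _; rewrite mule_ge0. Qed.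

(** Summing over labels instead of target states reduces a lumping to a regrouping of labels. *)
Lemma act_move_kernel F x : (forall y, 0 <= F y) ->
  act move_kernel F x = \esum_(l in [set: L]) (r x l * F (tau x l)).
Proof.
move=> F0; transitivity (\esum_(y in [set: S]) \esum_(l in [set: L])
    (r x l * (delta y (tau x l) * F y))).
  apply: eq_esum => y _; rewrite /move_kernel -ge0_esumZr//; last first.
    by move=> l; rewrite mule_ge0.
  by apply: eq_esum => l _; rewrite muleA.
rewrite exchange_esum; last by move=> *; rewrite !mule_ge0.
apply: eq_esum => l _; rewrite ge0_esumZl ?esum_delta// => y.
by rewrite mule_ge0.
Qed.

Lemma move_kernel_sum1 x : \esum_(y in [set: S]) move_kernel x y = 1.
Proof.
transitivity (act move_kernel (fun=> 1) x).
  by rewrite /act; apply: eq_esum => y _ /=; rewrite mule1.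
by rewrite act_move_kernel// -[RHS](r1 x); apply: eq_esum => l _ /=; rewrite mule1.
Qed.

Lemma move_kernel_neq0 x y : move_kernel x y != 0 ->
  exists2 l, r x l != 0 & tau x l = y.
Proof.
move=> /esum_neq0[l]; rewrite mule_eq0 negb_or => /andP[rl dl]; exists l => //.
by apply/eqP; apply: contraTT dl => /negPf ty; rewrite negbK /delta ty.
Qed.

End MoveKernel.

(** * Laws of continuous-time chains *)

Section MarkovLaws.
Local Open Scope ereal_scope.
Context {R : realType}.

Lemma cadlag_comp (S S' : choiceType) (f : S -> S') (g : R -> S) :
  cadlag_path g -> cadlag_path (f \o g).
Proof.
move=> [gr gl]; split=> t t0; first by apply: filterS (gr t t0) => s /= ->.
by have [x gx] := gl t t0; exists (f x); apply: filterS gx => s /= ->.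
Qed.

Lemma chain_ctmc (S : countType) (K : S -> S -> \bar R) (La : R) nu x0 (C : S -> nat)
    (K0 : forall x y, 0 <= K x y) (K1 : forall x, \esum_(y in [set: S]) K x y = 1)
    (La0 : (0 < La)%R) (nu0 : forall x, 0 <= nu x) (nu1 : \esum_(x in [set: S]) nu x = 1)
    (S' : choiceType) (f : S -> S') (K' : S' -> S' -> \bar R) (q : S' -> S' -> R) :
  (forall x y, K x y != 0 -> C y = (C x).+1) ->
  (forall x y, 0 <= K' x y) ->
  (forall x, \esum_(y in [set: S']) K' x y = 1) ->
  (forall F : S' -> \bar R, (forall y, 0 <= F y) ->
    forall x, act K (F \o f) x = act K' F (f x)) ->
  (forall x y, x != y -> (q x y)%:E = La%:E * K' x y) ->
  ctmc unit_lebesgue q (fun t w => f (chain_val x0 K0 K1 La0 nu0 nu1 t w)).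
Proof.
move=> KC K'0 K'1 K'f qK.
have KT x y : K x y != 0 -> setT x -> setT y by [].
have nuT x : nu x != 0 -> setT x by [].
split.
- move=> t x t0.
  have mX v := chain_measurable x0 K0 K1 La0 nu0 nu1 KC KT nuT v t0.
  exact: (countable_valued_measurable mX (f @^-1` [set x])).
- move=> w; apply: (cadlag_comp f).
  exact: (chain_cadlag x0 K0 K1 La0 nu0 nu1 KC KT nuT).
- exists (unif_trans K' La); first exact: unif_trans_transition_function.
  move=> n t x t0 tS.
  exact: (chain_markov x0 K0 K1 La0 nu0 nu1 KC KT nuT).
Qed.

Section Uniqueness.
Context (S : countType) (K : S -> S -> \bar R) (La : R) (q : S -> S -> R).
Hypothesis K0 : forall x y, 0 <= K x y.
Hypothesis K1 : forall x, \esum_(y in [set: S]) K x y = 1.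
Hypothesis La0 : (0 < La)%R.
Hypothesis qK : forall x y, x != y -> (q x y)%:E = La%:E * K x y.

Lemma ctmc_law (d : measure_display) (Om : measurableType d) (P : probability Om R)
    (X : R -> Om -> S) t y : ctmc P q X -> (0 <= t)%R ->
  P [set w | X t w = y] = \esum_(x in [set: S])
    (P [set w | X 0%R w = x] * (unif_trans K La t x y)%:E).
Proof.
move=> [mX _ [p pP pX]] t0.
have mXX v : measurable [set w | (X 0%R w, X t w) = v].
  have -> : [set w | (X 0%R w, X t w) = v] =
      [set w | X 0%R w = v.1] `&` [set w | X t w = v.2].
    by apply/seteqP; split=> w /=; [case: v => ? ? [-> ->]|case: v => ? ? [/= -> ->]].
  by apply: measurableI; exact: mX.
rewrite (countable_valued_prob P mXX [set v | v.2 = y]).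
rewrite esum_mkcond esum_pair; last by move=> v; case: ifP.
apply: eq_esum => x _; rewrite (@esum_single _ _ _ y)//=; last first.
- by move=> z zy; case: ifPn => //; rewrite inE/= => e; move: zy; rewrite e eqxx.
- by case: ifP.
rewrite ifT ?inE//.
(* The Markov property is stated for infinite sequences of times; after index 1 the time stays at
   [t]. *)
pose tt (k : nat) : R := if k is 0%N then 0%R else t.
pose xx (k : nat) := if k is 0%N then x else y.
have := pX 0%N tt xx (lexx _); rewrite subr0 -(tf_unique K0 K1 La0 qK pP)//.
have ttS k : (tt k <= tt k.+1)%R by case: k => [|k] /=.
move=> /(_ ttS) H; apply: etrans (etrans H _).
  congr (P _); apply/seteqP; split=> w /=.
    by move=> [e0 e1] [|[|k]].
  by move=> Hw; rewrite (Hw 0%N)// (Hw 1%N).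
congr (P _ * _); apply/seteqP; split=> w /=; first by move=> /(_ 0%N (leqnn _)).
by move=> e0 [|k].
Qed.

Lemma ctmc_law_unique (d1 d2 : measure_display) (Om1 : measurableType d1)
    (Om2 : measurableType d2) (P1 : probability Om1 R) (P2 : probability Om2 R)
    (X1 : R -> Om1 -> S) (X2 : R -> Om2 -> S) t (A : set S) :
  ctmc P1 q X1 -> ctmc P2 q X2 ->
  (forall x, P1 [set w | X1 0%R w = x] = P2 [set w | X2 0%R w = x]) -> (0 <= t)%R ->
  P1 [set w | A (X1 t w)] = P2 [set w | A (X2 t w)].
Proof.
move=> cX1 cX2 X12 t0.
rewrite (countable_valued_prob P1 (Y := X1 t)); last by case: cX1 => mX _ _ x; exact: mX.
rewrite (countable_valued_prob P2 (Y := X2 t)); last by case: cX2 => mX _ _ x; exact: mX.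
apply: eq_esum => y _; rewrite (ctmc_law y cX1 t0) (ctmc_law y cX2 t0).
by apply: eq_esum => x _; rewrite X12.
Qed.

End Uniqueness.
End MarkovLaws.

(** * States of the separate queues *)

Section QueueStates.
Context {M : nat} {n : 'I_M -> nat}.
Implicit Types (x y : state n) (c : nat * 'I_M).

Lemma state_ext x y : (forall i j, x i j = y i j) -> x = y.
Proof.
case: x y => [x x0 xS xF] [y y0 yS yF] /= xy.
have e : x = y by apply/funext => i; apply/funext => j.
by subst y; congr State; exact: Prop_irrelevance.
Qed.

Definition height x : nat := projT1 (cid (occ_fin x)).

Lemma heightP x i j : (height x <= i)%N -> x i j = 0%N.
Proof. by rewrite /height; case: cid => K /= HK; exact: HK. Qed.

(** The rows below the height determine the state, so finite lists encode it and there are only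
    countably many states. *)
Definition state_code x : seq (seq nat) :=
  mkseq (fun i => [seq x i j | j <- enum 'I_M]) (height x).

Lemma state_code_inj : injective state_code.
Proof.
move=> x y xy; have hxy : height x = height y.
  by have := congr1 size xy; rewrite !size_mkseq.
apply: state_ext => i j; have [hi|hi] := leqP (height x) i.
  by rewrite !heightP -?hxy.
have := congr1 (fun s => nth [::] s i) xy; rewrite !nth_mkseq -?hxy//.
by move=> /eq_in_map; apply; rewrite mem_enum.
Qed.

Definition state_decode (s : seq (seq nat)) : option (state n) :=
  if pselect (exists x, state_code x = s) is left e then Some (projT1 (cid e)) else None.

Lemma state_codeK : pcancel state_code state_decode.
Proof.
move=> x; rewrite /state_decode; case: pselect => [e|]; last by case; exists x.
by case: cid => y /= /state_code_inj ->.
Qed.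

HB.instance Definition _ := PCanIsCountable state_codeK.

(** An impossible move leaves the state fixed; its weight is 0 by [arrival_weight_neq0], and
    likewise for departures. *)
Definition add_at c x : state n :=
  if pselect (exists y, incr_at c x y) is left e then projT1 (cid e) else x.

Definition sub_at c x : state n :=
  if pselect (exists y, incr_at c y x) is left e then projT1 (cid e) else x.

Lemma incr_at_uniqr c x y y' : incr_at c x y -> incr_at c x y' -> y = y'.
Proof. by move=> h h'; apply: state_ext => i j; rewrite h h'. Qed.

Lemma incr_at_uniql c x x' y : incr_at c x y -> incr_at c x' y -> x = x'.
Proof.
move=> h h'; apply: state_ext => i j; apply/eqP.
by rewrite -(eqn_add2r ((i, j) == c)) -h -h'.
Qed.

Lemma incr_at_coord c c' x y : incr_at c x y -> incr_at c' x y -> c = c'.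
Proof.
case: c => i j h h'; have := h i j; rewrite h' eqxx => /eqP.
by rewrite eqn_add2l; case: ((i, j) =P c').
Qed.

Lemma add_at_eq c x y : x != y -> (add_at c x = y) <-> incr_at c x y.
Proof.
move=> xy; rewrite /add_at; case: pselect => [e|ne].
  case: cid => z /= xz; split=> [<-//|]; exact: incr_at_uniqr xz.
by split=> [e|xy']; [move: xy; rewrite e eqxx|case: ne; exists y].
Qed.

Lemma sub_at_eq c x y : x != y -> (sub_at c x = y) <-> incr_at c y x.
Proof.
move=> xy; rewrite /sub_at; case: pselect => [e|ne].
  case: cid => z /= zx; split=> [<-//|]; exact: incr_at_uniql zx.
by split=> [e|xy']; [move: xy; rewrite e eqxx|case: ne; exists y].
Qed.

(** The strict inequality provides a server with exactly [c.1 - 1] jobs, so the columns remain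
    nonincreasing. *)
Lemma incr_at_add c x : (0 < c.1)%N -> (x c.1 c.2 < x c.1.-1 c.2)%N ->
  incr_at c x (add_at c x).
Proof.
case: c => -[//|i] j _ /= lt.
rewrite /add_at; case: pselect => [e|]; first by case: cid.
case; pose f i' j' := (x i' j' + ((i', j') == (i.+1, j)))%N.
have f0 j' : f 0%N j' = n j' by rewrite /f occ0 xpair_eqE addn0.
have fS i' j' : (f i'.+1 j' <= f i' j')%N.
  rewrite /f !xpair_eqE eqSS; have := occ_noninc x i' j'.
  have [->|_] := eqVneq i' i; last by rewrite /= addn0 => h; exact: leq_trans h (leq_addr _ _).
  have [->|_] := eqVneq j' j; last by rewrite !andbF !addn0.
  by move=> _; rewrite /= addn1; exact: leq_trans lt (leq_addr _ _).
have fF : exists K, forall i' j', (K <= i')%N -> f i' j' = 0%N.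
  exists (maxn (height x) i.+2) => i' j'; rewrite geq_max => /andP[hi' ii'].
  by rewrite /f heightP// xpair_eqE gtn_eqF.
by exists (State f0 fS fF).
Qed.

Lemma incr_at_sub c x : (0 < c.1)%N -> (x c.1.+1 c.2 < x c.1 c.2)%N ->
  incr_at c (sub_at c x) x.
Proof.
case: c => i j /= i0 lt.
rewrite /sub_at; case: pselect => [e|]; first by case: cid.
case; pose f i' j' := (x i' j' - ((i', j') == (i, j)))%N.
have f0 j' : f 0%N j' = n j' by rewrite /f occ0 xpair_eqE ltn_eqF// subn0.
have fS i' j' : (f i'.+1 j' <= f i' j')%N.
  rewrite /f !xpair_eqE; have := occ_noninc x i' j'.
  have [ii|ii] := eqVneq i' i; last by move=> h; rewrite /= subn0; exact: leq_trans (leq_subr _ _) h.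
  have [jj|_] := eqVneq j' j; last by rewrite !andbF !subn0.
  by rewrite ii jj in lt *; rewrite gtn_eqF// subn0 subn1 => _; lia.
have fF : exists K, forall i' j', (K <= i')%N -> f i' j' = 0%N.
  by exists (height x) => i' j' hi'; rewrite /f heightP.
exists (State f0 fS fF) => i' j' /=; rewrite /f.
case: eqP => [[-> ->]|_]; last by rewrite subn0 addn0.
by rewrite subnK//; exact: leq_ltn_trans lt.
Qed.

Lemma total_jobsE x K : (forall i j, (K <= i)%N -> x i j = 0%N) ->
  total_jobs x = (\sum_(i < K) \sum_(j < M) x i.+1 j)%N.
Proof.
move=> xK; pose r := [seq (p.1.+1, p.2) | p <- [seq (i, j) | i <- iota 0 K, j <- enum 'I_M]].
have ur : uniq r.
  rewrite map_inj_uniq => [|[i j] [i' j'] /= [-> ->]//].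
  by apply: allpairs_uniq; rewrite ?iota_uniq ?enum_uniq// => -[? ?] [? ?] _ _ /= [-> ->].
rewrite /total_jobs (fsbigE r)//.
- rewrite big_map/= [LHS](_ : _ = (\sum_(p <- [seq (i, j) | i <- iota 0 K, j <- enum 'I_M]) x p.1.+1 p.2)%N); last first.
    by apply: eq_bigl => p; rewrite mem_set.
  rewrite big_allpairs_dep/= -(big_mkord xpredT (fun i => \sum_(j < M) x i.+1 j)%N).
  by rewrite /index_iota subn0; apply: eq_bigr => i _; rewrite big_enum.
- by move=> c /mapP[[i j] _ ->].
- move=> [[//|i] j] _ cr; apply: xK; rewrite leqNgt; apply: contra cr => iK.
  apply/mapP; exists (i, j) => //; apply/allpairsP; exists (i, j) => /=.
  by rewrite mem_iota mem_enum/= add0n; split=> //; exact: ltnW.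
Qed.

Lemma total_jobs_incr c x y : (0 < c.1)%N -> incr_at c x y ->
  total_jobs y = (total_jobs x).+1.
Proof.
case: c => -[//|i0] j0 _ xy; pose K := maxn (maxn (height x) (height y)) i0.+1.
rewrite (@total_jobsE x K); last first.
  by move=> i j; rewrite !geq_max => /andP[/andP[+ _] _]; exact: heightP.
rewrite (@total_jobsE y K); last first.
  by move=> i j; rewrite !geq_max => /andP[/andP[_ +] _]; exact: heightP.
under eq_bigr do under eq_bigr do rewrite xy.
under eq_bigr do rewrite big_split.
rewrite big_split/= -[RHS]addn1; congr (_ + _)%N.
have i0K : (i0 < K)%N by rewrite leq_max leqnn orbT.
rewrite (bigD1 (Ordinal i0K))//= (bigD1 j0)//= eqxx big1 => [|j /negPf jj]; last first.
  by rewrite xpair_eqE jj andbF.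
rewrite big1 // => i ii; rewrite big1// => j _; rewrite xpair_eqE eqSS.
by case: eqP => // e; move: ii; rewrite -val_eqE /= e eqxx.
Qed.

(** The first row counts the busy servers, each of which holds a job. *)
Lemma first_row_le x : (\sum_(j < M) x 1%N j <= total_jobs x)%N.
Proof.
rewrite (@total_jobsE x (height x).+1) => [|i j /ltnW]; last exact: heightP.
by rewrite big_ord_recl leq_addr.
Qed.

Section Weights.
Context {R : realType} (mu : 'I_M -> R) (a : state n -> nat -> 'I_M -> R).
Hypothesis mu0 : forall j, 0 < mu j.
Hypothesis ha : stationary_policy a.

(** Extended by 0 to row 0, so that sums run over all pairs of indices. *)
Definition arrival_weight x c : R := if (0 < c.1)%N then a x c.1 c.2 else 0.

Definition departure_weight x c : R :=
  if (0 < c.1)%N then mu c.2 * ((x c.1 c.2)%:R - (x c.1.+1 c.2)%:R) else 0.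

Definition departure_rate x : R := \sum_(j < M) mu j * (x 1%N j)%:R.

Lemma arrival_weight_ge0 x c : 0 <= arrival_weight x c.
Proof. by rewrite /arrival_weight; case: ifP => // c0; exact: policy_ge0. Qed.

Lemma departure_weight_ge0 x c : 0 <= departure_weight x c.
Proof.
rewrite /departure_weight; case: ifP => // c0; rewrite mulr_ge0 ?(ltW (mu0 _))//.
by rewrite subr_ge0 ler_nat occ_noninc.
Qed.

Lemma arrival_weight_neq0 x c : arrival_weight x c != 0 ->
  (0 < c.1)%N /\ incr_at c x (add_at c x).
Proof.
rewrite /arrival_weight; case: ifP => [c0 ac|]; last by rewrite eqxx.
split=> //; apply: incr_at_add => //; rewrite ltn_neqAle; apply/andP; split.
  by apply/negP => /eqP e; move: ac; rewrite (policy_supp ha)// eqxx.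
by have := occ_noninc x c.1.-1 c.2; rewrite prednK.
Qed.

Lemma departure_weight_neq0 x c : departure_weight x c != 0 ->
  (0 < c.1)%N /\ incr_at c (sub_at c x) x.
Proof.
rewrite /departure_weight; case: ifP => [c0 dc|]; last by rewrite eqxx.
split=> //; apply: incr_at_sub => //; rewrite ltn_neqAle occ_noninc andbT.
by apply/negP => /eqP e; move: dc; rewrite e subrr mulr0 eqxx.
Qed.

Lemma esum_arrival_weight x :
  (\esum_(c in [set: nat * 'I_M]) (arrival_weight x c)%:E = 1)%E.
Proof.
rewrite -(policy_sum1 ha x) [RHS]esum_mkcond; apply: eq_esum => c _.
rewrite /arrival_weight (_ : (c \in coords) = (0 < c.1)%N); first by case: ifP.
by apply/idP/idP; rewrite inE.
Qed.

(** For each type the sum over rows telescopes to the number of busy servers. *)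
Lemma esum_departure_weight x :
  (\esum_(c in [set: nat * 'I_M]) (departure_weight x c)%:E = (departure_rate x)%:E)%E.
Proof.
have d0 c : (0 <= (departure_weight x c)%:E)%E by rewrite lee_fin departure_weight_ge0.
rewrite esum_pair; last exact: d0.
rewrite exchange_esum; last by move=> i j; exact: d0.
rewrite esum_finType; last by move=> j; apply: esum_ge0 => i _; exact: d0.
rewrite /departure_rate -sumEFin; apply: eq_bigr => j _.
rewrite (esum_nat_fin (m := (height x).+1))//; last first.
  move=> [//|i] /ltnW hi; rewrite /departure_weight/= !heightP ?subrr ?mulr0//.
  exact: leq_trans hi (leqnSn _).
have tele m : \sum_(i < m) ((x i.+1 j)%:R - (x i.+2 j)%:R) = (x 1%N j)%:R - (x m.+1 j)%:R :> R.
  elim: m => [|m ih]; first by rewrite big_ord0 subrr.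
  by rewrite big_ord_recr/= ih addrA subrK.
rewrite sumEFin big_ord_recl/= /departure_weight/= add0r -mulr_sumr tele.
by rewrite [x (height x).+1 j]heightP ?subr0.
Qed.

Lemma departure_rate_ge0 x : 0 <= departure_rate x.
Proof. by apply: sumr_ge0 => j _; rewrite mulr_ge0// ltW. Qed.

End Weights.

End QueueStates.

(** * Optimality of serving on the fastest servers *)

Section Greedy.
Context {R : realType} {M : nat} (mu gamma : 'I_M -> R) (N : nat).
Hypothesis mu0 : forall j, 0 < mu j.
Hypothesis mu_dec : forall i j : 'I_M, (i < j)%N -> mu j < mu i.
Hypothesis gamma0 : forall j, 0 <= gamma j.
Hypothesis gamma1 : \sum_(j < M) gamma j = 1.

Definition servers_before (m : nat) : R := \sum_(i < M | (i < m)%N) N%:R * gamma i.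

(* The number of busy type [j] servers in the pooled system with [k] jobs. *)
Definition pooled_busy (k : nat) (j : 'I_M) : R :=
  Num.min (Num.max (k%:R - servers_before j) 0) (N%:R * gamma j).

Let g0 j : 0 <= N%:R * gamma j. Proof. by rewrite mulr_ge0. Qed.

Lemma servers_beforeS (j : 'I_M) :
  servers_before j.+1 = servers_before j + N%:R * gamma j.
Proof.
rewrite /servers_before (bigD1 j)//= addrC; congr (_ + _); apply: eq_bigl => i.
by rewrite ltnS leq_eqVlt andb_orl -val_eqE/=; case: ltngtP.
Qed.

Lemma servers_before_mono m m' : (m <= m')%N -> servers_before m <= servers_before m'.
Proof.
move=> mm; rewrite /servers_before big_mkcond [leRHS]big_mkcond/=.
apply: ler_sum => i _; case: ifPn => im; first by rewrite (leq_trans im mm).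
by case: ifP.
Qed.

(** Written as increments of [Num.min k%:R] along the cumulative capacities, the busy counts
    telescope when summed over the types. *)
Lemma pooled_busyE k j :
  pooled_busy k j = Num.min k%:R (servers_before j.+1) - Num.min k%:R (servers_before j).
Proof.
rewrite servers_beforeS /pooled_busy; have := g0 j.
move: (servers_before j) (N%:R * gamma j) (k%:R) => s g K gg.
case: (leP (K - s) 0) => ?; case: (leP _ g) => ?; case: (leP K s) => ?;
  by case: (leP K (s + g)) => ?; lra.
Qed.

Lemma sum_pooled_busy k : \sum_(j < M) pooled_busy k j = Num.min k%:R N%:R.
Proof.
under eq_bigr do rewrite pooled_busyE.
rewrite -(big_mkord xpredT (fun j => Num.min k%:R (servers_before j.+1) -
  Num.min k%:R (servers_before j))) telescope_sumr//.
rewrite /servers_before [X in Num.min _ X - _](eq_bigl xpredT) => [|i]; last by rewrite ltn_ord.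
rewrite -mulr_sumr gamma1 mulr1 [X in _ - Num.min _ X]big_pred0 => [|i]; last by rewrite ltn0.
by rewrite [X in _ - X]min_r ?subr0.
Qed.

Lemma pooled_busy_le k j : pooled_busy k j <= N%:R * gamma j.
Proof. by rewrite ge_min lexx orbT. Qed.

Lemma pooled_busy_ge0 k j : 0 <= pooled_busy k j.
Proof. by rewrite le_min g0 le_max lexx orbT. Qed.

(* With [m] the service rate of the first type that is not fully busy, every term
   of [\sum_j (mu j - m) * (pooled_busy k j - x j)] is nonnegative. *)
Lemma pooled_busy_optimal k (x : 'I_M -> R) :
  (forall j, 0 <= x j <= N%:R * gamma j) -> \sum_(j < M) x j <= k%:R ->
  \sum_(j < M) mu j * x j <= \sum_(j < M) mu j * pooled_busy k j.
Proof.
move=> x01 xk.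
have [m m0 Hm] : exists2 m, 0 <= m & forall j,
    m * (pooled_busy k j - x j) <= mu j * (pooled_busy k j - x j).
  have [j0 j0P|full] := pickP (fun j => pooled_busy k j < N%:R * gamma j); last first.
    (* If every type is fully busy, the value 0 serves. *)
    exists 0 => // j; rewrite mul0r mulr_ge0 ?(ltW (mu0 j))// subr_ge0.
    have /negbT := full j; rewrite -leNgt => /(le_trans _); apply.
    by case/andP: (x01 j).
  case: (@arg_minnP _ j0 (fun j => pooled_busy k j < N%:R * gamma j)
    (fun j : 'I_M => j : nat) j0P) => js jsP jmin.
  exists (mu js); first exact: ltW.
  move=> j; case: (ltngtP j js) => [jjs|jjs|/val_inj ->//].
  - apply: ler_wpM2r; last by apply: ltW; apply: mu_dec.
    rewrite subr_ge0; apply: (@le_trans _ _ (N%:R * gamma j)); first by case/andP: (x01 j).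
    by rewrite leNgt; apply/negP => /jmin; rewrite leqNgt jjs.
  - have -> : pooled_busy k j = 0.
      apply/eqP; rewrite eq_le pooled_busy_ge0 andbT ge_min ge_max lexx andbT subr_le0.
      apply/orP; left; apply: le_trans (servers_before_mono jjs).
      rewrite servers_beforeS; move: jsP; rewrite /pooled_busy.
      by case: (leP _ 0) => ?; case: (leP _ (N%:R * gamma js)) => ?; lra.
    rewrite sub0r !mulrN lerN2; apply: ler_wpM2r; first by case/andP: (x01 j).
    exact/ltW/mu_dec.
rewrite -subr_ge0 -sumrB; under eq_bigr do rewrite -mulrBr.
apply: (@le_trans _ _ (\sum_(j < M) m * (pooled_busy k j - x j))); last exact: ler_sum.
rewrite -mulr_sumr mulr_ge0// sumrB subr_ge0 sum_pooled_busy le_min xk/=.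
have -> : N%:R = \sum_(j < M) N%:R * gamma j by rewrite -mulr_sumr gamma1 mulr1.
by apply: ler_sum => j _; case/andP: (x01 j).
Qed.

End Greedy.

(** * The coupled kernel and its two marginals *)

Section Coupling.
Context {R : realType} {M : nat} (mu gamma : 'I_M -> R) (lambda : R) (N : nat)
  (n : 'I_M -> nat).
Hypothesis mu0 : forall j, 0 < mu j.
Hypothesis mu_dec : forall i j : 'I_M, (i < j)%N -> mu j < mu i.
Hypothesis gamma0 : forall j, 0 <= gamma j.
Hypothesis gamma1 : \sum_(j < M) gamma j = 1.
Hypothesis gamma_mu : \sum_(j < M) gamma j * mu j = 1.
Hypothesis lambda0 : 0 < lambda.
Hypothesis N0 : (0 < N)%N.
Hypothesis nE : forall j, (n j)%:R = N%:R * gamma j.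
Context (a : state n -> nat -> 'I_M -> R).
Hypothesis ha : stationary_policy a.
Implicit Types (x y : state n) (k : nat).

Local Notation DX := (departure_rate mu).
Local Notation DZ := (jffs_departure N mu gamma).

(* Arrivals, departures from the separate queues, and departures from the pooled
   system each occur at rate at most [N * lambda], [N] and [N] respectively. *)
Definition uniform_rate : R := N%:R * lambda + 2 * N%:R.
Local Notation La := uniform_rate.

Lemma uniform_rate_gt0 : 0 < La.
Proof. by rewrite /La addr_gt0 ?mulr_gt0 ?ltr0n. Qed.

Let LaN0 : La != 0. Proof. by rewrite gt_eqF ?uniform_rate_gt0. Qed.

Lemma first_row_bounds x j : 0 <= ((x 1%N j)%:R : R) <= N%:R * gamma j.
Proof. by rewrite ler0n -nE ler_nat -(occ0 x j) occ_noninc. Qed.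

Lemma sum_mu_servers : \sum_(j < M) mu j * (N%:R * gamma j) = N%:R.
Proof.
under eq_bigr do rewrite mulrCA [mu _ * _]mulrC.
by rewrite -mulr_sumr gamma_mu mulr1.
Qed.

Lemma departure_rate_le x : DX x <= N%:R.
Proof.
rewrite -sum_mu_servers; apply: ler_sum => j _; rewrite ler_pM2l//.
by case/andP: (first_row_bounds x j).
Qed.

Lemma jffs_departureE k : DZ k = \sum_(j < M) mu j * pooled_busy gamma N k j.
Proof. by []. Qed.

Lemma jffs_departure_le k : DZ k <= N%:R.
Proof.
rewrite -sum_mu_servers jffs_departureE; apply: ler_sum => j _; rewrite ler_pM2l//.
exact: pooled_busy_le.
Qed.

Lemma jffs_departure_ge0 k : 0 <= DZ k.
Proof.
rewrite jffs_departureE; apply: sumr_ge0 => j _.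
by rewrite mulr_ge0 ?(ltW (mu0 j))// pooled_busy_ge0.
Qed.

(** The busy servers of the separate queues form one admissible allocation of at most [total_jobs x]
    jobs; the pooled allocation is optimal. *)
Lemma departure_rate_le_jffs x : DX x <= DZ (total_jobs x).
Proof.
rewrite jffs_departureE; apply: pooled_busy_optimal => //.
  exact: first_row_bounds.
by rewrite -natr_sum ler_nat first_row_le.
Qed.

Definition label : choiceType := ((nat * 'I_M + nat * 'I_M) + bool)%type.

(** The label [inr true], a departure from the pooled system alone, has weight 0 here; it is present
    so that this kernel and the coupled one share their labels. The label [inr false] is the trivial
    step. *)
Definition queue_weight x (l : label) : R :=
  match l with
  | inl (inl c) => N%:R * lambda / La * arrival_weight a x c
  | inl (inr c) => La^-1 * departure_weight mu x c
  | inr true => 0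
  | inr false => 1 - N%:R * lambda / La - DX x / La
  end.

Definition queue_move x (l : label) : state n :=
  match l with
  | inl (inl c) => add_at c x
  | inl (inr c) => sub_at c x
  | inr _ => x
  end.

Definition jffs_weight k (l : bool + unit) : R :=
  match l with
  | inl true => N%:R * lambda / La
  | inl false => DZ k / La
  | inr _ => 1 - N%:R * lambda / La - DZ k / La
  end.

Definition jffs_move k (l : bool + unit) : nat :=
  match l with
  | inl true => k.+1
  | inl false => k.-1
  | inr _ => k
  end.

(* When the two systems hold equally many jobs, every departure from the separate
   queues is matched with a departure from the pooled system; [true] then labels
   the additional departures of the pooled system. The first coordinate counts the
   moves made so far. *)
Definition pair_state : Type := (nat * (nat * state n))%type.

Definition pair_weight (v : pair_state) (l : label) : R :=
  let k := v.2.1 in let x := v.2.2 in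
  let d := DZ k - (if k == total_jobs x then DX x else 0) in
  match l with
  | inr true => d / La
  | inr false => 1 - N%:R * lambda / La - DX x / La - d / La
  | _ => queue_weight x l
  end.

Definition pair_move (v : pair_state) (l : label) : pair_state :=
  let k := v.2.1 in let x := v.2.2 in
  (v.1.+1, match l with
  | inl (inl c) => (k.+1, add_at c x)
  | inl (inr c) => (if k == total_jobs x then k.-1 else k, sub_at c x)
  | inr true => (k.-1, x)
  | inr false => (k, x)
  end).

Let divLa u w : u + w <= La -> 0 <= 1 - u / La - w / La.
Proof.
move=> uw; rewrite -addrA -opprD -mulrDl subr_ge0 ler_pdivrMr ?mul1r//.
exact: uniform_rate_gt0.
Qed.

Let NL0 : 0 <= N%:R * lambda / La.
Proof. by rewrite divr_ge0 ?mulr_ge0 ?(ltW lambda0)// ltW// uniform_rate_gt0. Qed.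

Lemma queue_weight_ge0 x l : 0 <= queue_weight x l.
Proof.
have La0 := uniform_rate_gt0.
case: l => [[c|c]|[]] //=.
- by rewrite mulr_ge0// arrival_weight_ge0.
- by apply: mulr_ge0; [rewrite invr_ge0 ltW|exact: departure_weight_ge0].
- apply: divLa; rewrite /La lerD2l; have := departure_rate_le x.
  have : 0 <= N%:R :> R by []. lra.
Qed.

Lemma jffs_weight_ge0 k l : 0 <= jffs_weight k l.
Proof.
have La0 := uniform_rate_gt0.
case: l => [[]|] //=; first by rewrite divr_ge0 ?jffs_departure_ge0 ?ltW.
move=> _; apply: divLa; rewrite /La lerD2l; have := jffs_departure_le k.
have : 0 <= N%:R :> R by []. lra.
Qed.

Lemma pair_weight_ge0 v l : 0 <= pair_weight v l.
Proof.
have La0 := uniform_rate_gt0.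
case: v => c [k x]; case: l => [[d|d]|[]] /=.
- exact: (queue_weight_ge0 x (inl (inl d))).
- exact: (queue_weight_ge0 x (inl (inr d))).
- apply: divr_ge0; last exact: ltW.
  case: eqP => [->|_]; first by rewrite subr_ge0 departure_rate_le_jffs.
  by rewrite subr0 jffs_departure_ge0.
have := jffs_departure_le k; have := departure_rate_le x.
have := departure_rate_ge0 mu0 x => *.
(* The two departure rates add up to [DZ k] when the totals agree and to [DX x + DZ k] otherwise,
   hence to at most [2 N]. *)
rewrite -[_ - _ - DX x / La]addrA -opprD -mulrDl; apply: divLa.
by rewrite /La; case: ifP => _; lra.
Qed.

Local Open Scope ereal_scope.

Lemma esum_label (f : label -> \bar R) : (forall l, 0 <= f l) ->
  \esum_(l in [set: label]) f l =
  \esum_(c in [set: nat * 'I_M]) f (inl (inl c)) +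
  \esum_(c in [set: nat * 'I_M]) f (inl (inr c)) + (f (inr true) + f (inr false)).
Proof. by move=> f0; rewrite esum_sum_type// esum_sum_type// esum_bool. Qed.

Lemma esum_queue_arrivals x :
  \esum_(c in [set: nat * 'I_M]) (queue_weight x (inl (inl c)))%:E =
  (N%:R * lambda / La)%:E.
Proof.
under eq_esum do rewrite /= EFinM.
rewrite ge0_esumZl ?lee_fin// => [|c]; last by rewrite lee_fin arrival_weight_ge0.
by rewrite esum_arrival_weight// mule1.
Qed.

Lemma esum_queue_departures x :
  \esum_(c in [set: nat * 'I_M]) (queue_weight x (inl (inr c)))%:E = (DX x / La)%:E.
Proof.
have La0 := uniform_rate_gt0.
under eq_esum do rewrite /= EFinM.
rewrite ge0_esumZl ?lee_fin ?invr_ge0 ?(ltW La0)// => [|c]; last first.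
  by rewrite lee_fin departure_weight_ge0.
by rewrite esum_departure_weight// -EFinM mulrC.
Qed.

Lemma queue_weight_sum1 x : \esum_(l in [set: label]) (queue_weight x l)%:E = 1.
Proof.
rewrite esum_label => [|l]; last by rewrite lee_fin queue_weight_ge0.
rewrite esum_queue_arrivals esum_queue_departures -!EFinD; congr EFin => /=.
by rewrite add0r; ring.
Qed.

Lemma pair_weight_sum1 v : \esum_(l in [set: label]) (pair_weight v l)%:E = 1.
Proof.
rewrite esum_label => [|l]; last by rewrite lee_fin pair_weight_ge0.
rewrite (esum_queue_arrivals v.2.2) (esum_queue_departures v.2.2) -!EFinD.
by congr EFin => /=; ring.
Qed.

Lemma jffs_weight_sum1 k : \esum_(l in [set: bool + unit]) (jffs_weight k l)%:E = 1.
Proof.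
have w0 l : 0 <= (jffs_weight k l)%:E by rewrite lee_fin jffs_weight_ge0.
rewrite esum_sum_type// esum_bool// esum_unit// -!EFinD; congr EFin => /=; ring.
Qed.

Definition queue_kernel := move_kernel (fun x l => (queue_weight x l)%:E) queue_move.
Definition jffs_kernel := move_kernel (fun k l => (jffs_weight k l)%:E) jffs_move.
Definition pair_kernel := move_kernel (fun v l => (pair_weight v l)%:E) pair_move.

Lemma queue_kernel_ge0 x y : 0 <= queue_kernel x y.
Proof. by apply: move_kernel_ge0 => *; rewrite lee_fin queue_weight_ge0. Qed.

Lemma queue_kernel_sum1 x : \esum_(y in [set: state n]) queue_kernel x y = 1.
Proof.
apply: move_kernel_sum1 => [*|z]; last exact: queue_weight_sum1.
by rewrite lee_fin queue_weight_ge0.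
Qed.

Lemma jffs_kernel_ge0 k l : 0 <= jffs_kernel k l.
Proof. by apply: move_kernel_ge0 => *; rewrite lee_fin jffs_weight_ge0. Qed.

Lemma jffs_kernel_sum1 k : \esum_(l in [set: nat]) jffs_kernel k l = 1.
Proof.
apply: move_kernel_sum1 => [*|i]; last exact: jffs_weight_sum1.
by rewrite lee_fin jffs_weight_ge0.
Qed.

Lemma pair_kernel_ge0 v v' : 0 <= pair_kernel v v'.
Proof. by apply: move_kernel_ge0 => *; rewrite lee_fin pair_weight_ge0. Qed.

Lemma pair_kernel_sum1 v : \esum_(v' in [set: pair_state]) pair_kernel v v' = 1.
Proof.
apply: move_kernel_sum1 => [*|u]; last exact: pair_weight_sum1.
by rewrite lee_fin pair_weight_ge0.
Qed.

(** The separate queues are at rest under both labels [inr true] and [inr false], whose weights add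
    up to that of the trivial step. *)
Lemma pair_kernel_queue (F : state n -> \bar R) (v : pair_state) : (forall y, 0 <= F y) ->
  act pair_kernel (fun v : pair_state => F v.2.2) v = act queue_kernel F v.2.2.
Proof.
move=> F0; case: v => c [k x] /=.
have w0 l : 0 <= (pair_weight (c, (k, x)) l)%:E by rewrite lee_fin pair_weight_ge0.
have q0 l : 0 <= (queue_weight x l)%:E by rewrite lee_fin queue_weight_ge0.
rewrite !act_move_kernel//; try by move=> *; rewrite lee_fin ?pair_weight_ge0 ?queue_weight_ge0.
rewrite esum_label => [|l]; last by rewrite mule_ge0.
rewrite [RHS]esum_label => [|l]; last by rewrite mule_ge0.
congr (_ + _); rewrite -ge0_muleDl// mul0e add0e -EFinD; congr (_%:E * _) => /=.
by ring.
Qed.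

(** On equal totals, matched and additional departures add up to rate [DZ k]. Otherwise departures
    from the queues leave the pooled system at rest and join the trivial step. *)
Lemma pair_kernel_jffs (F : nat -> \bar R) (v : pair_state) : (forall i, 0 <= F i) ->
  act pair_kernel (fun v : pair_state => F v.2.1) v = act jffs_kernel F v.2.1.
Proof.
move=> F0; case: v => c [k x] /=.
have w0 l : 0 <= (pair_weight (c, (k, x)) l)%:E by rewrite lee_fin pair_weight_ge0.
have q0 l : 0 <= (jffs_weight k l)%:E by rewrite lee_fin jffs_weight_ge0.
have x0 l : 0 <= (queue_weight x l)%:E by rewrite lee_fin queue_weight_ge0.
rewrite !act_move_kernel//; try by move=> *; rewrite lee_fin ?pair_weight_ge0 ?jffs_weight_ge0.
rewrite esum_label => [|l]; last by rewrite mule_ge0.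
rewrite [RHS]esum_sum_type => [|l]; last by rewrite mule_ge0.
rewrite esum_bool => [|l]; last by rewrite mule_ge0.
rewrite esum_unit; last by rewrite mule_ge0.
rewrite (ge0_esumZr _ (F0 _) (fun c => x0 (inl (inl c)))) esum_queue_arrivals.
rewrite (ge0_esumZr _ (F0 _) (fun c => x0 (inl (inr c)))) esum_queue_departures.
rewrite -!addeA; congr (_ + _) => /=.
have d0 := w0 (inr true); have s0 := w0 (inr false); rewrite /= in d0 s0.
have e0 : 0 <= (DX x / La)%:E.
  by rewrite -esum_queue_departures; apply: esum_ge0 => l _; exact: x0.
case: ifP d0 s0 => _ d0 s0.
  rewrite addeA -ge0_muleDl// -EFinD; congr (_%:E * _ + _%:E * _); ring.
rewrite addeCA -ge0_muleDl// -EFinD; congr (_%:E * _ + _%:E * _); ring.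
Qed.

Lemma pair_kernel_counter v v' : pair_kernel v v' != 0 -> v'.1 = v.1.+1.
Proof. by move=> /move_kernel_neq0[l _ <-]. Qed.

(** The queues lose a job without a pooled departure only when [k] is strictly below their total.
    Positive weight of the label ensures that [add_at] and [sub_at] really change the total by
    one. *)
Lemma pair_kernel_order (v v' : pair_state) : pair_kernel v v' != 0 ->
  (v.2.1 <= total_jobs v.2.2)%N -> (v'.2.1 <= total_jobs v'.2.2)%N.
Proof.
case: v => c [k x] /move_kernel_neq0[l wl <-]; rewrite /= => kx.
have neq0 (u w : R) : (u * w)%:E != 0 -> w != 0%R.
  by apply: contraNneq => ->; rewrite mulr0.
case: l wl => [[d|d]|[]] /=.
- move=> /neq0/(arrival_weight_neq0 ha)[d0 dx].
  by rewrite (total_jobs_incr d0 dx).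
- move=> /neq0/departure_weight_neq0[d0 dx].
  have := total_jobs_incr d0 dx => e; case: eqP => kx'.
    by rewrite kx' e.
  by rewrite -ltnS -e ltn_neqAle kx andbT; apply/eqP.
- by move=> _; apply: leq_trans kx; exact: leq_pred.
- by [].
Qed.

Lemma jffs_kernel_rate k l : k != l ->
  (jffs_rates N lambda mu gamma k l)%:E = La%:E * jffs_kernel k l.
Proof.
move=> kl; have w0 i : 0 <= (jffs_weight k i)%:E by rewrite lee_fin jffs_weight_ge0.
have t0 i : 0 <= (jffs_weight k i)%:E * delta l (jffs_move k i) by apply: mule_ge0; [exact: w0|exact: delta_ge0].
rewrite /jffs_kernel /move_kernel esum_sum_type// esum_bool//.
rewrite esum_unit; last exact: (t0 (inr tt)).
rewrite /= /delta.
apply: (congr1 EFin (y := (La * (N%:R * lambda / La * (k.+1 == l)%:R +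
  DZ k / La * (k.-1 == l)%:R + (1 - N%:R * lambda / La - DZ k / La) * (k == l)%:R))%R)).
rewrite (negPf kl) mulr0 addr0.
rewrite /jffs_rates; case: (eqVneq l k.+1) => [e|lk].
  rewrite e (_ : (k.-1 == k.+1) = false) ?mulr0 ?addr0; last first.
    by rewrite ltn_eqF// (leq_ltn_trans (leq_pred k)).
  by rewrite mulr1 mulrCA mulfV// mulr1.
rewrite mulr0 add0r.
case: (eqVneq k l.+1) => [->|kl1] /=; first by rewrite eqxx mulr1 mulrCA mulfV// mulr1.
(* At [k = 0] the downward move is a self-loop, excluded by [k != l]. *)
have -> : (k.-1 == l) = false.
  by case: k kl kl1 {w0 t0 lk} => [|k] /= kl; [rewrite (negPf kl)|rewrite eqSS => /negPf].
by rewrite !mulr0.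
Qed.

(** Distinct states differ by at most one elementary move of each direction, so the label sums
    reduce to the terms of [queue_rates]. *)
Lemma queue_kernel_rate x y : x != y ->
  (queue_rates N lambda mu a x y)%:E = La%:E * queue_kernel x y.
Proof.
move=> xy; have La0 := uniform_rate_gt0.
have w0 l : 0 <= (queue_weight x l)%:E by rewrite lee_fin queue_weight_ge0.
have t0 l : 0 <= (queue_weight x l)%:E * delta y (queue_move x l).
  by apply: mule_ge0; [exact: w0|exact: delta_ge0].
rewrite /queue_kernel /move_kernel esum_label//=.
rewrite ![delta y x]/delta (negPf xy) !mule0 !adde0.
rewrite ge0_muleDr; last 2 first.
- by apply: esum_ge0 => c _; exact: (t0 (inl (inl c))).
- by apply: esum_ge0 => c _; exact: (t0 (inl (inr c))).
rewrite -!ge0_esumZl ?lee_fin ?(ltW La0)//; last 2 first.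
- by move=> c; exact: (t0 (inl (inr c))).
- by move=> c; exact: (t0 (inl (inl c))).
rewrite /queue_rates EFinD; congr (_ + _).
  rewrite [LHS](_ : _ = (\sum_(c \in coords `&` [set c | incr_at c x y])
    (N%:R * lambda * arrival_weight a x c))%R%:E); last first.
    by congr EFin; apply: eq_fsbigr => c /set_mem[c0 _]; rewrite /arrival_weight ifT.
  rewrite -esum_subsingleton; last 2 first.
  - by move=> c; rewrite mulr_ge0 ?arrival_weight_ge0// mulr_ge0// ltW.
  - by move=> c c' [_ h] [_ h']; exact: incr_at_coord h h'.
  rewrite esum_mkcond; apply: eq_esum => c _; rewrite /delta -!EFinM.
  case: ifPn => [/set_mem[c0 cxy]|].
    have -> : (add_at c x == y) = true by apply/eqP/add_at_eq.
    by congr EFin; rewrite /=; field.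
  rewrite notin_setE => nc; congr EFin.
  case: eqP => [e|_]; last by rewrite !mulr0.
  rewrite /arrival_weight; case: ifPn => [c0|_]; last by rewrite mulr0 mul0r mulr0.
  by case: nc; split=> //; apply/add_at_eq.
rewrite [LHS](_ : _ = (\sum_(c \in coords `&` [set c | incr_at c y x])
  departure_weight mu x c)%R%:E); last first.
  by congr EFin; apply: eq_fsbigr => c /set_mem[c0 _]; rewrite /departure_weight ifT.
rewrite -esum_subsingleton; last 2 first.
- by move=> c; rewrite departure_weight_ge0.
- by move=> c c' [_ h] [_ h']; exact: incr_at_coord h h'.
rewrite esum_mkcond; apply: eq_esum => c _; rewrite /delta -!EFinM.
case: ifPn => [/set_mem[c0 cxy]|].
  have -> : (sub_at c x == y) = true by apply/eqP/sub_at_eq.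
  by congr EFin; rewrite /=; field.
rewrite notin_setE => nc; congr EFin.
case: eqP => [e|_]; last by rewrite !mulr0.
rewrite /departure_weight; case: ifPn => [c0|_]; last by rewrite mulr0 mul0r mulr0.
by case: nc; split=> //; apply/sub_at_eq.
Qed.

End Coupling.

(** * Coupling from a given initial law, and dominance for all versions *)

Theorem theorem5 (R : realType) (M : nat) (mu gamma : 'I_M -> R)
    (lambda : R) (N : nat) (n : 'I_M -> nat)
    (hM : (0 < M)%N)
    (hmu_pos : forall j, 0 < mu j)
    (hmu_dec : forall i j : 'I_M, (i < j)%N -> mu j < mu i)
    (hgamma : forall j, 0 < gamma j <= 1)
    (hgamma_sum : \sum_(j < M) gamma j = 1)
    (hgamma_mu : \sum_(j < M) gamma j * mu j = 1)
    (hlambda : 0 < lambda)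
    (hN : (0 < N)%N)
    (hn_pos : forall j, (0 < n j)%N)
    (hn : forall j, (n j)%:R = N%:R * gamma j)
    (a : state n -> nat -> 'I_M -> R)
    (ha : stationary_policy a)
    (d0 : measure_display) (Om0 : measurableType d0) (P0 : probability Om0 R)
    (Z0 : Om0 -> nat) (X0 : Om0 -> state n)
    (hZ0 : forall k, measurable [set w | Z0 w = k])
    (hX0 : forall x, measurable [set w | X0 w = x])
    (hZX0 : {ae P0, forall w, (Z0 w <= total_jobs (X0 w))%N}) :
  (exists (d : measure_display) (Om : measurableType d)
     (P : probability Om R) (Z : R -> Om -> nat) (X : R -> Om -> state n),
     [/\ ctmc P (jffs_rates N lambda mu gamma) Z,
         ctmc P (queue_rates N lambda mu a) X,
         forall k x, P [set w | Z 0 w = k /\ X 0 w = x] =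
                     P0 [set w | Z0 w = k /\ X0 w = x] &
         forall t w, 0 <= t -> (Z t w <= total_jobs (X t w))%N]) /\
  (forall (d1 : measure_display) (Om1 : measurableType d1)
     (P1 : probability Om1 R) (Z : R -> Om1 -> nat)
     (d2 : measure_display) (Om2 : measurableType d2)
     (P2 : probability Om2 R) (X : R -> Om2 -> state n),
     ctmc P1 (jffs_rates N lambda mu gamma) Z ->
     ctmc P2 (queue_rates N lambda mu a) X ->
     (forall k, P1 [set w | Z 0 w = k] = P0 [set w | Z0 w = k]) ->
     (forall x, P2 [set w | X 0 w = x] = P0 [set w | X0 w = x]) ->
     forall t, 0 <= t -> st_le P1 P2 (Z t) (fun w => total_jobs (X t w))).
Proof.
  
have gamma0 j : 0 <= gamma j by case/andP: (hgamma j) => /ltW.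
have La0 := @uniform_rate_gt0 R lambda N hlambda hN.
pose Kp := @pair_kernel R M mu gamma lambda N n a.
have Kp0 : (forall v v', 0 <= Kp v v')%E.
  exact: (pair_kernel_ge0 hmu_pos hmu_dec gamma0 hgamma_sum hgamma_mu hlambda hN hn ha).
have Kp1 : (forall v, \esum_(v' in [set: nat * (nat * state n)]) Kp v v' = 1)%E.
  exact: (pair_kernel_sum1 hmu_pos hmu_dec gamma0 hgamma_sum hgamma_mu hlambda hN hn ha).
have Kq0 := queue_kernel_ge0 hmu_pos hgamma_mu hlambda hN hn ha.
have Kq1 := queue_kernel_sum1 hmu_pos hgamma_mu hlambda hN hn ha.
have Kz0 := jffs_kernel_ge0 hmu_pos gamma0 hgamma_mu hlambda hN.
have Kz1 := jffs_kernel_sum1 hmu_pos gamma0 hgamma_mu hlambda hN.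
have qX := queue_kernel_rate hmu_pos hgamma_mu hlambda hN hn ha.
have qZ := jffs_kernel_rate hmu_pos gamma0 hgamma_mu hlambda hN.
pose Y0 w := (Z0 w, X0 w).
have mY0 v : measurable [set w | Y0 w = v].
  rewrite (_ : [set w | _] = [set w | Z0 w = v.1] `&` [set w | X0 w = v.2]).
    exact: measurableI.
  by apply/seteqP; split=> w /=; [case: v => ? ? [-> ->]|case: v => ? ? [/= <- <-]].
(* The counter starts at 0, and the other coordinates have the given joint law. *)
pose nu (v : nat * (nat * state n)) : \bar R :=
  if v.1 == 0%N then P0 [set w | Y0 w = v.2] else 0%E.
have nu0 v : (0 <= nu v)%E by rewrite /nu; case: ifP.
have nu1 : (\esum_(v in [set: nat * (nat * state n)]) nu v = 1)%E.
  rewrite esum_pair// (@esum_single _ _ _ 0%N)//=; last 2 first.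
  - by apply: esum_ge0.
  - by move=> c /negPf c0; apply: esum1 => p _; rewrite /nu/= c0.
  rewrite /nu/= -(countable_valued_prob P0 mY0 setT); exact: probability_setT.
have [v0 _] : exists v, nu v != 0%E.
  by apply: (@esum_neq0 R _ [set: nat * (nat * state n)]); rewrite nu1.
have KC v v' : Kp v v' != 0%E -> v'.1 = v.1.+1 by exact: pair_kernel_counter.
pose G := [set v : nat * (nat * state n) | (v.2.1 <= total_jobs v.2.2)%N].
have KG v v' : Kp v v' != 0%E -> G v -> G v' by exact: (pair_kernel_order ha).
(* An initial pair that violates the order lies in the exceptional null set and so has mass 0: the
   almost sure order becomes an order on the whole support. *)
have nuG v : nu v != 0%E -> G v.
  rewrite /nu; case: (v.1 == 0%N); last by rewrite eqxx.
  move=> nuv; rewrite /G/= leqNgt; apply/negP => kx.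
  case/negP: nuv; apply/eqP.
  have [B [mB PB sB]] := hZX0.
  apply/eqP; rewrite -measure_le0 -PB; apply: le_measure; rewrite ?inE//.
  by move=> w /= Yw; apply: sB => /=; move: kx; rewrite -Yw/= ltnNge => /negP.
pose W := chain_val v0 Kp0 Kp1 La0 nu0 nu1.
pose Z t w := (W t w).2.1; pose X t w := (W t w).2.2.
have cZ : ctmc unit_lebesgue (jffs_rates N lambda mu gamma) Z.
  apply: (chain_ctmc v0 Kp0 Kp1 La0 nu0 nu1 (f := fun v => v.2.1) KC Kz0 Kz1) => // F F0 v.
  exact: (pair_kernel_jffs hmu_pos hmu_dec gamma0 hgamma_sum hgamma_mu hlambda hN hn ha).
have cX : ctmc unit_lebesgue (queue_rates N lambda mu a) X.
  apply: (chain_ctmc v0 Kp0 Kp1 La0 nu0 nu1 (f := fun v => v.2.2) KC Kq0 Kq1) => // F F0 v.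
  exact: (pair_kernel_queue hmu_pos hmu_dec gamma0 hgamma_sum hgamma_mu hlambda hN hn ha).
have ZX t w : 0 <= t -> (Z t w <= total_jobs (X t w))%N.
  exact: (chain_support v0 Kp0 Kp1 La0 nu0 nu1 KC KG nuG).
pose W0 w := (W 0 w).2.
have mW v : measurable [set w | W 0 w = v].
  exact: (chain_measurable v0 Kp0 Kp1 La0 nu0 nu1 KC KG nuG).
have mW0 p : measurable [set w | W0 w = p].
  exact: (countable_valued_measurable mW [set v | v.2 = p]).
have initE p : unit_lebesgue [set w | W0 w = p] = P0 [set w | Y0 w = p].
  apply: (etrans (countable_valued_prob unit_lebesgue mW [set v | v.2 = p])).
  transitivity (\esum_(v in [set v | v.2 = p]) nu v)%E.
    by apply: eq_esum => v _; exact: (chain_init v0 Kp0 Kp1 La0 nu0 nu1 KC KG nuG).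
  rewrite esum_mkcond esum_pair => [|v]; last by case: ifP.
  rewrite (@esum_single _ _ _ 0%N)//=; last 2 first.
  - by apply: esum_ge0 => q _; case: ifP.
  - move=> c /negPf c0; apply: esum1 => q _; rewrite /nu/= c0; by case: ifP.
  rewrite (@esum_single _ _ _ p)//=.
  - by rewrite ifT ?inE.
  - by case: ifP.
  - by move=> q qp; case: ifPn => //; rewrite inE /= => e; move: qp; rewrite e eqxx.
have initA A : unit_lebesgue [set w | A (W0 w)] = P0 [set w | A (Y0 w)].
  apply: (etrans (countable_valued_prob unit_lebesgue mW0 A)).
  by rewrite (countable_valued_prob P0 mY0 A); apply: eq_esum => p _; exact: initE.
split.
  exists _, _, unit_lebesgue, Z, X; split=> // k x.
  apply: etrans (etrans (initE (k, x)) _); congr (_ _); apply/seteqP; split=> w /=.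
  - by rewrite /Z /X /W0; case: (W 0 w).2 => ? ? [/= -> ->].
  - by rewrite /Z /X /W0 => ->.
  - by move=> [-> ->].
  - by rewrite /Y0 => -[-> ->].
move=> d1 Om1 P1 Z1 d2 Om2 P2 X2 cZ1 cX2 Z10 X20 t t0 k.
have mX y : measurable [set w | X t w = y] by case: cX => + _ _; apply.
have mZ y : measurable [set w | Z t w = y] by case: cZ => + _ _; apply.
(* The given versions have the same initial laws as the coupled marginals, hence the same laws at
   time [t]; the tail events of the coupled chains are then nested. *)
have iZ l : P1 [set w | Z1 0 w = l] = unit_lebesgue [set w | Z 0 w = l].
  by rewrite Z10; apply/esym; exact: (initA [set p | p.1 = l]).
have iX x : P2 [set w | X2 0 w = x] = unit_lebesgue [set w | X 0 w = x].
  by rewrite X20; apply/esym; exact: (initA [set p | p.2 = x]).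
rewrite (ctmc_law_unique Kz0 Kz1 La0 qZ [set l | (k < l)%N] cZ1 cZ iZ t0).
rewrite (ctmc_law_unique Kq0 Kq1 La0 qX [set x | (k < total_jobs x)%N] cX2 cX iX t0).
apply: le_measure; rewrite ?inE.
- exact: (countable_valued_measurable mZ).
- exact: (countable_valued_measurable mX [set x | (k < total_jobs x)%N]).
- by move=> w /= kZ; apply: leq_trans kZ _; exact: ZX.
Qed.
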